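(* Let $E$ and $F$ be infinite-dimensional Banach spaces, and let $1\le p<q<\infty$ and $1\le s\le\infty$. Suppose that $\mathcal K_q(\ell_1,\overline{\ell}_s)\setminus\mathcal K_p(\ell_1,\overline{\ell}_s)$ is non-empty and that $\ell_s^n$ embed uniformly in $F$. Then, for every integer $k\ge2$, the set $\mathcal P_{\mathcal K_q}(^kE,F)\setminus\mathcal P_{\mathcal K_p}(^kE,F)$ is empty or spaceable (as a subset of the Banach space $(\mathcal P_{\mathcal K_q}(^kE,F),\|\cdot\|_{\mathcal P_{\mathcal K_q}})$).
   Context: Banach spaces are over $\mathbb K=\mathbb R$ or $\mathbb C$; $B_E$ is the open unit ball of $E$; $\overline{\ell}_s=\ell_s$ if $s<\infty$ and $\overline{\ell}_\infty=c_0$; $\ell_s^n$ is $\mathbb K^n$ with the $\ell_s$-norm. For $1\le p<\infty$ with conjugate index $p'$, a set $K\subset F$ is (relatively) $p$-compact if there is a sequence $(x_n)_n$ in $F$ with $\sum_n\|x_n\|^p<\infty$ and $K\subset\{\sum_n\alpha_nx_n:(\alpha_n)_n\in B_{\ell_{p'}}\}$; $m_p(K;F)$ is the infimum of $(\sum_n\|x_n\|^p)^{1/p}$ over all such sequences. $\mathcal K_p(E,F)$ is the space of bounded linear $T:E\to F$ with $T(B_E)$ $p$-compact. A $k$-homogeneous polynomial $P:E\to F$ is a map of the form $P(x)=\widehat P(x,\dots,x)$ with $\widehat P$ a continuous symmetric $k$-linear map; it is $p$-compact if $P(B_E)$ is $p$-compact, and $\mathcal P_{\mathcal K_p}(^kE,F)$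 is the Banach space of these with norm $\|P\|_{\mathcal P_{\mathcal K_p}}=m_p(P(B_E);F)$. $\ell_s^n$ embed uniformly in $F$ if there are subspaces $F_n\subset F$ ($n\in\mathbb N$) with $\sup_nd(F_n,\ell_s^n)<\infty$, $d$ being the Banach–Mazur distance. A subset $A$ of a topological vector space $X$ is spaceable if $A\cup\{0\}$ contains a closed infinite-dimensional linear subspace of $X$. *)

(* Defs.v *)
From HB Require Import structures.
From mathcomp Require Import all_boot all_order all_algebra.
From mathcomp Require Import perm complex ring lra.
From mathcomp Require Import all_classical all_reals all_analysis.

Set Implicit Arguments.
Unset Strict Implicit.
Unset Printing Implicit Defensive.

Import Order.TTheory GRing.Theory Num.Theory.
Import numFieldNormedType.Exports.

Local Open Scope classical_set_scope.
Local Open Scope ring_scope.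

(* Spaces over R or C are treated uniformly as spaces over scalars R b; norms
   take their values in scalars R b, hence real_part and rnorm below. *)
Variant scalar_kind := RealScalars | ComplexScalars.

Definition scalars (R : realType) (b : scalar_kind) : numFieldType :=
  match b with
  | RealScalars => R : numFieldType
  | ComplexScalars => R[i] : numFieldType
  end.
Arguments scalars : simpl never.

Definition real_part (R : realType) (b : scalar_kind) : scalars R b -> R :=
  match b return scalars R b -> R with
  | RealScalars => fun x => x
  | ComplexScalars => fun z => complex.Re z
  end.
Arguments real_part : simpl never.

Definition of_real (R : realType) (b : scalar_kind) : R -> scalars R b :=
  match b return R -> scalars R b with
  | RealScalars => fun x => x
  | ComplexScalars => fun x => complex.Complex x 0
  end.
Arguments of_real : simpl never.

Section scalars_theory.
Context {R : realType} {b : scalar_kind}.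
Local Notation K := (scalars R b).

Lemma of_realK (r : R) : real_part (of_real b r) = r.
Proof. by case: b. Qed.

Lemma of_real_inj : injective (of_real b : R -> K).
Proof. exact: can_inj of_realK. Qed.

Lemma of_realD (r t : R) : of_real b (r + t) = of_real b r + of_real b t.
Proof. by case: b => //; apply/eqP; rewrite eq_complex /= eqxx addr0 eqxx. Qed.

Lemma of_realM (r t : R) : of_real b (r * t) = of_real b r * of_real b t.
Proof.
case: b => //; apply/eqP; rewrite eq_complex /=.
by rewrite !mulr0 mul0r subr0 addr0 !eqxx.
Qed.

Lemma of_real0 : of_real b (0 : R) = 0.
Proof. by case: b. Qed.

Lemma of_real_neq0 (r : R) : 0 < r -> of_real b r != 0.
Proof.
move=> r0; apply/eqP; rewrite -of_real0 => /of_real_inj r_eq0.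
by rewrite r_eq0 ltxx in r0.
Qed.

Lemma of_real1 : of_real b (1 : R) = 1.
Proof. by case: b. Qed.

Lemma ler_of_real (r t : R) : (of_real b r <= of_real b t) = (r <= t).
Proof. by case: b => //; rewrite /of_real lecE /= eqxx. Qed.

Lemma ltr_of_real (r t : R) : (of_real b r < of_real b t) = (r < t).
Proof. by case: b => //; rewrite /of_real ltcE /= eqxx. Qed.

Lemma of_real_part (z : K) : 0 <= z -> of_real b (real_part z) = z.
Proof.
move: z; rewrite /scalars /of_real /real_part; case: b => // -[x y].
by rewrite lecE /= => /andP[/eqP -> _].
Qed.

End scalars_theory.

(* The norm of a normed module over scalars R b, as an element of R. *)
Definition rnorm (R : realType) (b : scalar_kind)
  (V : normedModType (scalars R b)) (x : V) : R := real_part `|x|.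

Definition open_unit_ball (R : realType) (b : scalar_kind)
  (V : normedModType (scalars R b)) : set V := [set x | rnorm x < 1].
Arguments open_unit_ball {R b} V.

Section rnorm_theory.
Context {R : realType} {b : scalar_kind} {V : normedModType (scalars R b)}.
Local Notation K := (scalars R b).
Implicit Types x y : V.

Lemma of_rnorm x : of_real b (rnorm x) = `|x|.
Proof. exact: of_real_part. Qed.

Lemma rnorm_ge0 x : 0 <= rnorm x.
Proof. by rewrite -(ler_of_real (b := b)) of_rnorm of_real0. Qed.

Lemma rnormD x y : rnorm (x + y) <= rnorm x + rnorm y.
Proof. by rewrite -(ler_of_real (b := b)) of_realD !of_rnorm ler_normD. Qed.

Lemma rnorm0 : rnorm (0 : V) = 0.
Proof. by rewrite /rnorm normr0 -of_real0 of_realK. Qed.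

Lemma rnorm0_eq0 x : rnorm x = 0 -> x = 0.
Proof. by move=> x0; apply/normr0_eq0; rewrite -of_rnorm x0 of_real0. Qed.

Lemma rnorm_sum (I : Type) (r : seq I) (P : pred I) (f : I -> V) :
  rnorm (\sum_(i <- r | P i) f i) <= \sum_(i <- r | P i) rnorm (f i).
Proof.
elim/big_ind2 : _ => //; first by rewrite rnorm0.
by move=> x u y v xu yv; rewrite (le_trans (rnormD _ _))// lerD.
Qed.

End rnorm_theory.

Lemma rnormZ (R : realType) (b : scalar_kind) (V : normedModType (scalars R b))
    (a : scalars R b) (x : V) : rnorm (a *: x) = rnorm (a : (scalars R b)^o) * rnorm x.
Proof.
apply: (@of_real_inj R b); by rewrite of_realM !of_rnorm normrZ.
Qed.

Lemma rnorm_of_real (R : realType) (b : scalar_kind) (r : R) :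
  rnorm (of_real b r : (scalars R b)^o) = `|r|.
Proof.
wlog r0 : r / 0 <= r => [h|].
  have [/h//|/ltW r0] := leP 0 r.
  have : of_real b (- r) = - of_real b r.
    by apply/eqP; rewrite -addr_eq0 -of_realD addNr of_real0.
  move/(congr1 (@rnorm R b (scalars R b)^o)).
  by rewrite (h (- r)) ?oppr_ge0// normrN /rnorm normrN => <-.
have z0 : 0 <= of_real b r by rewrite -(of_real0 (R := R)) ler_of_real.
by rewrite /rnorm !ger0_norm ?of_realK//.
Qed.

Section vector_subspaces.
Context {K : numFieldType} {V : lmodType K}.
Implicit Type W : set V.

Definition linear_subspace W :=
  W 0 /\ forall (a : K) x y, W x -> W y -> W (a *: x + y).

(* W is contained in the span of finitely many vectors. *)
Definition finite_dimensional W := exists n (e : 'I_n -> V),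
  W `<=` [set x | exists c : 'I_n -> K, x = \sum_(i < n) c i *: e i].

End vector_subspaces.

(* A linear subspace of V with a norm of its own, which need not be defined
   from a norm of V, made into a normedModType below. *)
Record normed_subspace (R : realType) (b : scalar_kind)
    (V : lmodType (scalars R b)) := NormedSubspace {
  ns_dom : set V ;
  ns_norm : V -> R ;
  ns_linear : linear_subspace ns_dom ;
  ns_normD : forall x y, ns_dom x -> ns_dom y ->
    ns_norm (x + y) <= ns_norm x + ns_norm y ;
  ns_normZ : forall (a : scalars R b) x, ns_dom x ->
    ns_norm (a *: x) = rnorm (a : (scalars R b)^o) * ns_norm x ;
  ns_norm0_eq0 : forall x, ns_dom x -> ns_norm x = 0 -> x = 0 }.

Section normed_subspace_type.
Context {R : realType} {b : scalar_kind} {V : lmodType (scalars R b)}.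
Local Notation K := (scalars R b).
Variable S : normed_subspace V.

Definition ns_pred : {pred V} := fun x => `[< ns_dom S x >].

Definition ns_type := {x : V | x \in ns_pred}.

HB.instance Definition _ := [isSub of ns_type for @sval _ _].
HB.instance Definition _ := [Choice of ns_type by <:].

Lemma ns_pred_submod : submod_closed ns_pred.
Proof.
have [W0 WD] := ns_linear S; split; first exact/asboolP.
by move=> a x y /asboolP Wx /asboolP Wy; apply/asboolP/WD.
Qed.
HB.instance Definition _ := GRing.isSubmodClosed.Build K V ns_pred ns_pred_submod.
HB.instance Definition _ := [SubChoice_isSubLmodule of ns_type by <:].

Lemma ns_domP (x : ns_type) : ns_dom S (\val x).
Proof. by apply/asboolP; exact: (valP x). Qed.

Let K_norm (x : ns_type) : K := of_real b (ns_norm S (\val x)).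

Let K_normD x y : K_norm (x + y) <= K_norm x + K_norm y.
Proof.
rewrite /K_norm raddfD/= -of_realD ler_of_real.
by apply: ns_normD; exact: ns_domP.
Qed.

Let K_normZ (a : K) x : K_norm (a *: x) = `|a| * K_norm x.
Proof.
rewrite /K_norm linearZ/= ns_normZ; last exact: ns_domP.
by rewrite of_realM (of_rnorm (a : K^o)).
Qed.

Let K_norm0_eq0 x : K_norm x = 0 -> x = 0.
Proof.
rewrite /K_norm -(of_real0 (R := R) (b := b)) => /of_real_inj x0.
by apply/val_inj; rewrite raddf0; apply: (@ns_norm0_eq0 _ _ _ S); first exact: ns_domP.
Qed.

HB.instance Definition _ :=
  @Lmodule_isNormed.Build K ns_type K_norm K_normD K_normZ K_norm0_eq0.

Lemma rnorm_nsE (x : ns_type) : rnorm x = ns_norm S (\val x).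
Proof. exact: of_realK. Qed.

End normed_subspace_type.
Arguments ns_type {R b V} S.

Definition ns_normedModType (R : realType) (b : scalar_kind)
  (V : lmodType (scalars R b)) (S : normed_subspace V) :
  normedModType (scalars R b) := ns_type S.

(* The l_s norm, 1 <= s <= +oo, of a family of nonnegative reals; [set 0] only
   matters for the empty family, whose supremum would be -oo. *)
Definition lnorm (R : realType) (s : \bar R) (I : choiceType) (u : I -> R) :
    \bar R :=
  if s is r%:E then ((\esum_(i in [set: I]) (u i `^ r)%:E) `^ r^-1)%E
  else ereal_sup ([set 0%E] `|` [set (u i)%:E | i in [set: I]]).

Section lnorm_theory.
Context {R : realType} {I : choiceType}.
Implicit Types (s : \bar R) (u v : I -> R) (A B c : R).

Lemma esum_leP (a : I -> \bar R) (x : \bar R) :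
  (forall X : set I, finite_set X -> \sum_(i \in X) a i <= x)%E ->
  (\esum_(i in [set: I]) a i <= x)%E.
Proof. by move=> h; apply: ge_ereal_sup => _ [X [fX _] <-]; exact: h. Qed.

Lemma le_esumZ c (a : I -> \bar R) (x : \bar R) : 0 <= c ->
  (forall i, 0 <= a i)%E -> (\esum_(i in [set: I]) a i <= x)%E ->
  (\esum_(i in [set: I]) (c%:E * a i) <= c%:E * x)%E.
Proof.
move=> c0 a0 ax; apply: esum_leP => X fX.
rewrite -ge0_mule_fsumr//; apply: lee_wpmul2l; first by rewrite lee_fin.
by apply: le_trans ax; apply: esum_ge; exists X.
Qed.

Lemma lnorm_leP (r A : R) u : 0 < r -> 0 <= A ->
  ((lnorm r%:E u <= A%:E) = (\esum_(i in [set: I]) (u i `^ r)%:E <= (A `^ r)%:E))%E.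
Proof.
move=> r0 A0; rewrite /lnorm.
have e0 : (0 <= \esum_(i in [set: I]) (u i `^ r)%:E)%E.
  by apply: esum_ge0 => i _; rewrite lee_fin powR_ge0.
apply/idP/idP => h.
- rewrite -[leLHS]poweRe1// -(mulVf (lt0r_neq0 r0)) poweRrM -poweR_EFin.
  by apply: gt0_ler_poweR => //; rewrite ?in_itv/= ?leey ?andbT ?poweR_ge0// ltW.
- rewrite -[leRHS]poweRe1// -(mulfV (lt0r_neq0 r0)) poweRrM poweR_EFin.
  by apply: gt0_ler_poweR => //; rewrite ?in_itv/= ?leey ?andbT ?lee_fin ?powR_ge0// invr_ge0 ltW.
Qed.

Lemma lnorm_sup_leP A u : 0 <= A ->
  (lnorm +oo u <= A%:E)%E <-> forall i, u i <= A.
Proof.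
move=> A0; split => [h i|h].
  by rewrite -lee_fin; apply: le_trans h; apply: ereal_sup_ubound; right; exists i.
by apply: ge_ereal_sup => _ [->|[i _ <-]]; rewrite lee_fin.
Qed.

Lemma lnorm_ge0 s u : (0 <= lnorm s u)%E.
Proof.
rewrite /lnorm; case: s => [r||]; first exact: poweR_ge0.
all: by apply: ereal_sup_ubound; left.
Qed.

Lemma le_lnorm s u v : (1 <= s)%E -> (forall i, 0 <= u i) ->
  (forall i, u i <= v i) -> (lnorm s u <= lnorm s v)%E.
Proof.
case: s => [r||//] s1 u0 uv; rewrite /lnorm.
- have r0 : 0 < r by rewrite (lt_le_trans ltr01).
  have e0 w : (0 <= \esum_(i in [set: I]) (w i `^ r)%:E)%E.
    by apply: esum_ge0 => i _; rewrite lee_fin powR_ge0.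
  apply: gt0_ler_poweR; rewrite ?in_itv/= ?leey ?andbT//.
    by rewrite invr_ge0 ltW.
  apply: le_esum => i _; rewrite lee_fin.
  have vi0 := le_trans (u0 i) (uv i).
  by apply: ge0_ler_powR; rewrite ?nnegrE// ltW.
- apply: ge_ereal_sup => _ [->|[i _ <-]]; first by apply: ereal_sup_ubound; left.
  apply: (@le_trans _ _ (v i)%:E); first by rewrite lee_fin.
  by apply: ereal_sup_ubound; right; exists i.
Qed.

Lemma lnorm_coord s u i : (1 <= s)%E -> (forall i, 0 <= u i) ->
  ((u i)%:E <= lnorm s u)%E.
Proof.
case: s => [r||//] s1 u0; last by apply: ereal_sup_ubound; right; exists i.
have r0 : 0 < r by rewrite (lt_le_trans ltr01).
have [->|] := eqVneq (lnorm r%:E u) +oo%E; first exact: leey.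
rewrite -ltey -ge0_fin_numE ?lnorm_ge0// => ufin.
rewrite -(fineK ufin) lee_fin; set A := fine _.
have A0 : 0 <= A by rewrite fine_ge0// lnorm_ge0.
have := lexx (lnorm r%:E u); rewrite -{2}(fineK ufin) lnorm_leP// => h.
have {h} : u i `^ r <= A `^ r.
  rewrite -lee_fin; apply: le_trans h; apply: esum_ge; exists [set i].
    by split => //; exact: finite_set1.
  by rewrite fsbig_set1.
by rewrite leNgt => h; rewrite leNgt; apply: contra h => h; rewrite gt0_ltr_powR ?nnegrE.
Qed.

Lemma powRD_le (r A B x y : R) : 1 <= r -> 0 < A -> 0 < B -> 0 <= x -> 0 <= y ->
  (x + y) `^ r <= (A + B) `^ r *
    (A / (A + B) * (x / A) `^ r + B / (A + B) * (y / B) `^ r).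
Proof.
move=> r1 A0 B0 x0 y0; have r0 : 0 < r by rewrite (lt_le_trans ltr01).
have AB0 : 0 < A + B by rewrite addr_gt0.
have t0 : 0 <= A / (A + B) by rewrite divr_ge0 ?ltW.
have t1 : A / (A + B) <= 1 by rewrite ler_pdivrMr// mul1r lerDl ltW.
have tE : unstable.onem (A / (A + B)) = B / (A + B).
  by rewrite /unstable.onem; field; rewrite gt_eqF.
have mem z : 0 <= z -> z \in (`[0, +oo[%classic : set R).
  by move=> z0; rewrite inE/= in_itv/= andbT.
have := @convex_powR R r r1 (Itv01 t0 t1) (x / A) (y / B).
move=> /(_ (mem _ (divr_ge0 x0 (ltW A0))) (mem _ (divr_ge0 y0 (ltW B0)))).
move=> h; rewrite convRE [X in X `^ _ <= _]convRE /= tE in h.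
have -> : x + y = (A + B) * (A / (A + B) * (x / A) + B / (A + B) * (y / B)).
  by field; rewrite !gt_eqF.
have d0 : 0 <= A / (A + B) * (x / A) + B / (A + B) * (y / B).
  by rewrite addr_ge0// mulr_ge0 ?divr_ge0// ltW.
rewrite powRM ?(ltW AB0)//; apply: ler_wpM2l; first exact: powR_ge0.
exact: h.
Qed.

Lemma lnormZ_le s c u A : (1 <= s)%E -> 0 <= c -> 0 <= A -> (forall i, 0 <= u i) ->
  (lnorm s u <= A%:E)%E -> (lnorm s (fun i => c * u i)%R <= (c * A)%:E)%E.
Proof.
case: s => [r||//] s1 c0 A0 u0.
- have r0 : 0 < r by rewrite (lt_le_trans ltr01).
  rewrite !lnorm_leP ?mulr_ge0// powRM// EFinM => h.
  under eq_esum do rewrite powRM// EFinM.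
  by apply: le_esumZ; rewrite ?powR_ge0// => i; rewrite lee_fin powR_ge0.
- move=> /(lnorm_sup_leP _ A0) h.
  by apply/lnorm_sup_leP; rewrite ?mulr_ge0// => i; rewrite ler_wpM2l.
Qed.

Lemma lnorm0 s : (1 <= s)%E -> lnorm s (fun _ : I => 0 : R) = 0%E.
Proof.
move=> s1; apply/eqP; rewrite eq_le lnorm_ge0 andbT.
case: s s1 => [r||//] s1.
- have r0 : 0 < r by rewrite (lt_le_trans ltr01).
  rewrite lnorm_leP// powR0 ?lt0r_neq0//.
  by rewrite esum1.
- by apply/lnorm_sup_leP.
Qed.

Lemma lnormZ s c u : (1 <= s)%E -> 0 <= c -> (forall i, 0 <= u i) ->
  (lnorm s u < +oo)%E -> lnorm s (fun i => c * u i)%R = (c%:E * lnorm s u)%E.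
Proof.
move=> s1 c0 u0 uy; have ufin : lnorm s u \is a fin_num.
  by rewrite ge0_fin_numE// lnorm_ge0.
have [->|c_neq0] := eqVneq c 0.
  by rewrite mul0e; under eq_fun do rewrite mul0r; rewrite lnorm0.
have cpos : 0 < c by rewrite lt_neqAle eq_sym c_neq0.
have le1 : (lnorm s (fun i => c * u i)%R <= c%:E * lnorm s u)%E.
  rewrite -(fineK ufin) -EFinM; apply: lnormZ_le => //.
    by rewrite fine_ge0// lnorm_ge0.
  by rewrite fineK.
apply/eqP; rewrite eq_le le1/=.
have cfin : lnorm s (fun i => c * u i)%R \is a fin_num.
  rewrite ge0_fin_numE ?lnorm_ge0//; apply: (le_lt_trans le1).
  by rewrite -(fineK ufin) -EFinM ltry.
rewrite muleC -lee_pdivlMr// -(fineK cfin) muleC -EFinM.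
have -> : u = fun i => c^-1 * (c * u i) by apply/funext => i; rewrite mulKf.
apply: lnormZ_le; rewrite ?invr_ge0 ?fine_ge0 ?lnorm_ge0//.
- by move=> i; rewrite mulr_ge0.
- have -> : (fun i => c * (c^-1 * (c * u i))) = fun i => c * u i.
    by apply/funext => i; rewrite mulKf.
  by rewrite fineK.
Qed.

Lemma lnormD_le s u v A B : (1 <= s)%E -> 0 < A -> 0 < B ->
  (forall i, 0 <= u i) -> (forall i, 0 <= v i) ->
  (lnorm s u <= A%:E)%E -> (lnorm s v <= B%:E)%E ->
  (lnorm s (fun i => u i + v i)%R <= (A + B)%:E)%E.
Proof.
move=> s1 A0 B0 u0 v0 uA vB; have AB0 : 0 < A + B by rewrite addr_gt0.
case: s s1 uA vB => [r||//] s1 uA vB; last first.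
  move: uA vB => /(lnorm_sup_leP _ (ltW A0)) uA /(lnorm_sup_leP _ (ltW B0)) vB.
  by apply/lnorm_sup_leP => [|i]; [exact: ltW|exact: lerD].
have r0 : 0 < r by rewrite (lt_le_trans ltr01).
have nrm w C : 0 < C -> (forall i, 0 <= w i) -> (lnorm r%:E w <= C%:E)%E ->
    (\esum_(i in [set: I]) ((w i / C) `^ r)%:E <= 1)%E.
  move=> C0 w0 wC; have := @lnormZ_le r%:E C^-1 w C s1.
  rewrite invr_ge0 (ltW C0) => /(_ isT isT w0 wC).
  rewrite mulVf ?lt0r_neq0// lnorm_leP// powR1.
  by under eq_esum do rewrite mulrC.
rewrite lnorm_leP ?(ltW AB0)//.
set a := A / (A + B); set b := B / (A + B).
have a0 : 0 <= a by rewrite divr_ge0 ?ltW.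
have b0 : 0 <= b by rewrite divr_ge0 ?ltW.
apply: (@le_trans _ _ (\esum_(i in [set: I])
  (((A + B) `^ r)%:E * (a%:E * ((u i / A) `^ r)%:E + b%:E * ((v i / B) `^ r)%:E))%E)).
  by apply: le_esum => i _; rewrite lee_fin; exact: powRD_le.
rewrite -[leRHS]mule1; apply: le_esumZ; first exact: powR_ge0.
  by move=> i; rewrite lee_fin addr_ge0// mulr_ge0// powR_ge0.
rewrite esumD; [|by move=> i _; rewrite lee_fin mulr_ge0// powR_ge0..].
have -> : 1%E = (a%:E * 1 + b%:E * 1)%E :> \bar R.
  by rewrite !mule1 -EFinD -mulrDl divff// lt0r_neq0.
by apply: leeD; apply: le_esumZ => //; do ?[by move=> i; rewrite lee_fin powR_ge0]; exact: nrm.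
Qed.

Lemma lnormD s u v : (1 <= s)%E ->
  (forall i, 0 <= u i) -> (forall i, 0 <= v i) ->
  (lnorm s (fun i => u i + v i)%R <= lnorm s u + lnorm s v)%E.
Proof.
move=> s1 u0 v0.
have [->|uy] := eqVneq (lnorm s u) +oo%E.
  by rewrite addye ?leey// gt_eqF// (lt_le_trans _ (lnorm_ge0 _ _)).
have [->|vy] := eqVneq (lnorm s v) +oo%E.
  by rewrite addey ?leey// gt_eqF// (lt_le_trans _ (lnorm_ge0 _ _)).
have ufin : lnorm s u \is a fin_num by rewrite ge0_fin_numE ?lnorm_ge0// ltey.
have vfin : lnorm s v \is a fin_num by rewrite ge0_fin_numE ?lnorm_ge0// ltey.
apply/lee_addgt0Pr => e e0.
rewrite -(fineK ufin) -(fineK vfin) -!EFinD [e]splitr addrACA.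
have e20 : 0 < e / 2 by rewrite divr_gt0.
by apply: lnormD_le => //; rewrite ?ltr_wpDl ?fine_ge0 ?lnorm_ge0//
  EFinD fineK// leeDl// lee_fin ltW.
Qed.

End lnorm_theory.

(* The l_s norm of a family of vectors. *)
Definition family_norm (R : realType) (b : scalar_kind)
    (V : normedModType (scalars R b)) (s : \bar R) (I : choiceType)
    (x : I -> V) : \bar R :=
  lnorm s (fun i => rnorm (x i)).

Section family_norm_theory.
Context {R : realType} {b : scalar_kind} {V : normedModType (scalars R b)}.
Context {I : choiceType} {s : \bar R}.
Hypothesis s1 : (1 <= s)%E.
Local Notation K := (scalars R b).
Implicit Types x y : I -> V.

Lemma family_norm_ge0 x : (0 <= family_norm s x)%E.
Proof. exact: lnorm_ge0. Qed.

Lemma family_normD x y :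
  (family_norm s (x + y)%R <= family_norm s x + family_norm s y)%E.
Proof.
apply: le_trans (lnormD s1 _ _); last 2 first.
- by move=> i; exact: rnorm_ge0.
- by move=> i; exact: rnorm_ge0.
by apply: le_lnorm => // i; [exact: rnorm_ge0|exact: rnormD].
Qed.

Lemma family_normZ (a : K) x : (family_norm s x < +oo)%E ->
  family_norm s (a *: x) = ((rnorm (a : K^o))%:E * family_norm s x)%E.
Proof.
move=> xy; rewrite /family_norm -lnormZ ?rnorm_ge0//; last by move=> i; exact: rnorm_ge0.
by congr (lnorm s _); apply/funext => i; rewrite [LHS]rnormZ.
Qed.

Lemma family_norm0_eq0 x : family_norm s x = 0%E -> x = 0.
Proof.
move=> x0; apply/funext => i; apply: rnorm0_eq0; apply/eqP.
rewrite eq_le rnorm_ge0 andbT -lee_fin -[leRHS]x0.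
by apply: (@lnorm_coord _ _ s (fun i => rnorm (x i))) => // j; exact: rnorm_ge0.
Qed.

Lemma family_norm0 : family_norm s (0 : I -> V) = 0%E.
Proof.
rewrite /family_norm -[RHS](@lnorm0 R I s s1); congr lnorm.
by apply/funext => i; exact: rnorm0.
Qed.

Lemma family_norm_fin x : (family_norm s x < +oo)%E -> family_norm s x \is a fin_num.
Proof. by move=> ?; rewrite ge0_fin_numE// family_norm_ge0. Qed.

Lemma family_norm_subspace (W : set (I -> V)) : linear_subspace W ->
  linear_subspace (W `&` [set x | family_norm s x < +oo]%E).
Proof.
move=> [W0 WD]; split => /=; first by rewrite family_norm0.
move=> a x y [Wx /= xy] [Wy /= yy]; split; first exact: WD.
apply: (le_lt_trans (family_normD _ _)); apply: lte_add_pinfty => //.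
by rewrite family_normZ// -(fineK (family_norm_fin xy)) -EFinM ltry.
Qed.

End family_norm_theory.

Section sequence_spaces.
Context (R : realType) (b : scalar_kind).
Local Notation K := (scalars R b).
Variables (s : \bar R) (s1 : (1 <= s)%E) (I : choiceType).

Let ell_dom : set (I -> K^o) := [set x | family_norm s x < +oo]%E.

Let ell_linear : linear_subspace ell_dom.
Proof.
have -> : ell_dom = setT `&` [set x | family_norm s x < +oo]%E by rewrite setTI.
exact: family_norm_subspace.
Qed.

Let ell_normD (x y : I -> K^o) : ell_dom x -> ell_dom y ->
  fine (family_norm s (x + y)) <= fine (family_norm s x) + fine (family_norm s y).
Proof.
move=> xy yy; rewrite -lee_fin EFinD !fineK ?family_norm_fin//.
  exact: family_normD.
by apply: (le_lt_trans (family_normD _ _ _)) => //; exact: lte_add_pinfty.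
Qed.

Let ell_normZ (a : K) (x : I -> K^o) : ell_dom x ->
  fine (family_norm s (a *: x)) = rnorm (a : K^o) * fine (family_norm s x).
Proof.
by move=> xy; rewrite family_normZ// fineM// family_norm_fin.
Qed.

Let ell_norm0_eq0 (x : I -> K^o) : ell_dom x -> fine (family_norm s x) = 0 -> x = 0.
Proof.
move=> xy x0; apply: (family_norm0_eq0 s1).
by rewrite -(fineK (family_norm_fin xy)) x0.
Qed.

(* l_s(I); l_s is the case I = nat, l_s^n the case I = 'I_n. *)
Definition ell : normedModType K :=
  ns_normedModType (NormedSubspace ell_linear ell_normD ell_normZ ell_norm0_eq0).

End sequence_spaces.

Section null_sequences.
Context (R : realType) (b : scalar_kind).
Local Notation K := (scalars R b).

Let c0_dom : set (nat -> K^o) := [set x | x n @[n --> \oo] --> (0 : K^o)].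

Let c0_bounded (x : nat -> K^o) : c0_dom x -> (family_norm +oo x < +oo)%E.
Proof.
move=> /cvgP /cvg_seq_bounded [M [Mreal MP]].
have /MP {}MP : M < `|M| + 1 by rewrite (le_lt_trans (real_ler_norm Mreal))// ltrDl.
apply: (@le_lt_trans _ _ (real_part (`|M| + 1))%:E); last exact: ltry.
have M0 : 0 <= `|M| + 1 by rewrite addr_ge0.
apply/lnorm_sup_leP => [|n]; rewrite -(ler_of_real (b := b)) ?of_real0 of_real_part//.
by rewrite of_rnorm; exact: MP.
Qed.

Let c0_linear : linear_subspace c0_dom.
Proof.
split; first exact: cvg_cst.
move=> a x y x0 y0; have : (a *: x n + y n) @[n --> \oo] --> a *: (0 : K^o) + 0.
  by apply: cvgD => //; exact: cvgZl_tmp.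
by rewrite scaler0 addr0.
Qed.

Let c0_normD (x y : nat -> K^o) : c0_dom x -> c0_dom y ->
  fine (family_norm +oo (x + y)) <= fine (family_norm +oo x) + fine (family_norm +oo y).
Proof.
move=> /c0_bounded xy /c0_bounded yy.
rewrite -lee_fin EFinD !fineK ?family_norm_fin//; first exact: family_normD (leey _) _ _.
by apply: (le_lt_trans (family_normD (leey _) _ _)); exact: lte_add_pinfty.
Qed.

Let c0_normZ (a : K) (x : nat -> K^o) : c0_dom x ->
  fine (family_norm +oo (a *: x)) = rnorm (a : K^o) * fine (family_norm +oo x).
Proof.
by move=> /c0_bounded xy; rewrite (family_normZ (leey _))// fineM// family_norm_fin.
Qed.

Let c0_norm0_eq0 (x : nat -> K^o) : c0_dom x -> fine (family_norm +oo x) = 0 -> x = 0.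
Proof.
move=> /c0_bounded xy x0; apply: (@family_norm0_eq0 _ _ _ _ _ (leey _)).
by rewrite -(fineK (family_norm_fin xy)) x0.
Qed.

Definition c0 : normedModType K :=
  ns_normedModType (NormedSubspace c0_linear c0_normD c0_normZ c0_norm0_eq0).

End null_sequences.

(* l_s if s is finite, c_0 if s = +oo. *)
Definition ell_bar (R : realType) (b : scalar_kind) (s : \bar R) (s1 : (1 <= s)%E) :
    normedModType (scalars R b) :=
  if s == +oo%E then c0 R b else ell b s1 nat.

Section p_compact_sets.
Context (R : realType) (b : scalar_kind) (F : normedModType (scalars R b)).
Local Notation K := (scalars R b).
Implicit Types (p : R) (A : set F) (x : nat -> F).

(* The sums of the series \sum_n a_n x_n, where (a_n)_n ranges over the open
   unit ball of l_p', p' = +oo when p = 1. *)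
Definition p_hull p x : set F :=
  [set y | exists2 a : nat -> K^o,
     (family_norm (hoelder_conjugate p%:E) a < 1)%E &
     series (fun n => a n *: x n) @ \oo --> y].

(* A sequence x witnessing that A is p-compact. *)
Definition p_covers p A x : Prop :=
  (family_norm p%:E x < +oo)%E /\ A `<=` p_hull p x.

Definition p_compact p A : Prop := exists x, p_covers p A x.

(* m_p(A; F); it is +oo when A is not p-compact. *)
Definition p_measure p A : \bar R :=
  ereal_inf [set family_norm p%:E x | x in p_covers p A].

End p_compact_sets.

Section p_compact_theory.
Context {R : realType} {b : scalar_kind} {F : normedModType (scalars R b)}.
Context {p : R}.
Hypothesis p1 : 1 <= p.
Local Notation K := (scalars R b).
Local Notation q := (hoelder_conjugate p%:E).
Implicit Types (A B : set F) (x y : nat -> F) (z : F) (u v : nat -> R).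

Let p0 : 0 < p. Proof. exact: lt_le_trans ltr01 p1. Qed.

Lemma conjugate_cases : (p = 1 /\ q = +oo%E) \/
  exists r : R, [/\ q = r%:E, 1 < p, 1 <= r & r^-1 = 1 - p^-1].
Proof.
have [->|p_neq1] := eqVneq p 1; first by left; rewrite hoelder_conjugate1.
have {}p_gt1 : 1 < p by rewrite lt_neqAle eq_sym p_neq1.
right; exists (p / (p - 1)).
have pB : 0 < p - 1 by rewrite subr_gt0.
split => //.
- rewrite /hoelder_conjugate /= eqe (gt_eqF p0)/= -EFinB inver.
  by rewrite (gt_eqF pB).
- by rewrite ler_pdivlMr// mul1r gerBl.
- by rewrite invf_div mulrBl mul1r divff ?lt0r_neq0.
Qed.

Lemma conjugate_ge1 : (1 <= q)%E.
Proof.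
by have [[_ ->]|[r [-> _ r1 _]]] := conjugate_cases; rewrite ?leey ?lee_fin.
Qed.

Lemma sum_le_esum u (X : R) n : (forall i, 0 <= u i) ->
  (\esum_(i in [set: nat]) (u i)%:E <= X%:E)%E -> \sum_(0 <= i < n) u i <= X.
Proof.
move=> u0; rewrite -nneseries_esumT// -lee_fin -sumEFin; apply: le_trans.
by apply: nneseries_lim_ge => i _ _; rewrite lee_fin.
Qed.

Lemma esum_le_sum u (X : R) : (forall i, 0 <= u i) ->
  (forall n, \sum_(0 <= i < n) u i <= X) ->
  (\esum_(i in [set: nat]) (u i)%:E <= X%:E)%E.
Proof.
move=> u0 uX; rewrite -nneseries_esumT//; apply: lime_le.
  by apply: is_cvg_nneseries => n _ _; rewrite lee_fin.
by apply: nearW => n; rewrite sumEFin lee_fin.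
Qed.

Lemma hoelder_sum u v (X : R) n : (forall i, 0 <= u i) -> (forall i, 0 <= v i) ->
  0 < X -> (lnorm q u <= 1%R%:E)%E -> (lnorm p%:E v <= X%:E)%E ->
  \sum_(0 <= i < n) u i * v i <= X.
Proof.
move=> u0 v0 X0; have [[-> ->]|[r [-> p_gt1 r1 rE]]] := conjugate_cases.
- move=> /(lnorm_sup_leP u ler01) u1; rewrite lnorm_leP ?(ltW X0)// powRr1 ?(ltW X0)// => vX.
  have {vX} : \sum_(0 <= i < n) v i `^ 1 <= X.
    by apply: sum_le_esum => // i; exact: powR_ge0.
  apply: le_trans; apply: ler_sum => i _; rewrite powRr1//.
  by rewrite ler_piMl.
- have r0 : 0 < r by rewrite (lt_le_trans ltr01).
  rewrite (lnorm_leP _ r0 ler01) powR1 => u1 vX.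
  have {}vX : (lnorm p%:E (fun i => X^-1 * v i)%R <= (X^-1 * X)%:E)%E.
    by apply: lnormZ_le; rewrite ?invr_ge0 ?(ltW X0) ?lee_fin.
  move: vX; rewrite mulVf ?lt0r_neq0// (lnorm_leP _ p0 ler01) powR1 => vX.
  rewrite -[leRHS]mulr1 -ler_pdivrMl// mulr_sumr.
  apply: (@le_trans _ _ (r^-1 * (\sum_(0 <= i < n) u i `^ r) +
      p^-1 * (\sum_(0 <= i < n) (X^-1 * v i) `^ p))).
    rewrite !mulr_sumr -big_split /=; apply: ler_sum => i _.
    rewrite mulrCA (mulrC r^-1) (mulrC p^-1); apply: conjugate_powR => //.
      by rewrite mulr_ge0// invr_ge0 ltW.
    by rewrite rE subrK.
  have -> : 1 = r^-1 * 1 + p^-1 * 1 :> R by rewrite !mulr1 rE subrK.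
  apply: lerD; apply: ler_wpM2l; rewrite ?invr_ge0 ?(ltW p0) ?(ltW r0)//.
    by apply: sum_le_esum => // i; exact: powR_ge0.
  by apply: sum_le_esum => // i; exact: powR_ge0.
Qed.

Lemma p_hull_le x z : p_hull p x z -> ((rnorm z)%:E <= family_norm p%:E x)%E.
Proof.
move=> [a a1 ay].
have [->|xy] := eqVneq (family_norm p%:E x) +oo%E; first exact: leey.
have xfin : family_norm p%:E x \is a fin_num.
  by apply: family_norm_fin; rewrite ltey.
apply/lee_addgt0Pr => e e0.
set X := fine (family_norm p%:E x) + e / 2.
have X0 : 0 < X by rewrite ltr_wpDl ?divr_gt0// fine_ge0 ?family_norm_ge0.
have sum_le n : rnorm (series (fun n => a n *: x n) n) <= X.
  apply: (le_trans (rnorm_sum _ _ _)).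
  under eq_bigr do rewrite rnormZ.
  apply: hoelder_sum => //; [by move=> i; exact: rnorm_ge0|by move=> i; exact: rnorm_ge0|exact: ltW|].
  by rewrite EFinD fineK// leeDl// lee_fin ltW// divr_gt0.
have e20 : 0 < of_real b (e / 2).
  by rewrite -(of_real0 (R := R)) ltr_of_real divr_gt0.
have [n _ /(_ n (leqnn n)) yn] := (cvgrPdist_lt _ _).1 ay _ e20.
have {}yn : rnorm (z - series (fun n => a n *: x n) n) < e / 2.
  by rewrite -(ltr_of_real (b := b)) of_rnorm.
rewrite -(fineK xfin) -EFinD lee_fin [e]splitr addrA -/X addrC.
rewrite -[z](subrK (series (fun n => a n *: x n) n)).
by rewrite (le_trans (rnormD _ _))// lerD// ltW.
Qed.

Lemma p_measure_ge0 A : (0 <= p_measure p A)%E.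
Proof. by apply: le_ereal_inf_tmp => _ [x _ <-]; exact: family_norm_ge0. Qed.

Lemma p_measure_le A x : p_covers p A x -> (p_measure p A <= family_norm p%:E x)%E.
Proof. by move=> Ax; apply: ereal_inf_lbound; exists x. Qed.

Lemma p_measure_fin A : p_compact p A -> p_measure p A \is a fin_num.
Proof.
move=> [x Ax]; rewrite ge0_fin_numE ?p_measure_ge0//.
by apply: le_lt_trans (p_measure_le Ax) _; case: Ax.
Qed.

Lemma p_measure_ub A z : A z -> ((rnorm z)%:E <= p_measure p A)%E.
Proof.
by move=> Ay; apply: le_ereal_inf_tmp => _ [x [_ Ax] <-]; exact/p_hull_le/Ax.
Qed.

Lemma p_coversS A B x : A `<=` B -> p_covers p B x -> p_covers p A x.
Proof. by move=> AB [xy Bx]; split => // z /AB; exact: Bx. Qed.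

Lemma p_compactS A B : A `<=` B -> p_compact p B -> p_compact p A.
Proof. by move=> AB [x Bx]; exists x; exact: p_coversS Bx. Qed.

Lemma le_p_measure A B : A `<=` B -> (p_measure p A <= p_measure p B)%E.
Proof.
move=> AB; apply: le_ereal_inf_tmp => _ [x Bx <-].
by apply: p_measure_le; exact: p_coversS Bx.
Qed.

Lemma p_coversZ (a : K) A x : p_covers p A x ->
  p_covers p [set a *: z | z in A] (a *: x).
Proof.
move=> [xy Ax]; split.
  by rewrite family_normZ// -(fineK (family_norm_fin xy)) -EFinM ltry.
move=> _ [z /Ax [c c1 cy] <-]; exists c => //.
rewrite (_ : series _ = a \*: series (fun n => c n *: x n)); first exact: cvgZl_tmp.
apply/funext => n; rewrite /series /= scaler_sumr; apply: eq_bigr => i _.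
by rewrite !scalerA mulrC.
Qed.

Lemma p_compactZ (a : K) A : p_compact p A -> p_compact p [set a *: z | z in A].
Proof. by move=> [x Ax]; exists (a *: x); exact: p_coversZ. Qed.

Lemma p_measureZ_le (a : K) A : p_compact p A ->
  (p_measure p [set a *: z | z in A] <= (rnorm (a : K^o))%:E * p_measure p A)%E.
Proof.
move=> cA; have [->|a0] := eqVneq a 0.
  have -> : rnorm (0 : K^o) = 0 by rewrite rnorm0.
  rewrite mul0e; have [x Ax] := cA.
  apply: (le_trans (p_measure_le (p_coversZ 0 Ax))).
  by rewrite scale0r family_norm0// lee_fin.
have an : 0 < rnorm (a : K^o).
  by rewrite lt_neqAle rnorm_ge0 andbT eq_sym; apply: contra_neq a0; exact: rnorm0_eq0.
rewrite muleC -lee_pdivrMr//; apply: le_ereal_inf_tmp => _ [x Ax <-].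
rewrite lee_pdivrMr// muleC -family_normZ//; last by case: Ax.
by apply: p_measure_le; exact: p_coversZ.
Qed.

Lemma p_measureZ (a : K) A : p_compact p A -> A !=set0 ->
  p_measure p [set a *: z | z in A] = ((rnorm (a : K^o))%:E * p_measure p A)%E.
Proof.
move=> cA [z Az]; apply/eqP; rewrite eq_le p_measureZ_le//=.
have [->|a0] := eqVneq a 0.
  have -> : rnorm (0 : K^o) = 0 by rewrite rnorm0.
  by rewrite mul0e p_measure_ge0.
have an : 0 < rnorm (a : K^o).
  by rewrite lt_neqAle rnorm_ge0 andbT eq_sym; apply: contra_neq a0; exact: rnorm0_eq0.
have aV : rnorm (a^-1 : K^o) = (rnorm (a : K^o))^-1.
  apply: (mulfI (lt0r_neq0 an)); rewrite -rnormZ divff ?lt0r_neq0//.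
  have -> : a *: (a^-1 : K^o) = of_real b (1 : R) by rewrite of_real1; exact: divff.
  by rewrite rnorm_of_real normr1.
have AE : A = [set a^-1 *: z | z in [set a *: z | z in A]].
  apply/seteqP; split => [w Aw|_ [_ [w Aw <-] <-]].
    by exists (a *: w); [exists w|rewrite scalerA mulVf// scale1r].
  by rewrite scalerA mulVf// scale1r.
rewrite muleC -lee_pdivlMr// muleC {1}AE.
by rewrite -aV; apply: p_measureZ_le; exact: p_compactZ.
Qed.
End p_compact_theory.

Definition interleave (T : Type) (x y : nat -> T) : nat -> T :=
  fun n => if odd n then y n./2 else x n./2.

Lemma sum_interleave (V : zmodType) (x y : nat -> V) n :
  \sum_(0 <= k < n) interleave x y k =
  \sum_(0 <= k < uphalf n) x k + \sum_(0 <= k < n./2) y k.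
Proof.
elim: n => [|n IHn]; first by rewrite !big_nil addr0.
rewrite big_nat_recr//= IHn /interleave uphalf_half.
case: ifP => on /=; rewrite ?add1n ?add0n.
- by rewrite [X in _ = _ + X]big_nat_recr//= addrA.
- by rewrite [X in _ = X + _]big_nat_recr//= addrAC.
Qed.

Section p_compact_sum.
Context {R : realType} {b : scalar_kind} {F : normedModType (scalars R b)}.
Context {p : R}.
Hypothesis p1 : 1 <= p.
Local Notation K := (scalars R b).
Local Notation q := (hoelder_conjugate p%:E).
Implicit Types (A B : set F) (x y : nat -> F).

Let p0 : 0 < p. Proof. exact: lt_le_trans ltr01 p1. Qed.

Lemma lnorm_interleave (r : R) (u v : nat -> R) (X Y Z : R) : 1 <= r ->
  0 <= X -> 0 <= Y -> 0 <= Z ->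
  (forall i, 0 <= u i) -> (forall i, 0 <= v i) ->
  X `^ r + Y `^ r <= Z `^ r ->
  (lnorm r%:E u <= X%:E)%E -> (lnorm r%:E v <= Y%:E)%E ->
  (lnorm r%:E (interleave u v) <= Z%:E)%E.
Proof.
move=> r1 X0 Y0 Z0 u0 v0 XYZ; have r0 : 0 < r by rewrite (lt_le_trans ltr01).
rewrite !lnorm_leP// => uX vY.
apply: esum_le_sum => [i|n]; first exact: powR_ge0.
apply: le_trans XYZ.
rewrite (eq_bigr (interleave (fun i => u i `^ r) (fun i => v i `^ r))); last first.
  by move=> i _; rewrite /interleave; case: ifP.
by rewrite sum_interleave lerD//; apply: sum_le_esum => // i; exact: powR_ge0.
Qed.

Lemma series_interleave (x y : nat -> F) (z w : F) :
  series x @ \oo --> z -> series y @ \oo --> w ->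
  series (interleave x y) @ \oo --> z + w.
Proof.
move=> xz yw.
have -> : series (interleave x y) =
    (fun n => series x (uphalf n) + series y n./2).
  by apply/funext => n; exact: sum_interleave.
apply: cvgD; [apply: cvg_comp xz|apply: cvg_comp yw].
- move=> P [N _ NP]; exists N.*2 => //= n Nn; apply: NP => /=.
  by rewrite uphalf_half (leq_trans _ (leq_addl _ _))// -{1}(doubleK N) half_leq.
- move=> P [N _ NP]; exists N.*2 => //= n Nn; apply: NP => /=.
  by rewrite -(doubleK N) half_leq.
Qed.


Lemma p_coversD A B x y (X Y : R) : 0 < X -> 0 < Y ->
  (family_norm p%:E x <= X%:E)%E -> (family_norm p%:E y <= Y%:E)%E ->
  p_covers p A x -> p_covers p B y ->
  exists2 z, p_covers p [set v + w | v in A & w in B] z &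
             (family_norm p%:E z <= (X + Y)%:E)%E.
Proof.
move=> X0 Y0 xX yY [_ Ax] [_ By].
have XY0 : 0 < X + Y by rewrite addr_gt0.
pose t := X / (X + Y); pose s := Y / (X + Y).
have t0 : 0 < t by rewrite divr_gt0.
have s0 : 0 < s by rewrite divr_gt0.
have ts1 : t + s = 1 by rewrite -mulrDl divff// lt0r_neq0.
pose a := t `^ (1 - p^-1); pose c := s `^ (1 - p^-1).
have a0 : 0 < a by exact: powR_gt0.
have c0 : 0 < c by exact: powR_gt0.
have wE (t' Z : R) : 0 < t' -> 0 < Z -> Z / (X + Y) = t' ->
    ((t' `^ (1 - p^-1))^-1 * Z) `^ p = t' * (X + Y) `^ p.
  move=> t'0 Z0 tE.
  have -> : Z = t' * (X + Y) by rewrite -tE divfK// lt0r_neq0.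
  rewrite mulrA powRM ?(ltW XY0)//; last first.
    by rewrite mulr_ge0 ?invr_ge0 ?powR_ge0 ?ltW.
  congr (_ * _).
  have -> : (t' `^ (1 - p^-1))^-1 * t' = t' `^ p^-1.
    apply: (mulfI (lt0r_neq0 (powR_gt0 (1 - p^-1) t'0))).
    rewrite mulrA divff ?lt0r_neq0 ?powR_gt0// mul1r -powRD.
      by rewrite subrK powRr1// ltW.
    by rewrite (gt_eqF t'0) implybT.
  by rewrite -powRrM mulVf ?lt0r_neq0// powRr1// ltW.
pose z := interleave (fun n => (of_real b a)^-1 *: x n) (fun n => (of_real b c)^-1 *: y n).
have nV (d : R) : 0 < d -> (of_real b d)^-1 = of_real b d^-1 :> K.
  move=> d0; apply: (mulfI (of_real_neq0 (b := b) d0)).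
  by rewrite -of_realM divff ?of_real_neq0// divff ?lt0r_neq0// of_real1.
have zE : (fun n => rnorm (z n)) =
    interleave (fun n => a^-1 * rnorm (x n)) (fun n => c^-1 * rnorm (y n)).
  apply/funext => n; rewrite /z /interleave.
  by case: ifP => _; rewrite nV// rnormZ rnorm_of_real ger0_norm// invr_ge0 ltW.
have zXY : (family_norm p%:E z <= (X + Y)%:E)%E.
  rewrite /family_norm zE.
  apply: (@lnorm_interleave p _ _ (a^-1 * X) (c^-1 * Y)) => //.
  - by rewrite mulr_ge0 ?invr_ge0 ?ltW.
  - by rewrite mulr_ge0 ?invr_ge0 ?ltW.
  - by rewrite ltW.
  - by move=> i; rewrite mulr_ge0 ?invr_ge0 ?rnorm_ge0 ?ltW.
  - by move=> i; rewrite mulr_ge0 ?invr_ge0 ?rnorm_ge0 ?ltW.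
  - by rewrite !wE// -mulrDl ts1 mul1r.
  - by apply: lnormZ_le; rewrite ?lee_fin ?invr_ge0 ?(ltW a0) ?(ltW X0)// => i; exact: rnorm_ge0.
  - by apply: lnormZ_le; rewrite ?lee_fin ?invr_ge0 ?(ltW c0) ?(ltW Y0)// => i; exact: rnorm_ge0.
exists z => //; split; first by rewrite (le_lt_trans zXY)// ltry.
move=> _ [v /Ax [al al1 alv]] [w /By [be be1 bew]] <-.
exists (interleave (fun n => of_real b a * al n) (fun n => of_real b c * be n)); last first.
  rewrite (_ : (fun n => _) = interleave (fun n => al n *: x n) (fun n => be n *: y n)).
    exact: series_interleave.
  apply/funext => n; rewrite /z /interleave.
  by case: ifP => _; rewrite scalerA mulrAC divff ?of_real_neq0// mul1r.
have q1 : (1 <= q)%E := conjugate_ge1 p1.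
have alfin : family_norm q al \is a fin_num.
  by apply: family_norm_fin; rewrite (lt_trans al1)// ltry.
have befin : family_norm q be \is a fin_num.
  by apply: family_norm_fin; rewrite (lt_trans be1)// ltry.
pose m := Num.max (fine (family_norm q al)) (fine (family_norm q be)).
have m0 : 0 <= m by rewrite le_max fine_ge0// family_norm_ge0.
have m1 : m < 1 by rewrite gt_max -!lte_fin !fineK// al1.
apply: (@le_lt_trans _ _ m%:E); last by rewrite lte_fin.
have alm : (family_norm q al <= m%:E)%E by rewrite -(fineK alfin) lee_fin le_max lexx.
have bem : (family_norm q be <= m%:E)%E by rewrite -(fineK befin) lee_fin le_max lexx orbT.
rewrite /family_norm (_ : (fun n => _) =
    interleave (fun n => a * rnorm (al n)) (fun n => c * rnorm (be n))); last first.
  apply/funext => n; rewrite /interleave.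
  by case: ifP => _; rewrite [LHS]rnormZ rnorm_of_real ger0_norm// ltW.
move: alm bem; rewrite /family_norm.
have [[pE ->]|[r [-> p_gt1 r1 rE]]] := conjugate_cases p1.
- move=> /(lnorm_sup_leP _ m0) alm /(lnorm_sup_leP _ m0) bem.
  apply/lnorm_sup_leP => // n.
  rewrite /interleave /a /c pE invr1 subrr !powRr0 !mul1r.
  by case: ifP.
- have r0 : 0 < r by rewrite (lt_le_trans ltr01).
  move=> alm bem.
  apply: (@lnorm_interleave r _ _ (a * m) (c * m)) => //.
  - by rewrite mulr_ge0// ltW.
  - by rewrite mulr_ge0// ltW.
  - by move=> i; rewrite mulr_ge0 ?rnorm_ge0 ?ltW.
  - by move=> i; rewrite mulr_ge0 ?rnorm_ge0 ?ltW.
  - rewrite !powRM ?(ltW a0) ?(ltW c0)// -mulrDl /a /c -!powRrM -rE mulVf ?lt0r_neq0//.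
    by rewrite !powRr1 ?(ltW t0) ?(ltW s0)// ts1 mul1r.
  - by apply: lnormZ_le; rewrite ?lee_fin ?(ltW a0)// => i; exact: rnorm_ge0.
  - by apply: lnormZ_le; rewrite ?lee_fin ?(ltW c0)// => i; exact: rnorm_ge0.
Qed.

Lemma p_compactD A B : p_compact p A -> p_compact p B ->
  p_compact p [set v + w | v in A & w in B].
Proof.
move=> [x Ax] [y By].
have h (T : set F) u : p_covers p T u -> exists2 X : R, 0 < X & (family_norm p%:E u <= X%:E)%E.
  move=> [uy _]; exists (fine (family_norm p%:E u) + 1).
    by rewrite ltr_wpDl// fine_ge0// family_norm_ge0.
  by rewrite EFinD fineK ?family_norm_fin// leeDl.
have [X X0 xX] := h _ _ Ax; have [Y Y0 yY] := h _ _ By.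
by have [z ABz _] := p_coversD X0 Y0 xX yY Ax By; exists z.
Qed.

Lemma p_measureD A B : p_compact p A -> p_compact p B ->
  (p_measure p [set (v + w)%R | v in A & w in B] <= p_measure p A + p_measure p B)%E.
Proof.
move=> cA cB; have Afin := p_measure_fin cA; have Bfin := p_measure_fin cB.
apply/lee_addgt0Pr => e e0; have e20 : 0 < e / 2 by rewrite divr_gt0.
have h (T : set F) : p_measure p T \is a fin_num -> exists2 u, p_covers p T u &
    (family_norm p%:E u <= (fine (p_measure p T) + e / 2)%:E)%E.
  move=> Tfin; have [_ [u Tu <-] ulb] := lb_ereal_inf_adherent e20 Tfin.
  by exists u => //; rewrite EFinD fineK// ltW.
have [x Ax xX] := h _ Afin; have [y By yY] := h _ Bfin.
have pos (T : set F) : 0 < fine (p_measure p T) + e / 2.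
  by rewrite ltr_wpDl// fine_ge0// p_measure_ge0.
have [z ABz zXY] := p_coversD (pos A) (pos B) xX yY Ax By.
apply: (le_trans (p_measure_le ABz)); apply: (le_trans zXY).
by rewrite -(fineK Afin) -(fineK Bfin) -!EFinD [in leRHS](splitr e) addrACA.
Qed.

End p_compact_sum.

Section operators.
Context (R : realType) (b : scalar_kind).
Implicit Types E F : normedModType (scalars R b).

Definition p_compact_operators E F (p : R) : set {linear E -> F} :=
  [set T : {linear E -> F} |
    continuous T /\ p_compact p (T @` open_unit_ball E)].

Definition operator_norm E F (T : E -> F) : \bar R :=
  ereal_sup [set (rnorm (T x))%:E | x in open_unit_ball E].

(* +oo when E and F are not isomorphic. *)
Definition banach_mazur E F : \bar R :=
  ereal_inf [set d | exists (T : {linear E -> F}) (S : {linear F -> E}),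
    [/\ continuous T, continuous S, cancel T S, cancel S T
      & d = (operator_norm T * operator_norm S)%E]].

End operators.
Arguments p_compact_operators {R b} E F p.

Section homogeneous_polynomials.
Context (R : realType) (b : scalar_kind) (E F : normedModType (scalars R b)).
Local Notation K := (scalars R b).
Variable k : nat.
Implicit Types (A : ('I_k -> E) -> F) (P Q : E -> F).

(* dfwith x i u is x with its i-th entry replaced by u. *)
Definition multilinear A : Prop :=
  forall (i : 'I_k) (x : 'I_k -> E), linear (fun u : E => A (dfwith x i u)).

Definition symmetric_map A : Prop :=
  forall (sigma : 'S_k) (x : 'I_k -> E), A (x \o sigma) = A x.

(* {ptws 'I_k -> E} is E^k with the product topology. *)
Definition homogeneous_polynomial P : Prop :=
  exists A : {ptws 'I_k -> E} -> F,
    [/\ continuous A, multilinear A, symmetric_map A &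
        forall x : E, P x = A (fun=> x)].

Definition p_compact_polynomials (p : R) : set (E -> F) :=
  [set P | homogeneous_polynomial P /\ p_compact p (P @` open_unit_ball E)].

Lemma continuous_lincomb (T : topologicalType) (f g : T -> F) (a : K) :
  continuous f -> continuous g -> continuous (fun x => a *: f x + g x).
Proof.
move=> fc gc x; apply: (@cvgD _ _ _ (nbhs x) _ (fun x => a *: f x) g (a *: f x)).
  exact: (cvgZl_tmp (fc x)).
exact: gc.
Qed.

Lemma homogeneous_polynomial_linear :
  linear_subspace (homogeneous_polynomial : set (E -> F)).
Proof.
split.
- exists (fun=> 0); split.
  + exact: cst_continuous.
  + by move=> i x a u v; rewrite scaler0 addr0.
  + by move=> sigma x.
  + by move=> x.
- move=> a P Q [A [Ac Al As PA]] [B [Bc Bl Bs QB]].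
  exists (fun x => a *: A x + B x); split.
  + exact: continuous_lincomb.
  + move=> i x c u v; rewrite Al Bl !scalerDr !scalerA mulrC.
    by rewrite -!addrA; congr (_ + _); rewrite addrCA.
  + by move=> sigma x; rewrite As Bs.
  + by move=> x; rewrite -PA -QB.
Qed.

Lemma homogeneous_polynomialZ P (a : K) (x : E) :
  homogeneous_polynomial P -> P (a *: x) = a ^+ k *: P x.
Proof.
move=> [A [_ Al _ PA]]; rewrite !PA.
have h m : (m <= k)%N ->
    A (fun j : 'I_k => if (j < m)%N then a *: x else x) = a ^+ m *: A (fun=> x).
  elim: m => [_|m IHm mk]; first by rewrite expr0 scale1r.
  pose i := Ordinal mk.
  have -> : (fun j : 'I_k => if (j < m.+1)%N then a *: x else x) =
      dfwith (fun j : 'I_k => if (j < m)%N then a *: x else x) i (a *: x).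
    apply/funext => j; case: dfwithP => [|j' ij]; first by rewrite ltnS leqnn.
    rewrite ltnS leq_eqVlt; case: eqP => //= jm.
    by exfalso; move/eqP: ij; apply; exact/val_inj/esym.
  have lin := Al i (fun j : 'I_k => if (j < m)%N then a *: x else x).
  have lin0 : A (dfwith (fun j : 'I_k => if (j < m)%N then a *: x else x) i 0) = 0.
    have := lin (-1) 0 0; rewrite scaler0 addr0 scaleN1r addNr.
    by [].
  have := lin a x 0; rewrite addr0 lin0 addr0 => ->.
  rewrite exprS -scalerA -(IHm (ltnW mk)); congr (_ *: A _).
  by apply/funext => j; case: dfwithP => //; rewrite ltnn.
rewrite -(h k (leqnn k)); congr A; apply/funext => j.
by rewrite ltn_ord.
Qed.

Section polynomial_space.
Variables (p : R) (p1 : 1 <= p).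

Lemma image_polyD P Q : (P + Q) @` open_unit_ball E `<=`
  [set v + w | v in P @` open_unit_ball E & w in Q @` open_unit_ball E].
Proof.
by move=> _ [x Bx <-]; exists (P x); [exists x|exists (Q x) => //; exists x].
Qed.

Lemma image_polyZ (a : K) P : (a *: P) @` open_unit_ball E =
  [set a *: z | z in P @` open_unit_ball E].
Proof. by rewrite image_comp. Qed.

Let poly_linear : linear_subspace (p_compact_polynomials p).
Proof.
have [h0 hD] := homogeneous_polynomial_linear; split.
- split => //; exists 0; split; first by rewrite family_norm0 ?lee_fin// ltry.
  move=> _ [x _ <-]; exists 0.
    by rewrite family_norm0 ?lte01//; exact: conjugate_ge1.
  rewrite (_ : series _ = cst 0); first exact: cvg_cst.
  by apply/funext => n; rewrite /series /= big1// => i _; rewrite scaler0.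
- move=> a P Q [hP cP] [hQ cQ]; split; first exact: hD.
  apply: p_compactS (image_polyD (P := a *: P) (Q := Q)) _.
  by apply: p_compactD => //; rewrite image_polyZ; exact: p_compactZ.
Qed.

Local Notation poly_norm P := (fine (p_measure p (P @` open_unit_ball E))).

Let poly_normD P Q : p_compact_polynomials p P -> p_compact_polynomials p Q ->
  poly_norm (P + Q) <= poly_norm P + poly_norm Q.
Proof.
move=> [_ cP] [_ cQ].
have cPQ := p_compactD p1 cP cQ.
rewrite -lee_fin EFinD !fineK ?p_measure_fin//; last first.
  exact: p_compactS (@image_polyD P Q) cPQ.
exact: le_trans (le_p_measure (@image_polyD P Q)) (p_measureD p1 cP cQ).
Qed.

Lemma open_unit_ball0 : open_unit_ball E 0.
Proof. by rewrite /open_unit_ball/= rnorm0. Qed.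

Let poly_normZ (a : K) P : p_compact_polynomials p P ->
  poly_norm (a *: P) = rnorm (a : K^o) * poly_norm P.
Proof.
move=> [_ cP]; rewrite image_polyZ p_measureZ ?fineM ?p_measure_fin//.
by exists (P 0), 0 => //; exact: open_unit_ball0.
Qed.

Let poly_norm0_eq0 P : p_compact_polynomials p P -> poly_norm P = 0 -> P = 0.
Proof.
move=> [hP cP] P0; apply/funext => x.
have ball0 y : open_unit_ball E y -> P y = 0.
  move=> By; apply: rnorm0_eq0; apply/eqP; rewrite eq_le rnorm_ge0 andbT.
  rewrite -P0 -lee_fin fineK ?p_measure_fin//.
  by apply: p_measure_ub => //; exists y.
have r0 : 0 < (rnorm x + 1)^-1 by rewrite invr_gt0 ltr_wpDl// rnorm_ge0.
have : P (of_real b (rnorm x + 1)^-1 *: x) = 0.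
  apply: ball0; rewrite /open_unit_ball/= rnormZ rnorm_of_real ger0_norm ?ltW//.
  by rewrite mulrC ltr_pdivrMr ?mul1r ?ltrDl// ltr_wpDl// rnorm_ge0.
rewrite homogeneous_polynomialZ// => /eqP; rewrite scaler_eq0.
by rewrite expf_eq0 (negbTE (of_real_neq0 r0)) andbF/= => /eqP.
Qed.

(* The p-compact k-homogeneous polynomials, with the norm m_p(P(B_E); F). *)
Definition p_compact_polynomial_space : normedModType K :=
  ns_normedModType (NormedSubspace poly_linear poly_normD poly_normZ poly_norm0_eq0).

Definition polynomial_of (P : p_compact_polynomial_space) : E -> F := \val P.

End polynomial_space.
End homogeneous_polynomials.
Arguments p_compact_polynomials {R b} E F k p.
Arguments p_compact_polynomial_space {R b} E F k {p} p1.

Section subspace_as_space.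
Context (R : realType) (b : scalar_kind) (F : normedModType (scalars R b)).
Variables (W : set F) (linW : linear_subspace W).

(* W with the norm of F. *)
Definition subspace_space : normedModType (scalars R b) :=
  ns_normedModType (NormedSubspace linW (fun x y _ _ => rnormD x y)
    (fun a x _ => rnormZ a x) (fun x _ => @rnorm0_eq0 _ _ _ x)).

End subspace_as_space.

(* The spaces l_s^n embed uniformly in F. *)
Definition embed_uniformly (R : realType) (b : scalar_kind) (s : \bar R)
    (s1 : (1 <= s)%E) (F : normedModType (scalars R b)) : Prop :=
  exists (W : nat -> set F) (linW : forall n, linear_subspace (W n)),
    (ereal_sup (range (fun n =>
       banach_mazur (subspace_space (linW n)) (ell b s1 'I_n))) < +oo)%E.

Definition spaceable (K : numFieldType) (X : topologicalLmodType K) (A : set X) :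
    Prop :=
  exists V : set X, [/\ linear_subspace V, closed V, ~ finite_dimensional V &
    V `<=` A `|` [set 0]].

(* Main.v *)
Require Import Defs.
From mathcomp Require Import all_boot all_order all_algebra.
From mathcomp Require Import perm complex ring lra zify.
From mathcomp Require Import all_classical all_reals all_analysis.

(* If P is q-compact but not p-compact, then finite sets in F tell the two notions
   apart: for all d, C > 0 there is a finite family z whose absolutely convex hull
   has m_q (aco z) <= d and m_p (aco z) > C. Otherwise m_p <= c m_q on finite hulls,
   and P(B_E), contained in a sum of blocks with geometrically decreasing m_q, each
   of them nearly a finite hull, would be p-compact.

   A Dvoretzky-Rogers argument gives functionals f_i on E and points x_i of B_E with
   sum_i |f_i|^2 <= 1 on B_E, |f_i (x_i)| >= 1/20 and f_i (x_j) tiny for i <> j. As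
   k >= 2, the polynomial sum_i f_i^k z_i maps B_E into aco z, and the m_p of its
   values at the x_i is comparable to m_p (aco z).

   Choose blocks P_n of this form with summable m_q, with m_p growing fast, and
   vanishing at a point e and at the points of the earlier blocks. Let W be a
   separable closed infinite-dimensional subspace of F, (h_m) a sequence of
   functionals separating the points of W, and g a functional with g(e) <> 0. For
   z in W put T_z = g^k z + sum_n h_(c n) (z) P_n, where c takes every value
   infinitely often. The T_z form a closed subspace because z is recovered from
   T_z (e). If z <> 0 then T_z is not p-compact, since at the points of the n-th
   block it agrees with a multiple of P_n up to an error of controlled m_p. *)

Set Implicit Arguments.
Unset Strict Implicit.
Unset Printing Implicit Defensive.

Import Order.TTheory GRing.Theory Num.Theory.
Import numFieldNormedType.Exports.

Local Open Scope classical_set_scope.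
Local Open Scope ring_scope.

(** The domain and the range are decoupled: P only certifies that the gap between m_q and m_p is
    visible on finite sets, and these sets are then carried by new polynomials through functionals
    on E. The hulls of different blocks may overlap in F in an uncontrolled way, with no projections
    at hand to separate them, so the blocks are told apart in E, by evaluation at the points of a
    single block. This separation is only triangular: a block is chosen after the earlier points and
    can vanish there, but it cannot foresee the later ones. At the points of the n-th block the
    earlier blocks survive. They are harmless because every finite hull has finite m_p and the next
    gap can be demanded larger than n times the sum of these numbers. *)

(** * Flattening double sequences *)

Section flattening.

(* Every n is uniquely of the form 2^j (2 m + 1) - 1; it carries x j m. *)
Definition flat (T : Type) (x : nat -> nat -> T) (n : nat) : T :=
  x (logn 2 n.+1) (n.+1 %/ 2 ^ logn 2 n.+1)./2.

(** Row 0 sits at the even positions and the flattening of the other rows at the odd ones. Sums over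
    [flat] are estimated through this recursion, which halves the length. *)
Lemma flatE (T : Type) (x : nat -> nat -> T) :
  flat x = interleave (x 0%N) (flat (fun j => x j.+1)).
Proof.
apply/funext => n; rewrite /flat /interleave; case: ifP => on.
- have nE : n.+1 = (2 * n./2.+1)%N.
    by rewrite mulnC muln2 doubleS -{1}(odd_double_half n) on add1n.
  by rewrite nE lognM// logn_prime//= add1n expnS divnMl.
- by rewrite lognE dvdn2 /= on expn0 divn1 /= uphalf_half on.
Qed.

Lemma sum_flat (V : zmodType) (x : nat -> nat -> V) n :
  \sum_(0 <= k < n) flat x k =
  \sum_(0 <= k < uphalf n) x 0%N k + \sum_(0 <= k < n./2) flat (fun j => x j.+1) k.
Proof. by rewrite flatE sum_interleave. Qed.

Lemma map_flat (T U : Type) (f : T -> U) (x : nat -> nat -> T) n :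
  f (flat x n) = flat (fun j m => f (x j m)) n.
Proof. by []. Qed.

Context {R : realType}.

(** For a finite exponent r >= 1, row 0 contributes at most (D/2)^r and, by induction, so does the
    rest; 2 (D/2)^r <= D^r. The same weights 2^-(j+1) serve every s in [1, +oo], hence both p and
    its conjugate. *)
Lemma lnorm_flat (s : \bar R) (u : nat -> nat -> R) (D : R) : (1 <= s)%E -> 0 <= D ->
  (forall j i, 0 <= u j i) ->
  (forall j, lnorm s (u j) <= (D * 2^-1 ^+ j.+1)%:E)%E ->
  (lnorm s (flat u) <= D%:E)%E.
Proof.
case: s => [r||//] s1 D0 u0 uD.
- have r0 : 0 < r by rewrite (lt_le_trans ltr01).
  rewrite lnorm_leP//; apply: esum_le_sum => [i|n]; first exact: powR_ge0.
  have {uD} : forall j n, \sum_(0 <= i < n) u j i `^ r <= (D * 2^-1 ^+ j.+1) `^ r.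
    move=> j m; apply: sum_le_esum; first by move=> i; exact: powR_ge0.
    by rewrite -lnorm_leP// mulr_ge0// exprn_ge0// invr_ge0.
  have [m] := ubnP n; elim: m => // m IHm in n u u0 D D0 * => nm uD.
  under eq_bigr do rewrite (map_flat (fun t => t `^ r)).
  rewrite sum_flat; have [->|n0] := posnP n.
    by rewrite !big_nil addr0 powR_ge0.
  have h1 := uD 0%N (uphalf n).
  have h2 : \sum_(0 <= k < n./2) flat (fun j i => u j.+1 i `^ r) k <= (D * 2^-1) `^ r.
    under eq_bigr do rewrite -(map_flat (fun t => t `^ r)).
    apply: IHm => // [||j i]; first by rewrite mulr_ge0// invr_ge0.
      rewrite -ltnS (leq_trans _ nm)// ltnS -{2}(half_bit_double n false) add0n.
      by rewrite ltn_half_double doubleK -muln2 ltn_Pmulr.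
    by rewrite -mulrA -exprS.
  apply: (le_trans (lerD h1 h2)); rewrite expr1 -mulr2n.
  rewrite powRM// ?invr_ge0// -mulrnAr ler_piMr ?powR_ge0//.
  rewrite -powR_inv1// -powRrM mulN1r powRN -mulr_natr mulrC.
  rewrite ler_pdivrMr ?powR_gt0// mul1r -[leLHS]powRr1//.
  by rewrite ler_powR// ler1n.
- apply/lnorm_sup_leP => // i; rewrite /flat; set j := logn _ _.
  have Dj : D * 2^-1 ^+ j.+1 <= D.
    by rewrite ler_piMr// exprn_ile1 ?invr_ge0// invf_le1// ler1n.
  apply: le_trans Dj.
  have := uD j; rewrite lnorm_sup_leP; first by move=> ->.
  by rewrite mulr_ge0// exprn_ge0// invr_ge0.
Qed.

Context {b : scalar_kind} {F : normedModType (scalars R b)}.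
Implicit Types (w : nat -> nat -> F) (v : nat -> F).

Lemma rnorm_sum_flat w (D : R) n : 0 <= D ->
  (forall j m, rnorm (series (w j) m) <= D * 2^-1 ^+ j) ->
  rnorm (series (flat w) n) <= D * 2.
Proof.
have [m] := ubnP n; elim: m => // m IHm in n w D * => nm D0 wD.
rewrite /series /= sum_flat; have [->|n0] := posnP n.
  by rewrite !big_nil addr0 rnorm0 mulr_ge0.
have h1 := wD 0%N (uphalf n); rewrite expr0 mulr1 in h1.
have h2 : rnorm (series (flat (fun j => w j.+1)) n./2) <= D * 2^-1 * 2.
  apply: IHm => [||j i]; first 1 last.
  - by rewrite mulr_ge0 ?invr_ge0.
  - by rewrite -mulrA -exprS.
    rewrite -ltnS (leq_trans _ nm)// ltnS -{2}(half_bit_double n false) add0n.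
    by rewrite ltn_half_double doubleK -muln2 ltn_Pmulr.
rewrite divfK// in h2.
by rewrite (le_trans (rnormD _ _))// mulr_natr mulr2n lerD.
Qed.

Lemma cvg_rnormP v (y : F) :
  v @ \oo --> y <->
  forall e : R, 0 < e -> exists N, forall n, (N <= n)%N -> rnorm (y - v n) <= e.
Proof.
split => [/cvgrPdist_lt vy e e0|h].
  have := vy (of_real b e); rewrite -(of_real0 (R := R)) ltr_of_real.
  move=> /(_ e0) [N _ NP]; exists N => n Nn; have := NP n Nn.
  by rewrite /= -of_rnorm ltr_of_real => /ltW.
apply/cvgrPdist_lt => e e0.
have eE : of_real b (real_part e) = e by rewrite of_real_part// ltW.
have re0 : 0 < real_part e.
  by rewrite -(ltr_of_real (b := b)) eE of_real0.
have [|N NP] := h (real_part e / 2); first by rewrite divr_gt0.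
exists N => // n /= Nn; rewrite -of_rnorm -eE ltr_of_real.
by rewrite (le_lt_trans (NP n Nn))// ltr_pdivrMr// ltr_pMr// ltr1n.
Qed.

(** A partial sum of [flat w] consists of partial sums of the first J rows, whose lengths grow with
    n, and of a partial sum of the flattened remaining rows, which is at most D * 2 * 2^-J. *)
Lemma series_flat_prefix w v (D : R) J (e : R) : 0 <= D -> 0 < e ->
  (forall j m, rnorm (series (w j) m) <= D * 2^-1 ^+ j) ->
  (forall j, series (w j) @ \oo --> v j) ->
  exists N, forall n, (N <= n)%N ->
    rnorm (series v J - series (flat w) n) <= D * 2 * 2^-1 ^+ J + e.
Proof.
elim: J => [|J IHJ] in w v D e * => D0 e0 wD wv.
  exists 0%N => n _; rewrite /series /= big_nil sub0r.
  rewrite /rnorm normrN -/(rnorm _) expr0 mulr1.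
  by rewrite (le_trans (rnorm_sum_flat n D0 wD))// lerDl ltW.
have [||j m|j|N2 N2P] := IHJ (fun j => w j.+1) (fun j => v j.+1) (D * 2^-1) (e / 2).
- by rewrite mulr_ge0 ?invr_ge0.
- by rewrite divr_gt0.
- by rewrite -mulrA -exprS.
- exact: wv.
have [|N1 N1P] := (cvg_rnormP _ _).1 (wv 0%N) (e / 2); first by rewrite divr_gt0.
exists (N1 + N2)%N.*2 => n Nn.
have Nn2 : (N1 + N2 <= n./2)%N by rewrite -(doubleK (N1 + N2)%N) half_leq.
have -> : series v J.+1 - series (flat w) n =
    (v 0%N - series (w 0%N) (uphalf n)) +
    (series (fun j => v j.+1) J - series (flat (fun j => w j.+1)) n./2).
  rewrite /series /= sum_flat big_nat_recl// opprD.
  by rewrite addrACA.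
apply: (le_trans (rnormD _ _)).
have h1 : rnorm (v 0%N - series (w 0%N) (uphalf n)) <= e / 2.
  apply: N1P; rewrite uphalf_half (leq_trans _ (leq_addl _ _))//.
  exact: leq_trans (leq_addr _ _) Nn2.
have h2 := N2P n./2 (leq_trans (leq_addl _ _) Nn2).
rewrite [e]splitr addrA [leRHS]addrC lerD//.
rewrite (le_trans h2)// lerD2r exprS le_eqVlt; apply/orP; left; apply/eqP; ring.
Qed.

(** Geometric bounds on the partial sums of the rows replace absolute convergence in this
    rearrangement; for covering series Hoelder's inequality provides them. *)
Lemma cvg_series_flat w v (D : R) (y : F) : 0 <= D ->
  (forall j m, rnorm (series (w j) m) <= D * 2^-1 ^+ j) ->
  (forall j, series (w j) @ \oo --> v j) -> series v @ \oo --> y ->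
  series (flat w) @ \oo --> y.
Proof.
move=> D0 wD wv vy; apply/cvg_rnormP => e e0.
have e30 : 0 < e / 3 by rewrite divr_gt0.
have [N1 N1P] := (cvg_rnormP _ _).1 vy _ e30.
have [N2 N2P] : exists N, D * 2 * 2^-1 ^+ N <= e / 3.
  have D20 : 0 < D * 2 + 1 by rewrite ltr_wpDl// mulr_ge0.
  have : (2^-1 : R) ^+ n @[n --> \oo] --> 0.
    by apply: cvg_expr; rewrite ger0_norm ?invr_ge0// invf_lt1// ltr1n.
  move=> /cvgrPdist_lt /(_ (e / 3 / (D * 2 + 1))).
  rewrite divr_gt0// => /(_ isT) [N _ /(_ N (leqnn N))] /=.
  rewrite sub0r normrN ger0_norm ?exprn_ge0 ?invr_ge0// => h.
  exists N; rewrite -[leRHS](divfK (lt0r_neq0 D20)) mulrC.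
  apply: (@le_trans _ _ (2^-1 ^+ N * (D * 2 + 1))).
    by rewrite ler_wpM2l ?exprn_ge0 ?invr_ge0// lerDl.
  by rewrite ler_wpM2r// ltW.
pose J := (N1 + N2)%N.
have [N NP] := series_flat_prefix J D0 e30 wD wv.
exists N => n Nn; rewrite -[y](subrK (series v J)) -addrA.
rewrite (le_trans (rnormD _ _))//.
have -> : e = e / 3 + (e / 3 + e / 3) by field.
apply: lerD; first by apply: N1P; rewrite leq_addr.
apply: (le_trans (NP n Nn)); rewrite lerD2r (le_trans _ N2P)//.
rewrite ler_wpM2l ?mulr_ge0// ler_wiXn2l ?invr_ge0// ?invf_le1 ?ler1n//.
by rewrite /J leq_addl.
Qed.

End flattening.

(** * Coverings of p-compact sets *)

(** Dependent choice with access to the whole history: the blocks, and the functionals of a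
    triangular system, are chosen against all earlier ones. *)
Lemma history_choice (T : Type) (Q : seq T -> T -> Prop) :
  (forall s, exists t, Q s t) ->
  exists g : nat -> T, forall n, Q [seq g i | i <- iota 0 n] (g n).
Proof.
move=> /choice[h hQ].
pose hist := fix hist n := if n is m.+1 then rcons (hist m) (h (hist m)) else [::].
exists (fun n => h (hist n)) => n; suff <- : hist n = [seq h (hist i) | i <- iota 0 n] by [].
elim: n => // n IHn; rewrite -[in RHS]addn1 iotaD map_cat -IHn /=.
by rewrite add0n cats1.
Qed.

Lemma choice2 (T U : Type) (P Q : T -> U -> Prop) :
  (forall x, exists2 y, P x y & Q x y) ->
  exists f : T -> U, (forall x, P x (f x)) /\ (forall x, Q x (f x)).
Proof.
move=> h; have [|f fP] := @choice _ _ (fun x y => P x y /\ Q x y).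
  by move=> x; have [y Py Qy] := h x; exists y.
by exists f; split => x; have [] := fP x.
Qed.

Definition aco (R : realType) (b : scalar_kind) (F : normedModType (scalars R b))
    (N : nat) (z : 'I_N -> F) : set F :=
  [set y | exists2 a : 'I_N -> scalars R b,
     \sum_(i < N) rnorm (a i : (scalars R b)^o) <= 1 & y = \sum_(i < N) a i *: z i].

(* m_p(A; F) <= C, with a covering sequence that attains the bound. *)
Definition p_covered (R : realType) (b : scalar_kind)
    (F : normedModType (scalars R b)) (p C : R) (A : set F) : Prop :=
  exists x : nat -> F, (family_norm p%:E x <= C%:E)%E /\ A `<=` p_hull p x.

Section p_covered_theory.
Context {R : realType} {b : scalar_kind} {F : normedModType (scalars R b)}.
Context {p : R}.
Hypothesis p1 : 1 <= p.
Local Notation K := (scalars R b).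
Local Notation p' := (hoelder_conjugate p%:E).
Implicit Types (A B : set F) (C : R).

Let p'1 : (1 <= p')%E. Proof. exact: conjugate_ge1. Qed.
Let pp1 : (1 <= p%:E)%E. Proof. by rewrite lee_fin. Qed.

Lemma p_coveredS A B C : A `<=` B -> p_covered p C B -> p_covered p C A.
Proof. by move=> AB [x [xC Bx]]; exists x; split => // y /AB /Bx. Qed.

Lemma p_covered_le A C C' : C <= C' -> p_covered p C A -> p_covered p C' A.
Proof.
move=> CC [x [xC Ax]]; exists x; split => //.
by rewrite (le_trans xC)// lee_fin.
Qed.

Lemma p_covered_compact A C : p_covered p C A -> p_compact p A.
Proof. by move=> [x [xC Ax]]; exists x; split => //; rewrite (le_lt_trans xC)// ltry. Qed.

Lemma p_compact_covered A : p_compact p A -> exists2 C, 0 < C & p_covered p C A.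
Proof.
move=> [x [xy Ax]]; exists (fine (family_norm p%:E x) + 1).
  by rewrite ltr_wpDl// fine_ge0// family_norm_ge0.
exists x; split => //.
by rewrite EFinD fineK ?family_norm_fin// leeDl// lee_fin.
Qed.

Lemma p_covered_measure A C : p_covered p C A -> (p_measure p A <= C%:E)%E.
Proof.
move=> [x [xC Ax]]; apply: le_trans (xC); apply: p_measure_le.
by split => //; rewrite (le_lt_trans xC)// ltry.
Qed.

(** The infimum need not be attained, hence the strict inequality; estimates that end here keep a
    slightly larger constant. *)
Lemma p_measure_covered A C : (p_measure p A < C%:E)%E -> p_covered p C A.
Proof.
move=> AC; have Afin : p_measure p A \is a fin_num.
  by rewrite ge0_fin_numE ?p_measure_ge0// (lt_trans AC)// ltry.
have e0 : 0 < C - fine (p_measure p A).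
  by rewrite subr_gt0 -lte_fin fineK.
have [_ [x [xy Ax] <-] xC] := lb_ereal_inf_adherent e0 Afin.
exists x; split => //; apply/ltW/(lt_le_trans xC).
by rewrite -[X in (X + _)%E](fineK Afin) -EFinD lee_fin addrC subrK.
Qed.

Lemma p_coveredD A B X Y : 0 < X -> 0 < Y -> p_covered p X A -> p_covered p Y B ->
  p_covered p (X + Y) [set v + w | v in A & w in B].
Proof.
move=> X0 Y0 [x [xX Ax]] [y [yY By]].
have [||z [_ zAB] zXY] := p_coversD p1 X0 Y0 xX yY (A := A) (B := B).
- by split => //; rewrite (le_lt_trans xX)// ltry.
- by split => //; rewrite (le_lt_trans yY)// ltry.
by exists z.
Qed.

Lemma p_coveredZ (a : K) A C : p_covered p C A ->
  p_covered p (rnorm (a : K^o) * C) [set a *: z | z in A].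
Proof.
move=> [x [xC Ax]]; have xy : (family_norm p%:E x < +oo)%E.
  by rewrite (le_lt_trans xC)// ltry.
have [_ h] := p_coversZ p1 a (conj xy Ax).
exists (a *: x); split => //.
by rewrite family_normZ// EFinM; apply: lee_wpmul2l; rewrite ?lee_fin ?rnorm_ge0.
Qed.

(** Coefficients of [p_hull] range over an open ball, so strictness must survive: finitely many
    coefficient sequences have norms at most some m < 1, and absolutely convex combinations keep
    this bound. *)
Lemma p_hull_lincomb (x : nat -> F) N (a : 'I_N -> K) (y : 'I_N -> F) :
  \sum_(i < N) rnorm (a i : K^o) <= 1 -> (forall i, p_hull p x (y i)) ->
  p_hull p x (\sum_(i < N) a i *: y i).
Proof.
move=> a1 /choice2[al [al1 aly]].
pose m := \big[Num.max/0]_(i < N) fine (family_norm p' (al i)).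
have alm i : (family_norm p' (al i) <= m%:E)%E.
  rewrite -[leLHS]fineK; last first.
    by apply: family_norm_fin; rewrite (lt_trans (al1 i))// ltry.
  by rewrite lee_fin /m; apply: le_bigmax.
have m1 : m < 1.
  apply/bigmax_ltP; split => // i _; rewrite -lte_fin fineK//.
  by apply: family_norm_fin; rewrite (lt_trans (al1 i))// ltry.
have m0 : 0 <= m by exact: bigmax_ge_id.
have [h1 h2] : (family_norm p' (\sum_(i < N) a i *: al i)%R <=
      (\sum_(i < N) rnorm (a i : K^o) * m)%:E)%E /\
    series (fun n => (\sum_(i < N) a i *: al i) n *: x n) @ \oo -->
      \sum_(i < N) a i *: y i.
  elim: (index_enum _) => [|i r [IH1 IH2]].
    rewrite !big_nil family_norm0//; split => //.
    rewrite (_ : series _ = cst 0); first exact: cvg_cst.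
    by apply/funext => n; rewrite /series /= big1// => k _; rewrite scale0r.
  rewrite !big_cons; split.
    rewrite (le_trans (family_normD _ _ _))// EFinD leeD//.
    rewrite family_normZ//; last by rewrite (lt_trans (al1 i))// ltry.
    by rewrite EFinM; apply: lee_wpmul2l; rewrite ?lee_fin ?rnorm_ge0.
  rewrite (_ : series _ = (fun n => a i *: series (fun k => al i k *: x k) n +
      series (fun n => (\sum_(j <- r) a j *: al j) n *: x n) n)).
    by apply: cvgD => //; apply: cvgZl_tmp; exact: aly.
  apply/funext => n; rewrite /series /= scaler_sumr -big_split /=.
  by apply: eq_bigr => k _; rewrite scalerDl scalerA.
exists (\sum_(i < N) a i *: al i) => //; apply: (le_lt_trans h1).
by rewrite lte_fin -mulr_suml (le_lt_trans _ m1)// ler_piMl.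
Qed.

Lemma p_covered_aco A C N (z : 'I_N -> F) :
  (forall i, A (z i)) -> p_covered p C A -> p_covered p C (aco z).
Proof.
move=> Az [x [xC Ax]]; exists x; split => // _ [a a1 ->].
by apply: p_hull_lincomb => // i; exact/Ax.
Qed.

Lemma lnorm_single (s : \bar R) (c : R) : (1 <= s)%E -> 0 <= c ->
  (lnorm s (fun n : nat => if n == 0%N then c else 0)%R <= c%:E)%E.
Proof.
case: s => [r||//] s1 c0; last by apply/lnorm_sup_leP => // -[|n].
have r0 : 0 < r by rewrite (lt_le_trans ltr01).
rewrite lnorm_leP//; apply: esum_le_sum => [i|[|n]].
- exact: powR_ge0.
- by rewrite big_nil powR_ge0.
- by rewrite big_nat_recl//= big1 ?addr0// => i _; rewrite powR0// gt_eqF.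
Qed.

(** The disc is closed but the coefficients range over an open ball: the vector is doubled and the
    coefficients are halved. *)
Lemma p_covered_disc (z : F) C : 2 * rnorm z <= C ->
  p_covered p C [set a *: z | a in [set a : K | rnorm (a : K^o) <= 1]].
Proof.
move=> zC; exists (fun n => if n == 0%N then of_real b 2 *: z else 0); split.
  apply: le_trans (_ : (2 * rnorm z)%:E <= _)%E; last by rewrite lee_fin.
  rewrite /family_norm (_ : (fun i => _) =
      (fun n : nat => if n == 0%N then 2 * rnorm z else 0)).
    by apply: lnorm_single => //; rewrite mulr_ge0// rnorm_ge0.
  apply/funext => n; case: ifP => _; last exact: rnorm0.
  by rewrite rnormZ rnorm_of_real ger0_norm.
move=> _ [a a1 <-].
exists (fun n => if n == 0%N then of_real b 2^-1 * a else 0).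
  apply: (@le_lt_trans _ _ (2^-1)%:E); last by rewrite lte_fin invf_lt1// ltr1n.
  rewrite /family_norm (_ : (fun i => _) =
      (fun n : nat => if n == 0%N then 2^-1 * rnorm (a : K^o) else 0)).
    apply: le_trans (lnorm_single _ _) _ => //.
      by rewrite mulr_ge0 ?invr_ge0// rnorm_ge0.
    by rewrite lee_fin ler_piMr// invr_ge0.
  apply/funext => n; case: ifP => _; last exact: rnorm0.
  by rewrite (rnormZ (V := K^o)) rnorm_of_real ger0_norm// invr_ge0.
apply/cvg_rnormP => e e0; exists 1%N => -[//|n] _.
rewrite /series /= big_nat_recl//= big1 => [|i _]; last by rewrite scaler0.
rewrite addr0 scalerA mulrAC -of_realM mulVf// of_real1 mul1r subrr rnorm0.
exact: ltW.
Qed.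

Lemma p_covered0 C : 0 <= C -> p_covered p C [set 0 : F].
Proof.
move=> C0; exists 0; split; first by rewrite family_norm0 ?lee_fin.
move=> _ ->; exists 0.
  by rewrite family_norm0// lte01.
rewrite (_ : series _ = cst 0); first exact: cvg_cst.
by apply/funext => n; rewrite /series /= big1// => i _; rewrite scaler0.
Qed.

(** The extra [C] keeps the bound positive for the empty sum, as [p_coveredD] requires. *)
Lemma p_covered_sum N (B : 'I_N -> set F) (D : 'I_N -> R) C : 0 < C ->
  (forall i, 0 < D i) -> (forall i, p_covered p (D i) (B i)) ->
  p_covered p (C + \sum_(i < N) D i)
    [set y | exists2 v : 'I_N -> F, (forall i, B i (v i)) & y = \sum_(i < N) v i].
Proof.
move=> C0 D0 BD; suff [_] : 0 < C + \sum_(i < N) D i /\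
    p_covered p (C + \sum_(i < N) D i)
    [set y | exists2 v : 'I_N -> F, (forall i, B i (v i)) & y = \sum_(i < N) v i] by [].
elim: (index_enum _) => [|i r [IH0 IH]].
  rewrite !big_nil addr0; split => //; apply: p_coveredS (p_covered0 (ltW C0)).
  by move=> _ [v _ ->]; rewrite big_nil.
rewrite big_cons addrCA; split; first by rewrite addr_gt0.
apply: p_coveredS (p_coveredD (D0 i) IH0 (BD i) IH).
move=> _ [v Bv ->]; rewrite big_cons; exists (v i) => //.
by exists (\sum_(j <- r) v j) => //; exists v.
Qed.

Lemma p_covered_finite N (z : 'I_N -> F) :
  exists2 C, 0 < C & p_covered p C (aco z).
Proof.
have D0 i : 0 < 2 * rnorm (z i) + 1.
  by rewrite ltr_wpDl// mulr_ge0// rnorm_ge0.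
have zD i : p_covered p (2 * rnorm (z i) + 1)
    [set a *: z i | a in [set a : K | rnorm (a : K^o) <= 1]].
  by apply: p_covered_disc; rewrite lerDl.
exists (1 + \sum_(i < N) (2 * rnorm (z i) + 1)).
  by rewrite ltr_wpDr// sumr_ge0// => i _; exact: ltW.
apply: p_coveredS (p_covered_sum ltr01 D0 zD) => _ [a a1 ->].
exists (fun i => a i *: z i) => // i; exists (a i) => //=.
apply: le_trans a1; rewrite (bigD1 i)//= lerDl sumr_ge0// => j _.
exact: rnorm_ge0.
Qed.

Lemma p_covered_series (A : nat -> set F) C : 0 <= C ->
  (forall j, p_covered p (C * 4^-1 ^+ j) (A j)) ->
  p_covered p (8 * C)
    [set y | exists2 v : nat -> F, (forall j, A j (v j)) & series v @ \oo --> y].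
Proof.
move=> C0 /choice[x xA].
(* Of the decay 4^-j, one factor 2^-j stays on the vectors, whose flattened norm is then at most 8 *
   C, and the other moves to the coefficients. The exponent j + 2 brings the latter to norm at most
   1/2, inside the open ball. *)
pose c j : R := 2 ^+ j.+2.
have c0 j : 0 < c j by rewrite exprn_gt0.
exists (flat (fun j n => of_real b (c j) *: x j n)); split.
  rewrite /family_norm (_ : (fun i => _) = flat (fun j n => c j * rnorm (x j n))).
    apply: lnorm_flat => //; first by rewrite mulr_ge0.
      by move=> j i; rewrite mulr_ge0 ?rnorm_ge0 ?ltW.
    move=> j; have -> : 8 * C * 2^-1 ^+ j.+1 = c j * (C * 4^-1 ^+ j).
      rewrite /c !exprS (_ : 4^-1 = 2^-1 * 2^-1 :> R); last by field.
      rewrite exprMn; have := mulfV (lt0r_neq0 (exprn_gt0 j (ltr0n R 2))).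
      rewrite -exprVn => h.
      transitivity (4 * C * 2^-1 ^+ j); first by field.
      transitivity (4 * C * 2^-1 ^+ j * (2 ^+ j * 2^-1 ^+ j)); last by ring.
      by rewrite h mulr1.
    apply: lnormZ_le => //; rewrite ?(ltW (c0 j))// ?mulr_ge0 ?exprn_ge0 ?invr_ge0//.
      by move=> i; exact: rnorm_ge0.
    by have [] := xA j.
  apply/funext => n; rewrite (map_flat (@rnorm _ _ _)); congr flat.
  apply/funext => j; apply/funext => m.
  by rewrite rnormZ rnorm_of_real ger0_norm// ltW.
move=> y [v Av vy].
have /choice2[al [al1 aly]] : forall j, p_hull p (x j) (v j).
  by move=> j; have [_] := xA j; apply.
exists (flat (fun j n => of_real b (c j)^-1 *: (al j n : K^o))).
  apply: (@le_lt_trans _ _ (2^-1)%:E); last by rewrite lte_fin invf_lt1// ltr1n.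
  rewrite /family_norm (_ : (fun i => _) = flat (fun j n => (c j)^-1 * rnorm (al j n))).
    apply: lnorm_flat => //.
      by move=> j i; rewrite mulr_ge0 ?invr_ge0 ?rnorm_ge0 ?ltW.
    move=> j; have -> : 2^-1 * 2^-1 ^+ j.+1 = (c j)^-1 * 1.
      by rewrite mulr1 -exprS exprVn.
    apply: lnormZ_le => //; rewrite ?invr_ge0 ?(ltW (c0 j))//.
      by move=> i; exact: rnorm_ge0.
    exact: ltW (al1 j).
  apply/funext => n; rewrite (map_flat (@rnorm _ _ _)); congr flat.
  apply/funext => j; apply/funext => m.
  by rewrite rnormZ rnorm_of_real ger0_norm// invr_ge0 ltW.
rewrite (_ : (fun n => _) = flat (fun j m => al j m *: x j m)); last first.
  apply/funext => n; rewrite /flat scalerA mulrAC -of_realM mulVf ?lt0r_neq0//.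
  by rewrite of_real1 mul1r.
(* [hoelder_sum] wants a positive bound, and [C] may be 0. *)
have D0 : 0 < C + 1 by rewrite ltr_wpDl.
apply: (@cvg_series_flat _ _ _ _ v (C + 1)) => //; first exact: ltW.
move=> j m.
apply: (le_trans (rnorm_sum _ _ _)); under eq_bigr do rewrite rnormZ.
apply: (hoelder_sum p1).
- by move=> i; exact: rnorm_ge0.
- by move=> i; exact: rnorm_ge0.
- by rewrite mulr_gt0// exprn_gt0// invr_gt0.
- exact: ltW (al1 j).
- have [h _] := xA j; apply: (le_trans h); rewrite lee_fin ler_pM//.
  + by rewrite lerDl.
  + by rewrite lerXn2r ?nnegrE ?invr_ge0// lef_pV2 ?posrE// ler_nat.
Qed.

End p_covered_theory.

(** * Finite families separating q-compactness from p-compactness *)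

Section scalar_components.
Context {R : realType}.

Lemma rnorm_real (a : scalars R RealScalars) :
  rnorm (a : (scalars R RealScalars)^o) = `|a : R|.
Proof. by []. Qed.

Lemma rnorm_complex (x y : R) :
  rnorm (complex.Complex x y : (scalars R ComplexScalars)^o) =
  Num.sqrt (x ^+ 2 + y ^+ 2).
Proof. by []. Qed.

(** Rounding goes toward 0, so that |g| <= |a|: a rounded coefficient sequence must stay in the open
    ball of its sequence space. *)
Lemma unit_interval_net (e : R) : 0 < e -> exists G : seq R, forall a : R, `|a| <= 1 ->
  exists2 g, g \in G & `|g| <= `|a| /\ `|a - g| <= e.
Proof.
move=> e0; pose M := (Num.truncn e^-1).+1.
have M0 : 0 < M%:R :> R by rewrite ltr0n.
have Me : M%:R^-1 <= e.
  rewrite -[leRHS]invrK lef_pV2 ?posrE ?invr_gt0//.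
  by rewrite ltW// truncnS_gt.
pose G0 := [seq i%:R / M%:R : R | i <- iota 0 M.+1].
exists (G0 ++ [seq - g | g <- G0]) => a a1.
have [g gG [g1 g2]] : exists2 g, g \in G0 & 0 <= g <= `|a| /\ `|a| - g <= e.
  have aM : 0 <= `|a| * M%:R by rewrite mulr_ge0// ltW.
  have /andP[tl tr] := truncn_itv aM.
  exists ((Num.truncn (`|a| * M%:R))%:R / M%:R).
    apply/mapP; exists (Num.truncn (`|a| * M%:R)) => //.
    rewrite mem_iota add0n /= ltnS -(ler_nat R) (le_trans tl)//.
    by rewrite ler_piMl// ltW.
  split; first by rewrite divr_ge0 ?ler0n//= ler_pdivrMr.
  apply: le_trans Me; rewrite -[X in X - _](mulfK (lt0r_neq0 M0)) -mulrBl.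
  rewrite ler_piMl ?invr_ge0 ?ler0n// lerBlDr addrC ltW//.
  by rewrite -natr1 in tr.
case/andP: g1 => g0 ga.
have [a0|a0] := leP 0 a.
- exists g; first by rewrite mem_cat gG.
  rewrite (ger0_norm g0); split => //.
  by move: g2 ga; rewrite (ger0_norm a0) => g2 ga; rewrite ger0_norm// subr_ge0.
- exists (- g); first by rewrite mem_cat map_f// orbT.
  rewrite normrN (ger0_norm g0); split => //.
  move: g2 ga; rewrite (ltr0_norm a0) => g2 ga.
  by rewrite -normrN opprD opprK ger0_norm// subr_ge0.
Qed.

(** In the complex case both coordinates are rounded toward 0; errors of e/2 in each combine to at
    most e. *)
Lemma unit_disc_net (b : scalar_kind) (e : R) : 0 < e ->
  exists G : seq (scalars R b), forall a : scalars R b,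
    rnorm (a : (scalars R b)^o) <= 1 ->
    exists2 g, g \in G & rnorm (g : (scalars R b)^o) <= rnorm (a : (scalars R b)^o) /\
      rnorm (a - g : (scalars R b)^o) <= e.
Proof.
case: b => e0; first exact: unit_interval_net.
have e20 : 0 < e / 2 by rewrite divr_gt0.
have [G GP] := unit_interval_net e20.
exists [seq complex.Complex x y | x <- G, y <- G] => -[x y]; rewrite rnorm_complex => xy1.
have xy2 : x ^+ 2 + y ^+ 2 <= 1.
  by rewrite -[leLHS]sqr_sqrtr ?addr_ge0 ?sqr_ge0// expr_le1// sqrtr_ge0.
have sq1 (u : R) : u ^+ 2 <= 1 -> `|u| <= 1.
  by rewrite -real_normK ?num_real// expr_le1.
have [|g gG [g1 g2]] := GP x.
  by rewrite sq1// (le_trans _ xy2)// lerDl sqr_ge0.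
have [|h hG [h1 h2]] := GP y.
  by rewrite sq1// (le_trans _ xy2)// lerDr sqr_ge0.
have sq (u v : R) : `|u| <= `|v| -> u ^+ 2 <= v ^+ 2.
  move=> uv; rewrite -(real_normK (num_real u)) -(real_normK (num_real v)).
  by rewrite lerXn2r ?nnegrE.
exists (complex.Complex g h); first by apply/allpairsP; exists (g, h).
split; first by rewrite rnorm_complex ler_wsqrtr// lerD// sq.
rewrite [X in rnorm X](_ : _ = complex.Complex (x - g) (y - h)) // rnorm_complex.
rewrite -[leRHS]ger0_norm ?(ltW e0)// -sqrtr_sqr ler_wsqrtr//.
have e2E : `|e / 2| = e / 2 by rewrite ger0_norm// ltW.
apply: (@le_trans _ _ ((e / 2) ^+ 2 + (e / 2) ^+ 2)).
  by rewrite lerD// sq// e2E.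
have -> : e ^+ 2 = ((e / 2) ^+ 2 + (e / 2) ^+ 2) * 2 by field.
by rewrite ler_peMr ?ler1n// addr_ge0// sqr_ge0.
Qed.

End scalar_components.

Section finite_gap.
Context {R : realType} {b : scalar_kind} {F : normedModType (scalars R b)}.
Local Notation K := (scalars R b).

Lemma aco_scale (a : K) N (z : 'I_N -> F) :
  aco (fun i => a *: z i) = [set a *: y | y in aco z].
Proof.
apply/seteqP; split => [_ [c c1 ->]|_ [_ [c c1 ->] <-]].
- exists (\sum_(i < N) c i *: z i); first by exists c.
  by rewrite scaler_sumr; apply: eq_bigr => i _; rewrite !scalerA mulrC.
- exists c => //.
  by rewrite scaler_sumr; apply: eq_bigr => i _; rewrite !scalerA mulrC.
Qed.

Lemma family_norm_tail (q : R) (x : nat -> F) (e : R) : 1 <= q -> 0 < e ->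
  (family_norm q%:E x < +oo)%E -> exists a, forall c, (a <= c)%N ->
  (family_norm q%:E (fun n => if (c <= n)%N then x n else 0%R) <= e%:E)%E.
Proof.
move=> q1 e0 xy; have q0 : 0 < q by rewrite (lt_le_trans ltr01).
have e20 : 0 < e `^ q by rewrite powR_gt0.
pose u i := rnorm (x i) `^ q.
have u0 i : 0 <= u i by exact: powR_ge0.
pose S n := \sum_(0 <= i < n) u i.
have S_homo : {homo S : m n / (m <= n)%N >-> m <= n}.
  move=> m n mn; by rewrite /S [leRHS](big_cat_nat (n := m))//= lerDl sumr_ge0.
have Ssup : has_sup (range S).
  split; first by exists (S 0%N), 0%N.
  exists (fine (family_norm q%:E x) `^ q) => _ [n _ <-].
  apply: sum_le_esum => //; rewrite -lnorm_leP//.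
    by rewrite fineK// family_norm_fin.
  by rewrite fine_ge0// family_norm_ge0.
have [_ [a _ <-] aS] := sup_adherent e20 Ssup.
exists a => c ac; rewrite /family_norm lnorm_leP ?(ltW e0)//.
apply: esum_le_sum => [i|n]; first exact: powR_ge0.
have [nc|cn] := leqP n c.
  rewrite big_nat big1 ?powR_ge0// => i /andP[_ iN].
  by rewrite leqNgt (leq_trans iN nc) rnorm0 powR0// gt_eqF.
rewrite (big_cat_nat (n := c))//= ?(ltnW cn)// big_nat big1 ?add0r; last first.
  by move=> i /andP[_ iN]; rewrite leqNgt iN rnorm0 powR0// gt_eqF.
rewrite big_nat; under eq_bigr => i /andP[ci _] do rewrite ci.
rewrite -big_nat; have -> : \sum_(c <= i < n) rnorm (x i) `^ q = S n - S c.
  apply/eqP; rewrite eq_sym subr_eq addrC; apply/eqP.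
  by rewrite /S (big_cat_nat (n := c))//= ltnW.
have Sn : S n <= sup (range S) by apply: ub_le_sup; [case: Ssup|exists n].
rewrite lerBlDr (le_trans Sn)//.
by rewrite -lerBlDl ltW// (lt_le_trans aS)// S_homo.
Qed.

(** The first L coefficients are rounded to a finite grid. As rounding goes toward 0, the finitely
    many rounded sums z_i stay in the hull of [x] itself, and the errors have coefficients at most
    eta. *)
Lemma finite_block_net (q : R) (x : nat -> F) L (eta : R) : 1 <= q -> 0 < eta ->
  exists N (z : 'I_N -> F), (forall i, p_hull q x (z i)) /\
  forall al : nat -> K^o, (family_norm (hoelder_conjugate q%:E) al < 1)%E ->
  exists i (be : 'I_L -> K), (forall n, rnorm (be n : K^o) <= eta) /\
    \sum_(n < L) al n *: x n = z i + \sum_(n < L) be n *: x n.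
Proof.
move=> q1 eta0; have [G GP] := @unit_disc_net R b eta eta0.
pose T := {ffun 'I_L -> 'I_(size G)}.
pose c (g : T) (n : nat) : K^o := if insub n is Some i then nth 0 G (g i) else 0.
pose ok (g : T) := (family_norm (hoelder_conjugate q%:E) (c g) < 1)%E.
(* Grid sequences outside the open ball get the vector 0, which lies in the hull. *)
exists #|T|, (fun t => if ok (enum_val t) then \sum_(n < L) c (enum_val t) n *: x n else 0).
split => [t|al al1].
  case: ifPn => [okt|_]; last first.
    exists 0; first by rewrite family_norm0 ?lte01//; exact: conjugate_ge1.
    rewrite (_ : series _ = cst 0); first exact: cvg_cst.
    by apply/funext => n; rewrite /series /= big1// => i _; rewrite scale0r.
  exists (c (enum_val t)) => //; apply/cvg_rnormP => e e0; exists L => n Ln.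
  rewrite /series /= (big_cat_nat (n := L))//=.
  have -> : \sum_(L <= i < n) c (enum_val t) i *: x i = 0.
    rewrite big_nat big1// => i /andP[Li _].
    by rewrite /c insubN ?scale0r// -leqNgt.
  by rewrite addr0 big_mkord subrr rnorm0 ltW.
have q'1 := conjugate_ge1 q1.
have al1' n : rnorm (al n) <= 1.
  rewrite -lee_fin; apply: (le_trans _ (ltW al1)).
  by apply: (@lnorm_coord _ _ _ (fun n => rnorm (al n))) => // i; exact: rnorm_ge0.
have /choice2[f [f1 f2]] : forall n : 'I_L, exists2 j : 'I_(size G),
    rnorm (nth 0 G j : K^o) <= rnorm (al n) & rnorm (al n - nth 0 G j : K^o) <= eta.
  move=> n; have [g gG [g1 g2]] := GP _ (al1' n).
  have jP : (index g G < size G)%N by rewrite index_mem.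
  by exists (Ordinal jP); rewrite /= nth_index.
pose g : T := [ffun n => f n].
have cE (n : 'I_L) : c g n = nth 0 G (f n) by rewrite /c valK ffunE.
exists (enum_rank g), (fun n : 'I_L => al n - nth 0 G (f n)); split => //.
rewrite enum_rankK; have -> : ok g.
  apply: le_lt_trans al1; apply: le_lnorm => // n; first exact: rnorm_ge0.
  rewrite /c; case: insubP => [i _ <-|_]; first by rewrite ffunE.
  by rewrite rnorm0 rnorm_ge0.
rewrite -big_split /=; apply: eq_bigr => n _.
by rewrite cE -scalerDl addrC subrK.
Qed.

(** By homogeneity the assumed implication also holds with both constants multiplied by e. The hull
    of the net then costs e * C, and the rounding errors, a sum of L small discs, cost another e *
    C. *)
Lemma p_covered_finite_block (p q : R) (de C : R) : 1 <= p -> 1 <= q -> 0 < de -> 0 < C ->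
  (forall N (z : 'I_N -> F), p_covered q de (aco z) -> p_covered p C (aco z)) ->
  forall (x : nat -> F) L (e : R), 0 < e -> (family_norm q%:E x <= (e * de)%:E)%E ->
  p_covered p (2 * (e * C)) [set y | exists2 al : nat -> K^o,
     (family_norm (hoelder_conjugate q%:E) al < 1)%E & y = \sum_(n < L) al n *: x n].
Proof.
move=> p1 q1 de0 C0 H x L e e0 xe.
have eC0 : 0 < e * C by rewrite mulr_gt0.
(* Half of the second e * C is the spare term of [p_covered_sum]; the L discs share the other half.
   The 2 in [eta] below pays for the doubling in [p_covered_disc]. *)
pose D := e * C / (2 * L.+1%:R).
have D0 : 0 < D by rewrite divr_gt0// mulr_gt0// ltr0n.
pose X := 1 + \sum_(n < L) rnorm (x n).
have X0 : 0 < X by rewrite ltr_wpDr// sumr_ge0// => i _; exact: rnorm_ge0.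
pose eta := D / (2 * X).
have eta0 : 0 < eta by rewrite divr_gt0// mulr_gt0.
have [N [z [zx zal]]] := finite_block_net x L q1 eta0.
have zC : p_covered p (e * C) (aco z).
  have h : p_covered p C (aco (fun i => of_real b e^-1 *: z i)).
    apply: H; rewrite aco_scale.
    have -> : de = rnorm (of_real b e^-1 : K^o) * (e * de).
      by rewrite rnorm_of_real ger0_norm ?invr_ge0 ?ltW// mulKf// gt_eqF.
    apply: p_coveredZ => //; exists x; split => // _ [a a1 ->].
    exact: p_hull_lincomb.
  have := p_coveredZ p1 (of_real b e) h.
  rewrite rnorm_of_real ger0_norm ?ltW// -aco_scale.
  congr (p_covered _ _ (aco _)); apply/funext => i.
  by rewrite scalerA -of_realM mulfV ?gt_eqF// of_real1 scale1r.
have D0' (i : 'I_L) : 0 < D by [].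
have dP (i : 'I_L) : p_covered p D
    [set a *: (of_real b eta *: x i) | a in [set a : K | rnorm (a : K^o) <= 1]].
  apply: p_covered_disc => //; rewrite rnormZ rnorm_of_real ger0_norm ?(ltW eta0)//.
  have -> : 2 * (eta * rnorm (x i)) = D * (rnorm (x i) / X).
    by rewrite /eta; field; rewrite gt_eqF.
  rewrite ler_piMr ?(ltW D0)// ler_pdivrMr// mul1r /X.
  rewrite (bigD1 i)//= addrCA lerDl addr_ge0// sumr_ge0// => j _.
  exact: rnorm_ge0.
have eC20 : 0 < e * C / 2 by rewrite divr_gt0.
have SP := p_covered_sum p1 eC20 D0' dP.
have S0 : 0 < e * C / 2 + \sum_(i < L) D.
  by rewrite ltr_wpDr// sumr_ge0// => i _; exact: ltW.
apply: (p_covered_le _ (p_coveredS _ (p_coveredD p1 eC0 S0 zC SP))).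
  rewrite mulr_natl mulr2n lerD2l sumr_const card_ord -mulr_natr.
  have -> : D * L%:R = e * C / 2 * (L%:R / L.+1%:R).
    by rewrite /D invfM; ring.
  have L1 : L%:R / L.+1%:R <= 1 :> R by rewrite ler_pdivrMr ?ltr0n// mul1r ler_nat.
  by rewrite [leRHS]splitr lerD2l ler_piMr// ltW.
move=> _ [al al1 ->]; have [i [be [beta ->]]] := zal _ al1.
exists (z i).
  exists (fun j => (j == i)%:R).
    rewrite (bigD1 i)//= eqxx big1 ?addr0.
      by rewrite -(of_real1 (R := R)) rnorm_of_real normr1.
    by move=> j /negbTE ->; exact: rnorm0.
  rewrite (bigD1 i)//= eqxx scale1r big1 ?addr0// => j /negbTE ->.
  by rewrite scale0r.
exists (\sum_(n < L) be n *: x n) => //; exists (fun n => be n *: x n) => // n.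
exists ((of_real b eta)^-1 * be n); last first.
  by rewrite scalerA mulrAC mulVf ?mul1r// of_real_neq0.
have -> : (of_real b eta)^-1 = of_real b eta^-1 :> K.
  apply: (mulfI (of_real_neq0 (b := b) eta0)).
  by rewrite -of_realM divff ?of_real_neq0// divff ?lt0r_neq0// of_real1.
rewrite /= (rnormZ (V := K^o)) rnorm_of_real ger0_norm ?invr_ge0 ?(ltW eta0)//.
by rewrite ler_pdivrMl// mulr1.
Qed.

Theorem finite_gap (p q : R) (A : set F) : 1 <= p -> 1 <= q ->
  p_compact q A -> ~ p_compact p A -> forall de C : R, 0 < de -> 0 < C ->
  exists N (z : 'I_N -> F), p_covered q de (aco z) /\ ~ p_covered p C (aco z).
Proof.
move=> p1 q1 [x [xy Ax]] nA de C de0 C0; apply: contrapT => nz; apply: nA.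
have H N (z : 'I_N -> F) : p_covered q de (aco z) -> p_covered p C (aco z).
  by move=> zq; apply: contrapT => zp; apply: nz; exists N, z.
(* [D] is made for block 0, on which x need not be small: D * de exceeds the whole norm of x. *)
pose D := 1 + fine (family_norm q%:E x) / de.
have X0 : 0 <= fine (family_norm q%:E x) by rewrite fine_ge0// family_norm_ge0.
have D1 : 1 <= D by rewrite lerDl divr_ge0// ltW.
have D0 : 0 < D by rewrite (lt_le_trans ltr01).
have /choice[tau tauP] : forall j, exists t, forall c, (t <= c)%N ->
    (family_norm q%:E (fun n => if (c <= n)%N then x n else 0%R) <=
      (4^-1 ^+ j * de)%:E)%E.
  by move=> j; apply: family_norm_tail => //; rewrite mulr_gt0// exprn_gt0// invr_gt0.
(* Strictly increasing cuts, so that [a J] tends to infinity, and late enough for the tail after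
   [a j] to be at most 4^-j * de when j > 0. *)
pose a := fix a j := if j is i.+1 then maxn (a i).+1 (tau i.+1) else 0%N.
have aS j : (a j < a j.+1)%N by rewrite /= leq_max leqnn.
have a_ge j : (j <= a j)%N by elim: j => // j /leq_ltn_trans; apply.
pose xb j n := if (a j <= n)%N then x n else 0.
have xbC j : (family_norm q%:E (xb j) <= (D * 4^-1 ^+ j * de)%:E)%E.
  case: j => [|j].
    apply: (@le_trans _ _ (family_norm q%:E x)); first by rewrite /xb.
    rewrite -(fineK (family_norm_fin xy)) lee_fin expr0 mulr1 /D mulrDl.
    by rewrite divfK ?gt_eqF// mul1r lerDr ltW.
  apply: le_trans (tauP j.+1 (a j.+1) _) _; first by rewrite /= leq_maxr.
  by rewrite lee_fin -mulrA ler_peMl// mulr_ge0 ?exprn_ge0 ?invr_ge0// ltW.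
have cov j : p_covered p (2 * (D * C) * 4^-1 ^+ j)
    [set y | exists2 al : nat -> K^o,
      (family_norm (hoelder_conjugate q%:E) al < 1)%E &
      y = \sum_(n < a j.+1) al n *: xb j n].
  have -> : 2 * (D * C) * 4^-1 ^+ j = 2 * (D * 4^-1 ^+ j * C) by ring.
  apply: (p_covered_finite_block p1 q1 de0 C0 H _ _ (xbC j)).
  by rewrite mulr_gt0// exprn_gt0// invr_gt0.
have DC0 : 0 <= 2 * (D * C) by rewrite !mulr_ge0// ltW.
apply: p_covered_compact (p_coveredS _ (p_covered_series p1 DC0 cov)).
move=> y /Ax [al al1 aly].
exists (fun j => \sum_(n < a j.+1) al n *: xb j n) => [j|]; first by exists al.
(* The blocks tile the indices, so their J-th partial sum is the partial sum of the covering series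
   up to [a J], and convergence passes to this subsequence. *)
have vE J : series (fun j => \sum_(n < a j.+1) al n *: xb j n) J =
    series (fun n => al n *: x n) (a J).
  rewrite /series /=; elim: J => [|J IHJ]; first by rewrite !big_nil.
  rewrite big_nat_recr//= IHJ [RHS](big_cat_nat (n := a J))//=; last exact: ltnW (aS J).
  congr (_ + _); rewrite -(big_mkord xpredT (fun n => al n *: xb J n)).
  rewrite (big_cat_nat (n := a J))//=; last exact: ltnW (aS J).
  rewrite big_nat big1 ?add0r.
    by apply: eq_big_nat => n /andP[an _]; rewrite /xb an.
  by move=> n /andP[_ na]; rewrite /xb leqNgt na scaler0.
apply/cvg_rnormP => e e0; have [N NP] := (cvg_rnormP _ _).1 aly e e0.
by exists N => n Nn; rewrite vE NP// (leq_trans Nn).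
Qed.

End finite_gap.

(** * The Hahn-Banach theorem *)

Section hahn_banach.
Context {R : realType} {b : scalar_kind} {V : normedModType (scalars R b)}.
Local Notation K := (scalars R b).
Implicit Types (q : V -> R) (x y : V).

Definition sublinear q : Prop :=
  (forall x y, q (x + y) <= q x + q y) /\
  (forall (t : R) x, 0 <= t -> q (of_real b t *: x) = t * q x).

Lemma sublinear_pos q : (forall x y, q (x + y) <= q x + q y) ->
  (forall (t : R) x, 0 < t -> q (of_real b t *: x) <= t * q x) -> q 0 = 0 ->
  sublinear q.
Proof.
move=> qD qZ q0; split => // t x; rewrite le_eqVlt => /predU1P[<-|t0].
  by rewrite of_real0 scale0r q0 mul0r.
apply/eqP; rewrite eq_le qZ//= -ler_pdivlMl//.
have tV : 0 < t^-1 by rewrite invr_gt0.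
have := qZ t^-1 (of_real b t *: x) tV.
by rewrite scalerA -of_realM mulVf ?gt_eqF// of_real1 scale1r.
Qed.

Lemma sublinear0 q : sublinear q -> q 0 = 0.
Proof. by move=> [_ qZ]; have := qZ 0 0 (lexx 0); rewrite scaler0 mul0r. Qed.

Lemma sublinear_ge q x : sublinear q -> - q (- x) <= q x.
Proof.
move=> sq; have [qD _] := sq.
by rewrite lerNl -subr_ge0 opprK -(sublinear0 sq) -(addNr x) qD.
Qed.

(* The largest sublinear functional below q whose value at - y is at most - q y. *)
Definition lowered q y x : R :=
  inf [set q (x + of_real b t *: y) - t * q y | t in [set t | 0 <= t]].

Lemma lowered_lb q y x t : sublinear q -> 0 <= t ->
  - q (- x) <= q (x + of_real b t *: y) - t * q y.
Proof.
move=> [qD qZ] t0; rewrite -qZ// lerBrDr addrC lerBlDr.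
have := qD (x + of_real b t *: y) (- x).
by rewrite addrAC subrr add0r.
Qed.

Lemma lowered_le q y x t : sublinear q -> 0 <= t ->
  lowered q y x <= q (x + of_real b t *: y) - t * q y.
Proof.
move=> sq t0; apply: ge_inf; last by exists t.
by exists (- q (- x)) => _ [u /= u0 <-]; exact: lowered_lb.
Qed.

Lemma le_lowered q y x (c : R) :
  (forall t : R, 0 <= t -> c <= q (x + of_real b t *: y) - t * q y) -> c <= lowered q y x.
Proof.
move=> h; apply: lb_le_inf; first by exists (q (x + of_real b 0 *: y) - 0 * q y), 0 => /=.
by move=> _ [t t0 <-]; exact: h.
Qed.

Lemma sublinear_lowered q y : sublinear q -> sublinear (lowered q y).
Proof.
move=> sq; have [qD qZ] := sq; apply: sublinear_pos => [u v|t x t0|].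
- rewrite -lerBlDr; apply: le_lowered => t1 t10; rewrite lerBlDr -lerBlDl.
  apply: le_lowered => t2 t20; rewrite lerBlDl.
  apply: (le_trans (lowered_le _ _ sq (addr_ge0 t10 t20))).
  rewrite mulrDl opprD addrACA lerD2r.
  by rewrite of_realD scalerDl addrACA qD.
- rewrite -ler_pdivrMl//; apply: le_lowered => u u0; rewrite ler_pdivrMl//.
  apply: (le_trans (lowered_le _ _ sq (mulr_ge0 (ltW t0) u0))).
  by rewrite of_realM -scalerA -scalerDr qZ ?(ltW t0)// mulrBr mulrA.
- apply/eqP; rewrite eq_le; apply/andP; split.
    by have := lowered_le y 0 sq (lexx 0); rewrite of_real0 scale0r addr0 mul0r subr0 (sublinear0 sq).
  by apply: le_lowered => t t0; rewrite add0r qZ// subrr.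
Qed.

(** Zorn's lemma with the order reversed, so that maximal means pointwise smallest. A chain is
    bounded by its pointwise infimum, which is finite because every sublinear r <= q satisfies - q
    (- x) <= r x. *)
Lemma minimal_sublinear q : sublinear q -> exists m, [/\ sublinear m,
  forall x, m x <= q x & forall m', sublinear m' -> (forall x, m' x <= m x) ->
  forall x, m x <= m' x].
Proof.
move=> sq; pose T := {m : V -> R | sublinear m /\ forall x, m x <= q x}.
pose R' (m n : T) := `[< forall x, sval n x <= sval m x >].
have t0 : T by exists q; split.
have [|r s t /asboolP rs /asboolP st||t tmax] := @ZL_preorder T t0 R'.
- by move=> t; apply/asboolP.
- by apply/asboolP => x; rewrite (le_trans (st x)).
- move=> A Atot; have [[a Aa]|A0] := pselect (A !=set0); last first.
    by exists t0 => s As; exfalso; apply: A0; exists s.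
  pose m x := inf [set sval n x | n in A].
  have mlb x n : A n -> m x <= sval n x.
    move=> An; apply: ge_inf; last by exists n.
    exists (- q (- x)) => _ [[r [sr rq]] _ <-] /=.
    by apply: le_trans (sublinear_ge x sr); rewrite lerN2.
  have lem x (c : R) : (forall n, A n -> c <= sval n x) -> c <= m x.
    move=> h; apply: lb_le_inf; first by exists (sval a x), a.
    by move=> _ [n An <-]; exact: h.
  have sm : sublinear m.
    apply: sublinear_pos => [x y|t x tp|].
    - rewrite -lerBlDr; apply: (lem _ _) => n1 An1; rewrite lerBlDr -lerBlDl.
      apply: (lem _ _) => n2 An2; rewrite lerBlDl.
      have [n [An nn1 nn2]] : exists n, [/\ A n, forall z, sval n z <= sval n1 z &
          forall z, sval n z <= sval n2 z].
        by have [/asboolP h|/asboolP h] := Atot _ _ An1 An2; [exists n2|exists n1].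
      apply: (le_trans (mlb _ _ An)).
      have [[nD _] _] := svalP n.
      by rewrite (le_trans (nD x y))// lerD.
    - rewrite -ler_pdivrMl//; apply: (lem _ _) => n An; rewrite ler_pdivrMl//.
      have [[_ nZ] _] := svalP n.
      by rewrite -nZ ?(ltW tp)//; exact: mlb.
    - apply/eqP; rewrite eq_le; apply/andP; split.
        by have [sa _] := svalP a; rewrite -(sublinear0 sa); exact: mlb.
      by apply: (lem _ _) => n An; have [sn _] := svalP n; rewrite sublinear0.
  have mq : sublinear m /\ forall x, m x <= q x.
    split => // x; have [_ aq] := svalP a.
    exact: le_trans (mlb x _ Aa) (aq x).
  by exists (exist _ m mq) => s As; apply/asboolP => x /=; exact: mlb.
- have [st tq] := svalP t; exists (sval t); split => // m' sm' m't x.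
  have hm : sublinear m' /\ forall x, m' x <= q x.
    by split => // z; rewrite (le_trans (m't z)).
  by have /asboolP := tmax (exist _ m' hm) (asboolT m't); apply.
Qed.

(** A minimal sublinear m is additive: lowering it at y gives a sublinear functional below m, hence
    m again, and t = 1 yields m x <= m (x + y) - m y. Starting from the norm lowered at x0 forces m
    (- x0) <= - |x0|, so the norm is attained at x0. *)
Lemma real_hahn_banach x0 : exists f : V -> R,
  [/\ forall x y, f (x + y) = f x + f y, forall t x, f (of_real b t *: x) = t * f x,
      forall x, f x <= rnorm x & f x0 = rnorm x0].
Proof.
have sn : sublinear (@rnorm R b V).
  split => [x y|t x t0]; first exact: rnormD.
  by rewrite rnormZ rnorm_of_real ger0_norm.
have [m [sm mq mmin]] := minimal_sublinear (sublinear_lowered x0 sn).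
have [mD mZ] := sm.
have mN x : m x <= rnorm x.
  apply: le_trans (mq x) _; have := lowered_le x0 x sn (lexx 0).
  by rewrite of_real0 scale0r addr0 mul0r subr0.
have mDE x y : m (x + y) = m x + m y.
  apply/eqP; rewrite eq_le mD/= -lerBrDr.
  have lm z : lowered m y z <= m z.
    by have := lowered_le y z sm (lexx 0); rewrite of_real0 scale0r addr0 mul0r subr0.
  apply: le_trans (mmin _ (sublinear_lowered y sm) lm x) _.
  by have := lowered_le y x sm ler01; rewrite of_real1 scale1r mul1r.
have mNE x : m (- x) = - m x.
  by apply/eqP; rewrite -addr_eq0 -mDE addNr (sublinear0 sm).
exists m; split => //.
- move=> t x; have [t0|t0] := leP 0 t; first exact: mZ.
  have := mZ (- t) x; rewrite oppr_ge0 => /(_ (ltW t0)).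
  have -> : of_real b (- t) = - of_real b t.
    by apply/eqP; rewrite -addr_eq0 -of_realD addNr of_real0.
  by rewrite scaleNr mNE mulNr => /oppr_inj.
- apply/eqP; rewrite eq_le mN/= -lerN2 -mNE.
  apply: (le_trans (mq _)); have := lowered_le x0 (- x0) sn ler01.
  by rewrite of_real1 scale1r mul1r addNr rnorm0 sub0r.
Qed.

End hahn_banach.

(** * Functionals over real or complex scalars *)

Section bounded_functionals.
Context {R : realType} {b : scalar_kind}.
Local Notation K := (scalars R b).

Lemma rnormM (x y : K) : rnorm (x * y : K^o) = rnorm (x : K^o) * rnorm (y : K^o).
Proof. exact: (rnormZ (V := K^o)). Qed.

Lemma rnormX (x : K) n : rnorm (x ^+ n : K^o) = rnorm (x : K^o) ^+ n.
Proof.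
elim: n => [|n IHn]; last by rewrite !exprS rnormM IHn.
by rewrite !expr0 -[X in rnorm X](of_real1 (R := R)) rnorm_of_real normr1.
Qed.

Lemma real_part_le (x : K) : real_part x <= rnorm (x : K^o).
Proof.
move: x; rewrite /rnorm; case: b => [x|[x y]]; first exact: ler_norm.
rewrite /real_part /=.
apply: (le_trans (ler_norm x)); rewrite -sqrtr_sqr ler_wsqrtr//.
by rewrite lerDl sqr_ge0.
Qed.

Lemma real_partD (x y : K) : real_part (x + y) = real_part x + real_part y.
Proof. by move: x y; case: b => // -[? ?] [? ?]. Qed.

Lemma real_partM (t : R) (x : K) : real_part (of_real b t * x) = t * real_part x.
Proof.
by move: x; case: b => // -[x y]; rewrite /real_part /of_real /= mul0r subr0.
Qed.

(** In the complex case f x = g x - i g (i x), the complex-linear map with real part g. *)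
Lemma complexify (V : normedModType K) (g : V -> R) : (forall x y, g (x + y) = g x + g y) ->
  (forall t x, g (of_real b t *: x) = t * g x) ->
  exists f : V -> K, (forall a x y, f (a *: x + y) = a * f x + f y) /\ forall x, real_part (f x) = g x.
Proof.
move: V g; case: b => W g gD gZ.
  by exists g; split => // a x y; rewrite gD gZ.
pose i : scalars R ComplexScalars := complex.Complex 0 1.
exists (fun x => complex.Complex (g x) (- g (i *: x))); split => //.
have h s t x : g ((complex.Complex s t : scalars R ComplexScalars) *: x) =
    s * g x + t * g (i *: x).
  rewrite -!gZ -gD scalerA -scalerDl; congr (g (_ *: _)).
  by apply/eqP; rewrite eq_complex /=; apply/andP; split; apply/eqP; ring.
move=> [s t] x y; rewrite scalerDr !gD scalerA.
have -> : i * (complex.Complex s t : scalars R ComplexScalars) =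
    (complex.Complex (- t) s : scalars R ComplexScalars).
  by apply/eqP; rewrite eq_complex /=; apply/andP; split; apply/eqP; ring.
rewrite (h s t x) (h (- t) s x); apply/eqP; rewrite eq_complex /=.
by apply/andP; split; apply/eqP; ring.
Qed.

Context {V : normedModType (scalars R b)}.

Definition functional (f : V -> K) : Prop :=
  forall (a : K) x y, f (a *: x + y) = a * f x + f y.

Definition bounded_functional (f : V -> K) : Prop :=
  functional f /\ exists C, forall x, rnorm (f x : K^o) <= C * rnorm x.

Section functional_theory.
Context {f : V -> K}.
Hypothesis hf : functional f.

Lemma functional0 : f 0 = 0.
Proof. by have := hf (-1) 0 0; rewrite scaler0 addr0 mulN1r addNr. Qed.

Lemma functionalD x y : f (x + y) = f x + f y.
Proof. by have := hf 1 x y; rewrite scale1r mul1r. Qed.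

Lemma functionalZ a x : f (a *: x) = a * f x.
Proof. by have := hf a x 0; rewrite addr0 functional0 addr0. Qed.

Lemma functionalB x y : f (x - y) = f x - f y.
Proof. by rewrite functionalD -scaleN1r functionalZ mulN1r. Qed.

Lemma functional_sum I (r : seq I) (P : pred I) (x : I -> V) :
  f (\sum_(i <- r | P i) x i) = \sum_(i <- r | P i) f (x i).
Proof. by rewrite (big_morph f functionalD functional0). Qed.

End functional_theory.

(** Rotating a value onto the positive reals turns a bound on real parts into a bound on moduli. *)
Lemma phase (z : K) : exists2 u : K, rnorm (u : K^o) = 1 &
  u * z = of_real b (rnorm (z : K^o)).
Proof.
have [->|z0] := eqVneq z 0.
  exists 1; last by rewrite mulr0 (rnorm0 (V := K^o)) of_real0.
  by rewrite -[X in rnorm X](of_real1 (R := R)) rnorm_of_real normr1.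
have z1 : rnorm (z : K^o) != 0.
  by apply: contra_neq z0; exact: (@rnorm0_eq0 _ _ K^o).
exists (of_real b (rnorm (z : K^o)) / z); last by rewrite divfK.
apply: (mulIf z1); rewrite -rnormM divfK// rnorm_of_real mul1r.
by rewrite ger0_norm// rnorm_ge0.
Qed.

Theorem hahn_banach (x0 : V) : exists f : V -> K,
  [/\ functional f, forall x, rnorm (f x : K^o) <= rnorm x &
      rnorm (f x0 : K^o) = rnorm x0].
Proof.
have [g [gD gZ gN g0]] := real_hahn_banach x0.
have [f [fL fg]] := complexify gD gZ.
have fN x : rnorm (f x : K^o) <= rnorm x.
  have [u u1 ufx] := phase (f x).
  rewrite -(of_realK (b := b) (rnorm (f x : K^o))) -ufx -functionalZ// fg.
  by rewrite (le_trans (gN _))// rnormZ u1 mul1r.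
exists f; split => //; apply/eqP; rewrite eq_le fN/= -g0 -fg.
exact: real_part_le.
Qed.

(** One vector at a time: a functional norming pi s gives a bounded rank-one projection onto the
    line of pi s, and this is subtracted. By the last clause pi is the identity modulo the span of
    S. *)
Lemma projection_killing (S : seq V) : exists pi : V -> V,
  [/\ forall a x y, pi (a *: x + y) = a *: pi x + pi y,
      exists C, forall x, rnorm (pi x) <= C * rnorm x,
      forall s, s \in S -> pi s = 0 &
      forall x, exists c : nat -> K, x - pi x = \sum_(i < size S) c i *: nth 0 S i].
Proof.
elim: S => [|s S [pi [piL [C piC] piS pic]]].
  exists id; split => //; first by exists 1 => x; rewrite mul1r.
  by move=> x; exists (fun=> 0); rewrite big_ord0 subrr.
have [pis0|pis0] := eqVneq (pi s) 0.
  exists pi; split => //; first by exists C.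
    by move=> t; rewrite inE => /predU1P[->|/piS].
  move=> x; have [c cE] := pic x; exists (fun i => if i is j.+1 then c j else 0).
  by rewrite big_ord_recl/= scale0r add0r.
have [f [fL fN f1]] := hahn_banach (pi s).
have rpis : 0 < rnorm (pi s).
  by rewrite lt_neqAle rnorm_ge0 andbT eq_sym; apply: contra_neq pis0; exact: rnorm0_eq0.
have fs0 : f (pi s) != 0.
  apply: contra_eq_neq f1 => ->.
  by rewrite (rnorm0 (V := K^o)) eq_sym gt_eqF.
exists (fun x => pi x - (f (pi x) / f (pi s)) *: pi s); split.
- move=> a x y; rewrite piL fL mulrDl scalerDl opprD scalerBr scalerA mulrA.
  by rewrite addrACA.
- exists (C + C) => x; rewrite mulrDl (le_trans (rnormD _ _))// lerD//.
  rewrite /rnorm normrN -/(rnorm _) rnormZ -f1 -rnormM divfK//.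
  exact: le_trans (fN _) (piC x).
- move=> t; rewrite inE => /predU1P[->|/piS ->].
    by rewrite divff// scale1r subrr.
  by rewrite functional0// mul0r scale0r subrr.
- move=> x; have [c cE] := pic x; have [d dE] := pic s.
  set l := f (pi x) / f (pi s).
  exists (fun i => if i is j.+1 then c j - l * d j else l).
  rewrite big_ord_recl/= opprB addrA addrAC cE.
  have -> : pi s = s - \sum_(i < size S) d i *: S`_i by rewrite -dE opprB addrC subrK.
  rewrite scalerBr addrCA; congr (_ + _); rewrite scaler_sumr -sumrB.
  by apply: eq_bigr => i _; rewrite scalerBl scalerA.
Qed.

(** In infinite dimension S does not span, so pi is not 0; a functional norming some pi y is
    composed with pi and rescaled. *)
Lemma functional_killing (S : seq V) : ~ finite_dimensional [set: V] ->
  exists (f : V -> K) y, [/\ bounded_functional f,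
    forall s, s \in S -> f s = 0 & f y = 1].
Proof.
move=> Vinf; have [pi [piL [C piC] piS pic]] := projection_killing S.
have [y piy] : exists y, pi y != 0.
  apply: contrapT => npi; apply: Vinf.
  exists (size S), (fun i => nth 0 S i) => x _; have [c cE] := pic x.
  exists (fun i => c i); rewrite -cE; case: (eqVneq (pi x) 0) => [->|pix].
    by rewrite subr0.
  by exfalso; apply: npi; exists x.
have [f [fL fN f1]] := hahn_banach (pi y).
have rpi : 0 < rnorm (pi y).
  by rewrite lt_neqAle rnorm_ge0 andbT eq_sym; apply: contra_neq piy; exact: rnorm0_eq0.
have fs0 : f (pi y) != 0.
  apply: contra_eq_neq f1 => ->.
  by rewrite (rnorm0 (V := K^o)) eq_sym gt_eqF.
exists (fun x => f (pi x) / f (pi y)), y; split.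
- split; first by move=> a u v; rewrite piL fL mulrDl mulrA.
  exists (rnorm ((f (pi y))^-1 : K^o) * C) => x; rewrite rnormM mulrC -mulrA.
  by rewrite ler_wpM2l ?rnorm_ge0// (le_trans (fN _)).
- by move=> s /piS ->; rewrite functional0// mul0r.
- by rewrite divff.
Qed.

End bounded_functionals.

(** * Dvoretzky-Rogers systems *)

Section householder.
Context {R : rcfType} {n : nat}.
Implicit Types (w v : 'cV[R]_n) (A H : 'M[R]_n).

Definition sqnorm w : R := \sum_i w i 0 ^+ 2.

Lemma sqnormE w : sqnorm w = (w^T *m w) 0 0.
Proof. by rewrite mxE; apply: eq_bigr => i _; rewrite mxE expr2. Qed.

Lemma sqnorm_orthogonal H w : H^T *m H = 1%:M -> sqnorm (H *m w) = sqnorm w.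
Proof.
by move=> HH; rewrite !sqnormE trmx_mul -mulmxA (mulmxA H^T) HH mul1mx.
Qed.

Lemma det_orthogonal H : H^T *m H = 1%:M -> `|\det H| = 1.
Proof.
move=> /(congr1 determinant); rewrite det_mulmx det_tr det1 -expr2 => d1.
by apply/eqP; rewrite -(@eqrXn2 _ 2)// ?normr_ge0// real_normK ?num_real// d1 expr1n.
Qed.

(** H is the reflection orthogonal to v, where v is the tail of w from m on, minus the length of
    this tail times the m-th unit vector. As v vanishes before m, the earlier coordinates are fixed,
    and the tail of w is gathered in coordinate m. *)
Lemma householder w (m : 'I_n) : exists H, [/\ H^T *m H = 1%:M,
  forall v (i : 'I_n), (i < m)%N -> (H *m v) i 0 = v i 0 &
  (H *m w) m 0 ^+ 2 = \sum_(i < n | (m <= i)%N) w i 0 ^+ 2].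
Proof.
pose r := \sum_(i < n | (m <= i)%N && (i != m)) w i 0 ^+ 2.
have tailE : \sum_(i < n | (m <= i)%N) w i 0 ^+ 2 = w m 0 ^+ 2 + r.
  by rewrite (bigD1 m)//=.
have r0 : 0 <= r by apply: sumr_ge0 => i _; exact: sqr_ge0.
pose tau := Num.sqrt (w m 0 ^+ 2 + r).
have tau2 : tau ^+ 2 = w m 0 ^+ 2 + r by rewrite sqr_sqrtr// addr_ge0// sqr_ge0.
pose v : 'cV[R]_n := \col_i (if (i < m)%N then 0 else w i 0 - (i == m)%:R * tau).
have vm : v m 0 = w m 0 - tau by rewrite mxE ltnn eqxx mul1r.
have sumv (a : 'I_n -> R) : \sum_i v i 0 * a i =
    (w m 0 - tau) * a m + \sum_(i < n | (m <= i)%N && (i != m)) w i 0 * a i.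
  rewrite (bigID (fun i : 'I_n => (m <= i)%N))/= [X in _ + X]big1 ?addr0; last first.
    by move=> i; rewrite -ltnNge mxE => ->; rewrite mul0r.
  rewrite (bigD1 m)//= vm; congr (_ + _); apply: eq_bigr => i /andP[mi im].
  by rewrite mxE ltnNge mi/= (negbTE im) mul0r subr0.
have vw : \sum_i v i 0 * w i 0 = (w m 0 - tau) * w m 0 + r by rewrite sumv.
have vv : sqnorm v = (w m 0 - tau) ^+ 2 + r.
  rewrite /sqnorm; under eq_bigr do rewrite expr2.
  rewrite sumv vm -expr2; congr (_ + _); apply: eq_bigr => i /andP[mi im].
  by rewrite mxE ltnNge mi/= (negbTE im) mul0r subr0.
(* If v = 0, the tail is already concentrated in coordinate m. *)
have [v0|v0] := eqVneq (sqnorm v) 0.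
  exists 1%:M; split; [by rewrite trmx1 mulmx1|by move=> v' i _; rewrite mul1mx|].
  rewrite mul1mx tailE -tau2; congr (_ ^+ 2); apply/eqP; rewrite -subr_eq0.
  have /eqP : (w m 0 - tau) ^+ 2 + r = 0 by rewrite -vv.
  by rewrite paddr_eq0 ?sqr_ge0// => /andP[]; rewrite sqrf_eq0.
pose H : 'M[R]_n := 1%:M - (2 / sqnorm v) *: (v *m v^T).
have HE u i : (H *m u) i 0 = u i 0 - 2 / sqnorm v * (\sum_j v j 0 * u j 0) * v i 0.
  rewrite mulmxBl mul1mx -scalemxAl -mulmxA mxE; congr (_ + _).
  rewrite !mxE big_ord1 mxE -mulrA; congr (- (_ * _)).
  rewrite mulrC; congr (_ * _); rewrite mxE; apply: eq_bigr => j _.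
  by rewrite mxE.
have vTv : v^T *m v = (sqnorm v)%:M.
  by apply/matrixP => i j; rewrite !ord1 -sqnormE [RHS]mxE eqxx mulr1n.
exists H; split.
- have HT : H^T = H by rewrite /H linearB/= trmx1 linearZ/= trmx_mul trmxK.
  rewrite HT {2}/H mulmxBr mulmx1 -scalemxAr {2}/H mulmxBl mul1mx -scalemxAl.
  rewrite -mulmxA (mulmxA v^T) vTv mul_scalar_mx -scalemxAr scalerA divfK// {1}/H.
  have -> : v *m v^T - 2 *: (v *m v^T) = - (v *m v^T).
    by rewrite scaler_nat mulr2n opprD addrA subrr add0r.
  by rewrite scalerN opprK subrK.
- by move=> u i im; rewrite HE [v i 0]mxE im mulr0 subr0.
- rewrite HE vm vw tailE -tau2; congr (_ ^+ 2).
  have -> : 2 / sqnorm v * ((w m 0 - tau) * w m 0 + r) = 1.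
    apply: (mulIf v0); rewrite mul1r mulrAC divfK// vv.
    apply/eqP; rewrite -subr_eq0; apply/eqP.
    have -> : r = tau ^+ 2 - w m 0 ^+ 2 by rewrite tau2 addrAC subrr add0r.
    by ring.
  by rewrite mul1r subKr.
Qed.

End householder.

(** * Matrices of nearly maximal determinant *)

Section near_maximal_determinant.
Context {R : realType} {b : scalar_kind} {V : normedModType (scalars R b)}.
Local Notation K := (scalars R b).
Variables (N : nat) (u : V -> 'cV[R]_(N + N)).
Hypothesis uZ : forall (t : R) x, u (of_real b t *: x) = t *: u x.

(** The ellipsoid |A y| <= 1 contains the image of the unit ball under u, and its volume is
    inversely proportional to |det A|: a near-maximal |det A| stands for Loewner's ellipsoid of
    minimal volume. *)
Definition admissible (A : 'M[R]_(N + N)) : Prop :=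
  forall x, sqnorm (A *m u x) <= rnorm x ^+ 2.

(* Halving the first m coordinates and multiplying the others by 4 at least
   doubles the determinant, hence violates admissibility. *)
Lemma large_tail A (m : nat) : (m < N)%N -> admissible A -> 0 < `|\det A| ->
  (forall B, admissible B -> `|\det B| < 2 * `|\det A|) ->
  exists2 x, rnorm x < 1 &
    100^-1 <= \sum_(i < N + N | (m <= i)%N) (A *m u x) i 0 ^+ 2.
Proof.
move=> mN adA dA0 maxA.
pose d (i : nat) : R := if (i < m)%N then 2^-1 else 4.
pose D : 'M[R]_(N + N) := diag_mx (\row_i d i).
(* det D = 2^-m 4^(2N - m) = 2^(4N - 3m). The ambient dimension 2N leaves enough stretched
   coordinates for every m < N. *)
have detD : 2 <= \det D.
  rewrite det_diag; under eq_bigr do rewrite mxE.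
  rewrite -(big_mkord xpredT d) (big_cat_nat (n := m))//=; last first.
    by rewrite (leq_trans (ltnW mN))// leq_addr.
  rewrite (eq_big_nat _ _ (F2 := fun=> 2^-1)); last first.
    by move=> i /andP[_ im]; rewrite /d im.
  rewrite [X in _ * X](eq_big_nat _ _ (F2 := fun=> 4)); last first.
    by move=> i /andP[mi _]; rewrite /d ltnNge mi.
  rewrite !prodr_const_nat subn0 exprVn mulrC ler_pdivlMr ?exprn_gt0//.
  rewrite -exprS (_ : 4 = 2 ^+ 2 :> R); last by rewrite -natrX.
  rewrite -exprM ler_weXn2l ?ler1n//.
  by move: mN; lia.
have nadm : ~ admissible (D *m A).
  move=> /maxA; rewrite det_mulmx normrM ltr_pM2r// => h.
  by have := lt_le_trans (le_lt_trans (ler_norm _) h) detD; rewrite ltxx.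
have [x xD] : exists x, rnorm x ^+ 2 < sqnorm (D *m A *m u x).
  apply: contrapT => nx; apply: nadm => x; rewrite leNgt; apply/negP => xD.
  by apply: nx; exists x.
set tail := fun x => \sum_(i < N + N | (m <= i)%N) (A *m u x) i 0 ^+ 2.
have tail_le y : tail y <= sqnorm (A *m u y).
  rewrite /sqnorm (bigID (fun i : 'I_(N + N) => (m <= i)%N))/= lerDl sumr_ge0// => i _.
  exact: sqr_ge0.
have DE : sqnorm (D *m A *m u x) <= 4^-1 * sqnorm (A *m u x) + 16 * tail x.
  rewrite /sqnorm -mulmxA mul_diag_mx.
  rewrite (bigID (fun i : 'I_(N + N) => (m <= i)%N))/= addrC lerD//.
    rewrite mulr_sumr [leRHS](bigID (fun i : 'I_(N + N) => ~~ (m <= i)%N))/=.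
    rewrite -[leLHS]addr0 lerD//.
      apply: ler_sum => i; rewrite -ltnNge => im; rewrite !mxE /d im exprMn.
      by rewrite (_ : 2^-1 ^+ 2 = 4^-1 :> R)//; field.
    by apply: sumr_ge0 => i _; rewrite mulr_ge0 ?invr_ge0// sqr_ge0.
  rewrite /tail mulr_sumr; apply: ler_sum => i mi; rewrite !mxE /d ltnNge mi/= exprMn.
  by rewrite (_ : 4 ^+ 2 = 16 :> R)// -natrX.
(* From |x|^2 < |A u x|^2 / 4 + 16 tail x and |A u x|^2 <= |x|^2. *)
have tx : 3 / 64 * rnorm x ^+ 2 < tail x.
  have := adA x; move: DE xD; move: (sqnorm _) (sqnorm _) (tail x) (rnorm x ^+ 2).
  by move=> s1 s2 t z h1 h2 h3; lra.
have x0 : 0 < rnorm x.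
  rewrite lt_neqAle rnorm_ge0 andbT eq_sym; apply/eqP => x0.
  have := lt_le_trans tx (le_trans (tail_le x) (adA x)).
  by rewrite x0 expr0n/= mulr0 ltxx.
(* Scaling x to norm 1/2 puts it inside the open ball and leaves a tail of at least 3/256, which
   exceeds 1/100. *)
pose t := (2 * rnorm x)^-1.
have t0 : 0 < t by rewrite invr_gt0 mulr_gt0.
exists (of_real b t *: x).
  rewrite rnormZ rnorm_of_real ger0_norm ?(ltW t0)// /t invfM mulrVK ?unitfE ?gt_eqF//.
  by rewrite invf_lt1// ltr1n.
have -> : \sum_(i < N + N | (m <= i)%N) (A *m u (of_real b t *: x)) i 0 ^+ 2 =
    t ^+ 2 * tail x.
  by rewrite mulr_sumr; apply: eq_bigr => i _; rewrite uZ -scalemxAr mxE exprMn.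
apply: (@le_trans _ _ (t ^+ 2 * (3 / 64 * rnorm x ^+ 2))); last first.
  by rewrite ler_wpM2l ?sqr_ge0// ltW.
have -> : t ^+ 2 * (3 / 64 * rnorm x ^+ 2) = 3 / 256.
  by rewrite /t; field; rewrite gt_eqF.
by rewrite ler_pdivlMr// mulrC ler_pdivrMr// -!natrM ler_nat.
Qed.

(** An orthogonal factor on the left preserves admissibility and |det A|, so near-maximality
    survives each step. The reflection of step m moves a large tail into coordinate m and fixes the
    earlier coordinates, so the points already found keep their large entries. The supremum of |det
    A| need not be attained, hence the factor 2 of tolerance. *)
Lemma near_maximal_rows (B0 : R) : (exists2 A, admissible A & 0 < `|\det A|) ->
  (forall A, admissible A -> `|\det A| <= B0) ->
  exists (A : 'M[R]_(N + N)) (x : nat -> V), admissible A /\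
    forall i : 'I_(N + N), (i < N)%N ->
      rnorm (x i) < 1 /\ 100^-1 <= (A *m u (x i)) i 0 ^+ 2.
Proof.
move=> [A0 adA0 dA0] bdd.
pose dets := [set `|\det A| | A in admissible].
have dsup : has_sup dets.
  split; first by exists `|\det A0|, A0.
  by exists B0 => _ [A adA <-]; exact: bdd.
have [A1 [ad1 d1 max1]] : exists A, [/\ admissible A, 0 < `|\det A| &
    forall B, admissible B -> `|\det B| < 2 * `|\det A|].
  have s0 : 0 < sup dets.
    by apply: lt_le_trans dA0 _; apply: ub_le_sup; [case: dsup|exists A0].
  have s20 : 0 < sup dets / 2 by rewrite divr_gt0.
  have [_ [A adA <-] As] := sup_adherent s20 dsup.
  have As2 : sup dets / 2 < `|\det A| by move: As; rewrite {1}(splitr (sup dets)) addrK.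
  exists A; split => //; first exact: lt_trans As2.
  move=> B adB; apply: (@le_lt_trans _ _ (sup dets)).
    by apply: ub_le_sup; [case: dsup|exists B].
  by rewrite mulrC -ltr_pdivrMr.
suff /(_ N (leqnn N)) [A [x [adA _ _ xA]]] : forall m, (m <= N)%N ->
    exists (A : 'M[R]_(N + N)) (x : nat -> V), [/\ admissible A, 0 < `|\det A|,
      forall B, admissible B -> `|\det B| < 2 * `|\det A| &
      forall i : 'I_(N + N), (i < m)%N ->
        rnorm (x i) < 1 /\ 100^-1 <= (A *m u (x i)) i 0 ^+ 2].
  by exists A, x; split.
elim => [|m IHm] mN.
  by exists A1, (fun=> 0); split.
have [A [x [adA dA maxA xA]]] := IHm (ltnW mN).
have [y y1 ytail] := large_tail mN adA dA maxA.
have mNN : (m < N + N)%N by rewrite (leq_trans mN)// leq_addr.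
have [H [HH Hlow Hm]] := householder (A *m u y) (Ordinal mNN).
exists (H *m A), (fun i => if i == m then y else x i); split.
- by move=> z; rewrite -mulmxA sqnorm_orthogonal.
- by rewrite det_mulmx normrM (det_orthogonal HH) mul1r.
- by move=> B /maxA; rewrite det_mulmx normrM (det_orthogonal HH) mul1r.
- move=> i; rewrite ltnS leq_eqVlt => /predU1P[im|im].
    rewrite im eqxx; split => //.
    have -> : i = Ordinal mNN by exact/val_inj.
    by rewrite -mulmxA Hm.
  have [xi1 xi2] := xA i im.
  by rewrite ltn_eqF// -mulmxA Hlow.
Qed.

End near_maximal_determinant.

Section dvoretzky_rogers.
Context {R : realType} {b : scalar_kind} {V : normedModType (scalars R b)}.
Local Notation K := (scalars R b).
Hypothesis Vinf : ~ finite_dimensional [set: V].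

Lemma triangular_system (S : seq V) : exists (f : nat -> V -> K) (y : nat -> V),
  forall j, [/\ bounded_functional (f j), forall s, s \in S -> f j s = 0,
    forall i, (i < j)%N -> f j (y i) = 0 & f j (y j) = 1].
Proof.
have [s|g gP] := @history_choice ((V -> K) * V) (fun s t => [/\ bounded_functional t.1,
    forall v, v \in S ++ [seq r.2 | r <- s] -> t.1 v = 0 & t.1 t.2 = 1]).
  have [f [y [bf fS fy]]] := functional_killing (S ++ [seq r.2 | r <- s]) Vinf.
  by exists (f, y).
exists (fun j => (g j).1), (fun j => (g j).2) => j; have [bf fS fy] := gP j.
split => // [s sS|i ij]; apply: fS; rewrite mem_cat ?sS// -map_comp.
by apply/orP; right; apply/mapP; exists i; rewrite ?mem_iota.
Qed.

Lemma real_part_abs (z : K) : `|real_part z| <= rnorm (z : K^o).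
Proof.
rewrite ler_norml real_part_le andbT lerNl.
have := real_part_le (- z); rewrite /rnorm normrN -/(rnorm _).
have -> : real_part (- z) = - real_part z.
  apply/eqP; rewrite -addr_eq0 -real_partD addNr -(of_real0 (R := R)).
  by rewrite of_realK.
by [].
Qed.

(** With th = -i in the complex case, |z|^2 = Re(z)^2 + Re(-i z)^2; this lets real matrices serve
    both scalar fields. *)
Lemma rnorm_sqr_parts : exists2 th : K, rnorm (th : K^o) <= 1 &
  forall z : K, rnorm (z : K^o) ^+ 2 <= real_part z ^+ 2 + real_part (th * z) ^+ 2.
Proof.
case: b.
  exists 0; first by rewrite rnorm0 ler01.
  by move=> z; rewrite rnorm_real real_normK ?num_real// lerDl sqr_ge0.
exists (complex.Complex 0 (-1)).
  by rewrite rnorm_complex expr0n/= add0r sqrrN expr1n sqrtr1.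
move=> [x y]; rewrite rnorm_complex sqr_sqrtr ?addr_ge0 ?sqr_ge0//.
by rewrite /real_part /= mul0r mulN1r sub0r opprK.
Qed.

(** The functionals are halves of the first N rows of a near-maximal matrix acting on 2N
    coordinates, which come from a triangular system vanishing on S. *)
Theorem dvoretzky_rogers (S : seq V) N :
  exists (f : 'I_N -> V -> K) (x : 'I_N -> V), [/\ forall i, bounded_functional (f i),
    forall i s, s \in S -> f i s = 0,
    forall x, \sum_(i < N) rnorm (f i x : K^o) ^+ 2 <= rnorm x ^+ 2,
    forall i, rnorm (x i) < 1 & forall i, 20^-1 <= rnorm (f i (x i) : K^o)].
Proof.
have [f [y fy]] := triangular_system S.
have bf (j : 'I_(N + N)) : bounded_functional (f j) by have [] := fy j.
have fL (j : 'I_(N + N)) : functional (f j) by have [] := bf j.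
pose u x : 'cV[R]_(N + N) := \col_j real_part (f j x).
have uZ (t : R) x : u (of_real b t *: x) = t *: u x.
  by apply/matrixP => i j; rewrite !mxE functionalZ// real_partM.
have /choice[C fC] : forall j : 'I_(N + N), exists C, forall x,
    rnorm (f j x : K^o) <= C * rnorm x.
  by move=> j; have [_ [C fC]] := bf j; exists C.
pose c := 1 + \sum_j C j ^+ 2.
have c0 : 0 < c by rewrite ltr_wpDr// sumr_ge0// => j _; exact: sqr_ge0.
have adm0 : exists2 A, admissible u A & 0 < `|\det A|.
  exists (Num.sqrt c)^-1%:M; last first.
    by rewrite det_scalar normr_gt0 expf_neq0// invr_neq0// gt_eqF// sqrtr_gt0.
  move=> x; rewrite mul_scalar_mx /sqnorm.
  have -> : \sum_i ((Num.sqrt c)^-1 *: u x) i 0 ^+ 2 =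
      c^-1 * \sum_(i < N + N) real_part (f i x) ^+ 2.
    rewrite mulr_sumr; apply: eq_bigr => i _; rewrite !mxE exprMn exprVn sqr_sqrtr//.
    exact: ltW.
  rewrite ler_pdivrMl// (@le_trans _ _ (\sum_(j < N + N) C j ^+ 2 * rnorm x ^+ 2))//.
    apply: ler_sum => j _; rewrite -real_normK ?num_real// -exprMn.
    have h := le_trans (real_part_abs (f j x)) (fC j x).
    by rewrite lerXn2r ?nnegrE// (le_trans _ h).
  by rewrite -mulr_suml ler_wpM2r ?sqr_ge0// /c lerDr.
(* [T] has determinant 1, and the columns of [A *m T] are the vectors A u (y_j), with entries at
   most |y_j|: this bounds |det A| over all admissible [A]. *)
pose T : 'M[R]_(N + N) := \matrix_(i, j) real_part (f i (y j)).
have detT : \det T = 1.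
  rewrite -det_tr det_trig.
    rewrite big1// => i _; rewrite !mxE.
    have [_ _ _ ->] := fy i.
    by rewrite -(of_real1 (R := R)) of_realK.
  apply/is_trig_mxP => i j ij; rewrite !mxE.
  have [_ _ fj0 _] := fy j; rewrite (fj0 i ij).
  by rewrite -(of_real0 (R := R)) of_realK.
pose M := \sum_(j < N + N) rnorm (y j).
have bdd A : admissible u A -> `|\det A| <= \sum_(s : 'S_(N + N)) \prod_(i < N + N) M.
  move=> adA; have -> : \det A = \det (A *m T) by rewrite det_mulmx detT mulr1.
  rewrite /determinant.
  apply: (le_trans (ler_norm_sum _ _ _)); apply: ler_sum => s _.
  rewrite normrM normrX normrN1 expr1n mul1r normr_prod; apply: ler_prod => i _.
  rewrite normr_ge0/=.
  have -> : (A *m T) i (s i) = (A *m u (y (s i))) i 0.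
    by rewrite !mxE; apply: eq_bigr => j _; rewrite !mxE.
  apply: (@le_trans _ _ (rnorm (y (s i)))); last first.
    rewrite /M (bigD1 (s i))//= lerDl sumr_ge0// => j _; exact: rnorm_ge0.
  rewrite -(@ler_pXn2r _ 2) ?nnegrE ?rnorm_ge0// real_normK ?num_real//.
  apply: le_trans (adA _); rewrite /sqnorm (bigD1 i)//= lerDl sumr_ge0// => j _.
  exact: sqr_ge0.
have [A [x [adA xA]]] := near_maximal_rows uZ adm0 bdd.
pose w (i : 'I_N) : 'I_(N + N) := lshift N i.
(* The factor 1/2 pays for the passage from real parts to moduli, where the contraction bound is
   used at both z and th *: z. It turns the entry 1/10 into 1/20. *)
pose h (i : 'I_N) z : K := of_real b 2^-1 * \sum_j of_real b (A (w i) j) * f j z.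
have hL i : functional (h i).
  move=> a z1 z2; rewrite /h mulrCA -mulrDr; congr (_ * _).
  rewrite mulr_sumr -big_split /=; apply: eq_bigr => j _.
  by rewrite fL mulrDr mulrCA.
have hRe i z : real_part (h i z) = 2^-1 * (A *m u z) (w i) 0.
  rewrite /h real_partM; congr (_ * _); rewrite mxE.
  rewrite (big_morph (@real_part R b) real_partD (id1 := 0)); last first.
    by rewrite -(of_real0 (R := R)) of_realK.
  by apply: eq_bigr => j _; rewrite real_partM mxE.
have wsum z : \sum_(i < N) (A *m u z) (w i) 0 ^+ 2 <= rnorm z ^+ 2.
  apply: le_trans (adA z); rewrite /sqnorm big_split_ord /= lerDl sumr_ge0// => i _.
  exact: sqr_ge0.
have hsum z : \sum_(i < N) real_part (h i z) ^+ 2 <= 2^-1 ^+ 2 * rnorm z ^+ 2.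
  under eq_bigr do rewrite hRe exprMn.
  by rewrite -mulr_sumr ler_wpM2l// exprn_ge0// invr_ge0.
exists h, (fun i => x i); split.
- move=> i; split => //.
  exists (\sum_j rnorm (of_real b 2^-1 * of_real b (A (w i) j) : K^o) * C j) => z.
  rewrite /h mulr_sumr (le_trans (rnorm_sum (V := K^o) _ _ _))// mulr_suml.
  apply: ler_sum => j _; rewrite mulrA -[leRHS]mulrA.
  have -> : rnorm (of_real b 2^-1 * of_real b (A (w i) j) * f j z : K^o) =
      rnorm (of_real b 2^-1 * of_real b (A (w i) j) : K^o) * rnorm (f j z : K^o).
    exact: rnormM.
  by apply: ler_wpM2l; [exact: rnorm_ge0|exact: fC].
- move=> i s sS; rewrite /h big1 ?mulr0// => j _.
  by have [_ fS _ _] := fy j; rewrite fS// mulr0.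
- move=> z; have [th th1 thP] := rnorm_sqr_parts.
  apply: (@le_trans _ _ (4^-1 * rnorm z ^+ 2 + 4^-1 * rnorm (th *: z) ^+ 2)).
    have -> : 4^-1 = 2^-1 ^+ 2 :> R by rewrite exprVn -natrX.
    apply: (@le_trans _ _ (\sum_(i < N) (real_part (h i z) ^+ 2 +
        real_part (h i (th *: z)) ^+ 2))).
      by apply: ler_sum => i _; rewrite functionalZ//; exact: thP.
    by rewrite big_split /= lerD.
  rewrite -mulrDr ler_pdivrMl//.
  have : rnorm (th *: z) ^+ 2 <= rnorm z ^+ 2.
    by rewrite lerXn2r ?nnegrE ?rnorm_ge0// rnormZ ler_piMl ?rnorm_ge0.
  have := sqr_ge0 (rnorm z); move: (rnorm z ^+ 2) (rnorm (th *: z) ^+ 2) => s1 s2.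
  by move=> ? ?; lra.
- by move=> i; have [] := xA (w i) (ltn_ord i).
- move=> i; have [_] := xA (w i) (ltn_ord i).
  move=> hx; apply: le_trans (real_part_abs _); rewrite hRe normrM ger0_norm ?invr_ge0//.
  have -> : 20^-1 = 2^-1 * 10^-1 :> R by rewrite -invfM -natrM.
  rewrite ler_wpM2l ?invr_ge0// -(@ler_pXn2r _ 2) ?nnegrE ?invr_ge0//.
  by rewrite real_normK ?num_real// exprVn -natrX.
Qed.

End dvoretzky_rogers.

(** * Independent sets in sparse directed graphs *)

Section sparse_relations.

(** Double counting: at most d edges inside A end at each vertex, so on average at most d start from
    a vertex. *)
Lemma small_out_degree (T : finType) (e : rel T) d (A : {set T}) :
  (forall j, #|[pred i | e i j]| <= d)%N -> (0 < #|A|)%N ->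
  exists2 v, v \in A & (#|[pred j in A | e v j]| <= d)%N.
Proof.
move=> ed A0; apply: contrapT => nv.
have h v : v \in A -> (d < #|[pred j in A | e v j]|)%N.
  by move=> vA; rewrite ltnNge; apply/negP => vd; apply: nv; exists v.
have : (\sum_(v in A) d.+1 <= \sum_(v in A) #|[pred j in A | e v j]|)%N.
  by apply: leq_sum => v /h.
have -> : (\sum_(v in A) #|[pred j in A | e v j]| =
    \sum_(v in A) \sum_(j in A) e v j)%N.
  apply: eq_bigr => v _; rewrite -sum1_card.
  rewrite [RHS](eq_bigr (fun j => if e v j then 1%N else 0%N)); last first.
    by move=> j _; case: (e v j).
  by rewrite -big_mkcondr; apply: eq_bigl => j; rewrite inE.
rewrite exchange_big /= => h1.
have : (\sum_(v in A) d.+1 <= \sum_(v in A) d)%N.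
  apply: (leq_trans h1); apply: leq_sum => j _; apply: leq_trans (ed j).
  rewrite -sum1_card [leqLHS](eq_bigr (fun i => if e i j then 1%N else 0%N)); last first.
    by move=> i _; case: (e i j).
  rewrite -big_mkcondr [leqRHS](eq_bigl (e^~ j))//.
  rewrite [leqRHS](bigID (mem A))/= (eq_bigl (fun i => e i j && (i \in A))).
    exact: leq_addr.
  by move=> i; rewrite andbC.
by rewrite !sum_nat_const leq_pmul2l// ltnn.
Qed.

(** Greedy choice: each chosen v removes itself, at most d out-neighbours and at most d
    in-neighbours. *)
Lemma independent_subset (T : finType) (e : rel T) d N (A : {set T}) :
  (forall j, #|[pred i | e i j]| <= d)%N -> (N * (2 * d).+1 <= #|A|)%N ->
  exists B : {set T}, [/\ B \subset A, #|B| = N &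
    {in B &, forall i j, i != j -> ~~ e i j}].
Proof.
move=> ed; elim: N A => [|N IHN] A NA.
  exists finset.set0; split; [exact: finset.sub0set|exact: finset.cards0|].
  by move=> i j; rewrite finset.in_set0.
have A0 : (0 < #|A|)%N by apply: leq_trans NA; rewrite mulSn addSn.
have [v vA vd] := small_out_degree ed A0.
pose X := (v |: ([set j | j \in [pred j in A | e v j]] :|: [set i | i \in [pred i | e i v]]))%SET.
have cX : (#|X| <= (2 * d).+1)%N.
  rewrite cardsU1 -add1n leq_add ?leq_b1// (leq_trans (leq_card_setU _ _))//.
  rewrite mul2n -addnn leq_add//.
    by apply: leq_trans vd; apply/eq_leq/eq_card => j; rewrite !inE.
  by apply: leq_trans (ed v); apply/eq_leq/eq_card => j; rewrite !inE.
have [|B [BA BN Bi]] := IHN (A :\: X)%SET.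
  rewrite cardsD leq_subRL; last exact/subset_leq_card/subsetIl.
  apply: leq_trans NA; rewrite (mulSn N) leq_add2r.
  by apply: leq_trans cX; exact/subset_leq_card/subsetIr.
have vB : v \notin B.
  by apply/negP => /(fintype.subsetP BA); rewrite !inE eqxx.
have BX j : j \in B -> ~~ e v j && ~~ e j v.
  move=> /(fintype.subsetP BA); rewrite !inE !negb_or => /andP[/and3P[_ evj ejv] jA].
  by rewrite jA/= in evj; rewrite evj ejv.
exists (v |: B)%SET; split.
- by rewrite finset.subUset finset.sub1set vA (fintype.subset_trans BA)// finset.subsetDl.
- by rewrite cardsU1 vB BN.
- move=> i j; rewrite !inE => /predU1P[->|iB] /predU1P[->|jB].
  + by rewrite eqxx.
  + by move=> _; have /andP[] := BX j jB.
  + by move=> _; have /andP[] := BX i iB.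
  + exact: Bi.
Qed.

End sparse_relations.

(** As sum_i |f_i (x_j)|^2 <= 1, at most about 1/e functionals have square larger than e at a given
    x_j. This bounded in-degree allows N independent indices to be extracted from a larger system,
    and dropping functionals preserves the square-sum bound. *)
Lemma sparse_dvoretzky_rogers (R : realType) (b : scalar_kind)
    (V : normedModType (scalars R b)) (S : seq V) N (e : R) :
  ~ finite_dimensional [set: V] -> 0 < e ->
  exists (f : 'I_N -> V -> scalars R b) (x : 'I_N -> V),
  [/\ (forall i, bounded_functional (f i)) /\ (forall i s, s \in S -> f i s = 0),
    forall x, \sum_(i < N) rnorm (f i x : (scalars R b)^o) ^+ 2 <= rnorm x ^+ 2,
    forall i, rnorm (x i) < 1, forall i, 20^-1 <= rnorm (f i (x i) : (scalars R b)^o) &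
    forall i j, i != j -> rnorm (f i (x j) : (scalars R b)^o) ^+ 2 <= e].
Proof.
move=> Vinf e0; pose d := (Num.truncn e^-1).+1.
have d0 : 0 < d%:R :> R by rewrite ltr0n.
have de : d%:R^-1 <= e.
  by rewrite -[leRHS]invrK lef_pV2 ?posrE ?invr_gt0// ltW// truncnS_gt.
pose M := (N * (2 * d).+1)%N.
have [f [x [bf fS fsum x1 fx]]] := dvoretzky_rogers Vinf S M.
pose E (i j : 'I_M) := e < rnorm (f i (x j) : (scalars R b)^o) ^+ 2.
have Ed j : (#|[pred i | E i j]| <= d)%N.
  rewrite -(ler_nat R) -[leRHS]mul1r -ler_pdivrMr//.
  apply: (@le_trans _ _ (\sum_(i | E i j) e)).
    by rewrite sumr_const -[leRHS]mulr_natl ler_wpM2l.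
  apply: (@le_trans _ _ (rnorm (x j) ^+ 2)); last first.
    by rewrite expr_le1 ?rnorm_ge0// ltW.
  apply: le_trans (fsum (x j)); rewrite [leRHS](bigID (E^~ j))/=.
  rewrite -[leLHS]addr0 lerD//.
    by apply: ler_sum => i /ltW.
  by apply: sumr_ge0 => i _; exact: sqr_ge0.
have [|B [_ BN Bi]] := @independent_subset _ E d N [set: 'I_M]%SET Ed.
  by rewrite cardsT card_ord.
pose g (i : 'I_N) : 'I_M := enum_val (cast_ord (esym BN) i).
have gB i : g i \in B by exact: enum_valP.
have ginj : injective g by move=> i j /enum_val_inj /cast_ord_inj.
exists (fun i => f (g i)), (fun i => x (g i)); split => //.
- by split => [i|i s]; [exact: bf|exact: fS].
- move=> z; apply: le_trans (fsum z).
  rewrite -(big_map g xpredT (fun i => rnorm (f i z : (scalars R b)^o) ^+ 2)).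
  rewrite big_uniq/=; last by rewrite map_inj_uniq// index_enum_uniq.
  rewrite [leRHS](bigID (mem [seq g i | i <- index_enum 'I_N]))/= lerDl.
  by apply: sumr_ge0 => i _; exact: sqr_ge0.
- move=> i j ij; have := Bi _ _ (gB i) (gB j); rewrite (inj_eq ginj) => /(_ ij).
  by rewrite -leNgt.
Qed.

(** * Hulls recovered from the values of power sums *)

Section blocks.
Context {R : realType} {b : scalar_kind} {E F : normedModType (scalars R b)}.
Local Notation K := (scalars R b).
Context {p : R}.
Hypothesis p1 : 1 <= p.

Definition power_sum (k N : nat) (f : 'I_N -> E -> K) (z : 'I_N -> F) (x : E) : F :=
  \sum_(i < N) f i x ^+ k *: z i.

(* Since |f_i (x_i)| >= 1/20 and the numbers f_i (x_j), i <> j, are tiny,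
   aco z lies in 20^k aco {P (x_j)} + (1/2) aco z, where P is the power sum;
   hence m_p (aco z) <= 2 * 20^k m_p {P (x_j)}. *)
Lemma aco_power_sum k N (f : 'I_N -> E -> K) (z : 'I_N -> F) (x : 'I_N -> E) (e : R) :
  (2 <= k)%N -> (forall y, \sum_(i < N) rnorm (f i y : K^o) ^+ 2 <= rnorm y ^+ 2) ->
  (forall i, rnorm (x i) < 1) -> (forall i, 20^-1 <= rnorm (f i (x i) : K^o)) ->
  (forall i j, i != j -> rnorm (f i (x j) : K^o) ^+ 2 <= e) ->
  0 <= e -> 2 * 20 ^+ k * N%:R * e <= 1 ->
  forall (A : set F) (C : R), 0 < C -> (forall j, A (power_sum k f z (x j))) ->
  p_covered p C A -> p_covered p (3 * 20 ^+ k * C) (aco z).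
Proof.
move=> k2 fsum x1 fx fe e0 eN A C C0 AP AC.
have f1 i j : rnorm (f i (x j) : K^o) <= 1.
  rewrite -(@expr_le1 _ 2) ?rnorm_ge0//; apply: (@le_trans _ _ (rnorm (x j) ^+ 2)).
    apply: le_trans (fsum _); rewrite (bigD1 i)//= lerDl sumr_ge0// => l _.
    exact: sqr_ge0.
  by rewrite expr_le1 ?rnorm_ge0// ltW.
have fk i j : i != j -> rnorm (f i (x j) ^+ k : K^o) <= e.
  move=> ij; rewrite rnormX; apply: le_trans (fe _ _ ij).
  by rewrite ler_wiXn2l ?rnorm_ge0.
pose c j : K := (f j (x j) ^+ k)^-1.
have fx0 j : f j (x j) != 0.
  apply: contraTneq (fx j) => ->.
  by rewrite (rnorm0 (V := K^o)) -ltNge invr_gt0.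
have cE j : c j * f j (x j) ^+ k = 1 by rewrite mulVf// expf_neq0.
have c20 j : rnorm (c j : K^o) <= 20 ^+ k.
  have h1 : rnorm (c j : K^o) * rnorm (f j (x j) ^+ k : K^o) = 1.
    by rewrite -rnormM cE -[X in rnorm X](of_real1 (R := R)) rnorm_of_real normr1.
  have h : 20^-1 ^+ k <= rnorm (f j (x j) ^+ k : K^o).
    by rewrite rnormX lerXn2r ?nnegrE ?rnorm_ge0 ?invr_ge0.
  have : rnorm (c j : K^o) * 20^-1 ^+ k <= 1.
    apply: (@le_trans _ _ (rnorm (c j : K^o) * rnorm (f j (x j) ^+ k : K^o))).
      by rewrite ler_wpM2l ?rnorm_ge0.
    by rewrite h1.
  by rewrite exprVn ler_pdivrMr ?exprn_gt0// mul1r.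
pose t : R := 20 ^+ k; have t0 : 0 < t by rewrite exprn_gt0.
pose P := power_sum k f z.
have split_aco : aco z `<=` [set v + w |
    v in [set of_real b t *: y | y in aco (P \o x)] &
    w in [set of_real b 2^-1 *: y | y in aco z]].
  move=> _ [a a1 ->].
  (* The off-diagonal error: evaluating P at x_j, with weight a_j c_j, yields a_j z_j plus small
     multiples of the other z_i, and [o i] collects those of z_i. *)
  pose o i : K := \sum_(j < N | j != i) a j * c j * f i (x j) ^+ k.
  have zE : \sum_(j < N) a j *: z j =
      \sum_(j < N) (a j * c j) *: P (x j) - \sum_(i < N) o i *: z i.
    have -> : \sum_(j < N) (a j * c j) *: P (x j) =
        \sum_(i < N) (\sum_(j < N) a j * c j * f i (x j) ^+ k) *: z i.
      under [RHS]eq_bigr do rewrite scaler_suml.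
      rewrite exchange_big /=; apply: eq_bigr => j _.
      rewrite /P /power_sum scaler_sumr; apply: eq_bigr => i _.
      by rewrite scalerA.
    rewrite -sumrB; apply: eq_bigr => i _.
    rewrite (bigD1 i)//= -scalerBl -mulrA cE mulr1; congr (_ *: _).
    by rewrite /o addrK.
  have aj (j : 'I_N) : rnorm (a j * c j : K^o) <= rnorm (a j : K^o) * t.
    by rewrite rnormM ler_wpM2l ?rnorm_ge0.
  exists (\sum_(j < N) (a j * c j) *: P (x j)).
    exists (\sum_(j < N) (of_real b t^-1 * (a j * c j)) *: P (x j)).
      exists (fun j => of_real b t^-1 * (a j * c j)) => //.
      apply: le_trans a1; apply: ler_sum => j _.
      rewrite rnormM rnorm_of_real ger0_norm ?invr_ge0 ?(ltW t0)//.
      by rewrite ler_pdivrMl// (mulrC t).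
    rewrite scaler_sumr; apply: eq_bigr => j _.
    by rewrite scalerA mulrA -of_realM divff ?gt_eqF// of_real1 mul1r.
  exists (- \sum_(i < N) o i *: z i); last exact/esym.
  exists (\sum_(i < N) (- (of_real b 2 * o i)) *: z i); last first.
    rewrite scaler_sumr -sumrN; apply: eq_bigr => i _.
    by rewrite scalerA mulrN mulrA -of_realM mulVf// of_real1 mul1r scaleNr.
  exists (fun i => - (of_real b 2 * o i)) => //.
  have oE i : rnorm (- (of_real b 2 * o i) : K^o) <=
      2 * \sum_(j < N) rnorm (a j : K^o) * t * e.
    rewrite /rnorm normrN -/(rnorm _) rnormM rnorm_of_real ger0_norm//.
    rewrite ler_wpM2l//; apply: (le_trans (rnorm_sum (V := K^o) _ _ _)).
    rewrite [leRHS](bigID (fun j => j != i))/= -[leLHS]addr0 lerD//.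
      apply: ler_sum => j ji; rewrite rnormM ler_pM ?rnorm_ge0//.
      by apply: fk; rewrite eq_sym.
    by apply: sumr_ge0 => j _; rewrite !mulr_ge0 ?rnorm_ge0 ?(ltW t0).
  apply: (le_trans (ler_sum _ (fun i _ => oE i))).
  rewrite sumr_const card_ord -!mulr_suml -[leLHS]mulr_natl.
  apply: le_trans eN; rewrite -/t.
  set s := \sum_(j < N) _ in a1 *.
  have -> : N%:R * (2 * (s * t * e)) = s * (2 * t * N%:R * e) by ring.
  by rewrite ler_piMl// !mulr_ge0// ltW.
have [D D0 zD] := p_covered_finite p1 z.
have zfin : p_measure p (aco z) \is a fin_num by apply: p_measure_fin; exact: p_covered_compact zD.
have PA : p_covered p C (aco (P \o x)) by apply: p_covered_aco AC.
have tP : p_covered p (t * C) [set of_real b t *: y | y in aco (P \o x)].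
  have := p_coveredZ p1 (of_real b t) PA.
  by rewrite rnorm_of_real ger0_norm// ltW.
have hz : (p_measure p [set of_real b 2^-1 *: y | y in aco z] <=
    (2^-1)%:E * p_measure p (aco z))%E.
  have := p_measureZ_le p1 (of_real b 2^-1) (p_covered_compact zD).
  by rewrite rnorm_of_real ger0_norm// invr_ge0.
have : (p_measure p (aco z) <= (t * C)%:E + (2^-1)%:E * p_measure p (aco z))%E.
  apply: (le_trans (le_p_measure split_aco)).
  apply: (le_trans (p_measureD p1 (p_covered_compact tP) _)).
    exact/p_compactZ/(p_covered_compact zD).
  by rewrite leeD// p_covered_measure.
(* As m_p (aco z) is finite, its half on the right can be absorbed, giving m <= 2 t C; the 3 in
   place of 2 makes the inequality strict for [p_measure_covered]. *)
rewrite -(fineK zfin) -EFinM -EFinD lee_fin; set m := fine _ => mle.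
apply: p_measure_covered; rewrite -(fineK zfin) lte_fin -/m -/t.
have tC : 0 < t * C by rewrite mulr_gt0.
rewrite -mulrA; move: (t * C) tC mle => u u0 mle; lra.
Qed.

(** The number N of vectors fixes how small the cross terms have to be; the functionals and points
    depend on z through N alone. *)
Theorem block (S : seq E) k : ~ finite_dimensional [set: E] -> (2 <= k)%N ->
  forall N (z : 'I_N -> F), exists (f : 'I_N -> E -> K) (x : 'I_N -> E),
  [/\ forall i, bounded_functional (f i), forall i s, s \in S -> f i s = 0,
    forall y, \sum_(i < N) rnorm (f i y : K^o) ^+ 2 <= rnorm y ^+ 2,
    forall i, rnorm (x i) < 1 &
    forall (A : set F) (C : R), 0 < C -> (forall j, A (power_sum k f z (x j))) ->
      p_covered p C A -> p_covered p (3 * 20 ^+ k * C) (aco z)].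
Proof.
move=> Einf k2 N z.
pose e : R := (2 * 20 ^+ k * N.+1%:R)^-1.
have e0 : 0 < e by rewrite invr_gt0 !mulr_gt0 ?exprn_gt0// ltr0n.
have [f [x [[bf fS] fsum x1 fx fe]]] := sparse_dvoretzky_rogers S N Einf e0.
exists f, x; split => //.
apply: (aco_power_sum (e := e)) => //; first exact: ltW.
rewrite ler_pdivrMr ?mul1r; last by rewrite !mulr_gt0 ?exprn_gt0// ltr0n.
by rewrite ler_wpM2l ?mulr_ge0 ?exprn_ge0// ler_nat.
Qed.

End blocks.

(** * Separable subspaces and bounded multilinear maps *)

Section closed_spans.
Context {R : realType} {b : scalar_kind} {F : normedModType (scalars R b)}.
Local Notation K := (scalars R b).

Lemma rnormN (z : F) : rnorm (- z) = rnorm z.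
Proof. by rewrite /rnorm normrN. Qed.

Lemma rnormB_triangle (x y z : F) : rnorm (x - z) <= rnorm (x - y) + rnorm (y - z).
Proof. by rewrite -[x - z](subrKA y) rnormD. Qed.

(** A net of mesh (M+1)^-2 on the unit disc, blown up by M+1, has mesh 1/(M+1) on the disc of radius
    M+1. *)
Lemma scalars_dense : exists ka : nat * nat -> K, forall (a : K) (e : R), 0 < e ->
  exists i, rnorm (a - ka i : K^o) <= e.
Proof.
have M0 (M : nat) : 0 < M.+1%:R :> R by rewrite ltr0n.
have /choice[G GP] : forall M : nat, exists G : seq K, forall a : K,
    rnorm (a : K^o) <= 1 -> exists2 g, g \in G & rnorm (g : K^o) <= rnorm (a : K^o) /\
      rnorm (a - g : K^o) <= M.+1%:R ^- 2.
  by move=> M; apply: unit_disc_net; rewrite invr_gt0 exprn_gt0.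
exists (fun i => of_real b i.1.+1%:R * nth 0 (G i.1) i.2) => a e e0.
pose M := Num.truncn (rnorm (a : K^o) + e^-1).
have MP : rnorm (a : K^o) + e^-1 < M.+1%:R by exact: truncnS_gt.
have aM : rnorm (a : K^o) < M.+1%:R.
  by apply: le_lt_trans MP; rewrite lerDl invr_ge0 ltW.
have eM : e^-1 < M.+1%:R by apply: le_lt_trans MP; rewrite lerDr rnorm_ge0.
have MM : of_real b M.+1%:R * of_real b M.+1%:R^-1 = 1 :> K.
  by rewrite -of_realM divff ?gt_eqF// of_real1.
have [|g gG [_ g2]] := GP M (of_real b M.+1%:R^-1 * a).
  rewrite rnormM rnorm_of_real ger0_norm ?invr_ge0 ?(ltW (M0 M))//.
  by rewrite ler_pdivrMl// mulr1 ltW.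
exists (M, index g (G M)); rewrite /= nth_index//.
have -> : a - of_real b M.+1%:R * g =
    of_real b M.+1%:R * (of_real b M.+1%:R^-1 * a - g).
  by rewrite mulrBr mulrA MM mul1r.
rewrite rnormM rnorm_of_real ger0_norm ?(ltW (M0 M))//.
apply: (@le_trans _ _ (M.+1%:R * M.+1%:R ^- 2)).
  by rewrite ler_wpM2l// ltW.
rewrite expr2 invfM mulrA divff ?gt_eqF// mul1r.
by rewrite -[leRHS]invrK lef_pV2 ?posrE ?invr_gt0// ltW.
Qed.

Definition closed_span (w : nat -> F) : set F := [set z | forall e : R, 0 < e ->
  exists n (c : nat -> K), rnorm (z - \sum_(i < n) c i *: w i) <= e].

Lemma closed_span_gen (w : nat -> F) j : closed_span w (w j).
Proof.
move=> e e0; exists j.+1, (fun i => (i == j)%:R).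
rewrite (bigD1 ord_max)//= eqxx scale1r big1 ?addr0 ?subrr ?rnorm0 ?ltW//.
move=> i; rewrite -val_eqE/= => /negbTE ->; exact: scale0r.
Qed.

Lemma closed_span_limit (w : nat -> F) z :
  (forall e : R, 0 < e -> exists2 y, closed_span w y & rnorm (z - y) <= e) ->
  closed_span w z.
Proof.
move=> h e e0; have e20 : 0 < e / 2 by rewrite divr_gt0.
have [y yw zy] := h _ e20; have [n [c cE]] := yw _ e20.
by exists n, c; rewrite (le_trans (rnormB_triangle _ y _))// [e]splitr lerD.
Qed.

Lemma closed_span_linear (w : nat -> F) : linear_subspace (closed_span w).
Proof.
split=> [e e0|a x y xw yw e e0].
  by exists 0%N, (fun=> 0); rewrite big_ord0 subr0 rnorm0 ltW.
have a0 : 0 < rnorm (a : K^o) + 1 by rewrite ltr_wpDl// rnorm_ge0.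
have [|n [c cE]] := xw (e / 2 / (rnorm (a : K^o) + 1)); first by rewrite !divr_gt0.
have [|m [d dE]] := yw (e / 2); first by rewrite divr_gt0.
have widen (u : nat -> K) l L : (l <= L)%N ->
    \sum_(i < l) u i *: w i = \sum_(i < L) (if (i < l)%N then u i else 0) *: w i.
  move=> lL; rewrite (big_ord_widen L (fun i => u i *: w i))// [RHS](bigID (fun i : 'I_L => (i < l)%N))/=.
  rewrite [X in _ = _ + X]big1 ?addr0.
    by apply: eq_bigr => i ->.
  by move=> i /negbTE ->; rewrite scale0r.
exists (n + m)%N, (fun i => a * (if (i < n)%N then c i else 0) +
  (if (i < m)%N then d i else 0)).
have -> : \sum_(i < n + m) (a * (if (i < n)%N then c i else 0) +
    (if (i < m)%N then d i else 0)) *: w i =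
    a *: (\sum_(i < n) c i *: w i) + \sum_(i < m) d i *: w i.
  rewrite (widen c n (n + m)%N) ?leq_addr// (widen d m (n + m)%N) ?leq_addl//.
  rewrite scaler_sumr -big_split; apply: eq_bigr => i _ /=.
  by rewrite scalerDl scalerA.
rewrite opprD addrACA -scalerBr (le_trans (rnormD _ _))// [e]splitr lerD//.
rewrite rnormZ; apply: (@le_trans _ _ ((rnorm (a : K^o) + 1) * (e / 2 / (rnorm (a : K^o) + 1)))).
  by rewrite ler_pM ?rnorm_ge0// lerDl.
by rewrite mulrC divfK// gt_eqF.
Qed.

(* The functionals norm the terms of a dense sequence. *)
Lemma closed_span_total (w : nat -> F) : exists h : nat -> F -> K,
  [/\ forall m, functional (h m), forall m z, rnorm (h m z : K^o) <= rnorm z &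
      forall z, closed_span w z -> (forall m, h m z = 0) -> z = 0].
Proof.
have [ka kaP] := scalars_dense.
(* Finite lists of indices of [ka] are decoded from integers, so the combinations with coefficients
   in a countable dense set form a single sequence. *)
pose d m := if unpickle m is Some s then
  \sum_(i < size (s : seq (nat * nat))) ka (nth (0, 0)%N s i) *: w i else 0.
have dense z : closed_span w z -> forall e : R, 0 < e -> exists m, rnorm (z - d m) <= e.
  move=> zw e e0; have e20 : 0 < e / 2 by rewrite divr_gt0.
  have [n [c zc]] := zw _ e20.
  pose X := 1 + \sum_(i < n) rnorm (w i).
  have X0 : 0 < X by rewrite ltr_wpDr// sumr_ge0// => i _; exact: rnorm_ge0.
  have eX : 0 < e / 2 / X by rewrite divr_gt0.
  have /choice[r rP] : forall i, exists j, rnorm (c i - ka j : K^o) <= e / 2 / X.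
    by move=> i; exact: kaP.
  exists (pickle [seq r i | i <- iota 0 n]); rewrite /d pickleK size_map size_iota.
  rewrite (le_trans (rnormB_triangle _ (\sum_(i < n) c i *: w i) _))// [e]splitr lerD//.
  rewrite -sumrB (le_trans (rnorm_sum _ _ _))//.
  apply: (@le_trans _ _ (\sum_(i < n) (e / 2 / X) * rnorm (w i))).
    apply: ler_sum => i _; rewrite (nth_map 0%N) ?size_iota// nth_iota// add0n.
    by rewrite -scalerBl rnormZ ler_wpM2r ?rnorm_ge0.
  rewrite -mulr_sumr -[leRHS](divfK (lt0r_neq0 X0)) ler_wpM2l ?(ltW eX)//.
  by rewrite /X lerDr.
have /choice[h hP] : forall m, exists h : F -> K, [/\ functional h,
    forall x, rnorm (h x : K^o) <= rnorm x & rnorm (h (d m) : K^o) = rnorm (d m)].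
  by move=> m; exact: hahn_banach.
exists h; split => [m|m z|z zw hz0]; [by case: (hP m)|by case: (hP m)|].
apply/rnorm0_eq0/eqP; apply: contrapT => /negP z0.
have zpos : 0 < rnorm z by rewrite lt_neqAle eq_sym z0 rnorm_ge0.
(* For d_m within |z|/3 of z, |d_m| = |h_m (d_m - z)| <= |z|/3, which is impossible. *)
have [|m zd] := dense z zw (rnorm z / 3); first by rewrite divr_gt0.
have [hL hN hd] := hP m.
have : rnorm (d m) <= rnorm z / 3.
  rewrite -hd -[d m](subKr z) functionalB// hz0 sub0r.
  rewrite /rnorm normrN -/(rnorm (h m (z - d m) : K^o)).
  exact: le_trans (hN _) zd.
have : rnorm z <= rnorm (z - d m) + rnorm (d m).
  by rewrite -{1}[z](subrK (d m)) rnormD.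
by move: zd zpos; move: (rnorm z) (rnorm (z - d m)) (rnorm (d m)) => s t u; lra.
Qed.

(** The matrix of the phi_l (w_j), for l and j up to m, has determinant 1; if the w_j lay in the
    span of m vectors, it would factor through K^m. *)
Lemma triangular_independent (phi : nat -> F -> K) (w : nat -> F) :
  (forall j, functional (phi j)) -> (forall i j, (i < j)%N -> phi j (w i) = 0) ->
  (forall j, phi j (w j) = 1) -> forall m (e : 'I_m -> F),
  ~ (forall j, exists c : 'I_m -> K, w j = \sum_(i < m) c i *: e i).
Proof.
move=> phiL phi0 phi1 m e /choice[c wc].
pose T : 'M[K]_m.+1 := \matrix_(j, l) phi l (w j).
pose C : 'M[K]_(m.+1, m) := \matrix_(j, i) c j i.
pose B : 'M[K]_(m, m.+1) := \matrix_(i, l) phi l (e i).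
have TE : T = C *m B.
  apply/matrixP => j l; rewrite !mxE (wc j) functional_sum//.
  by apply: eq_bigr => i _; rewrite functionalZ// !mxE.
have detT : \det T = 1.
  rewrite det_trig; first by rewrite big1// => i _; rewrite mxE phi1.
  by apply/is_trig_mxP => i j ij; rewrite mxE phi0.
have : \rank T = m.+1 by apply/mxrank_unit; rewrite unitmxE detT unitr1.
rewrite TE => rT; have := mulmx_max_rank C B.
by rewrite rT ltnn.
Qed.

End closed_spans.

Section geometric_series.
Context {R : realType} {b : scalar_kind} {F : completeNormedModType (scalars R b)}.
Local Notation K := (scalars R b).

Lemma sum_geometric4 n m : (n <= m)%N ->
  \sum_(n <= i < m) (4^-1 : R) ^+ i <= 2 * 4^-1 ^+ n - 2 * 4^-1 ^+ m.
Proof.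
elim: m => [|m IHm]; first by rewrite leqn0 => /eqP ->; rewrite big_nil subrr.
rewrite leq_eqVlt => /predU1P[->|]; first by rewrite big_geq// subrr.
rewrite ltnS => nm; rewrite big_nat_recr//=.
apply: (le_trans (lerD (IHm nm) (lexx _))).
have : 0 <= (4^-1 : R) ^+ m by rewrite exprn_ge0// invr_ge0.
rewrite exprS; move: (4^-1 ^+ n) (4^-1 ^+ m) => s t t0.
by lra.
Qed.

(** Completeness of F enters here and makes the series of blocks converge. *)
Lemma cvg_geometric (u : nat -> F) (C : R) : 0 <= C ->
  (forall n, rnorm (u n) <= C * 4^-1 ^+ n) ->
  exists2 l, series u @ \oo --> l & rnorm l <= 2 * C.
Proof.
move=> C0 uC.
have tail n m : (n <= m)%N ->
    rnorm (\sum_(n <= i < m) u i) <= C * (2 * 4^-1 ^+ n).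
  move=> nm; apply: (le_trans (rnorm_sum _ _ _)).
  apply: (le_trans (ler_sum _ (fun i _ => uC i))); rewrite -mulr_sumr ler_wpM2l//.
  apply: (le_trans (sum_geometric4 nm)); by rewrite lerBlDr lerDl mulr_ge0// exprn_ge0.
have cu : cvg (series u @ \oo).
  apply/cauchy_cvgP/cauchy_seriesP => e e0.
  have eE : of_real b (real_part e) = e by rewrite of_real_part// ltW.
  have re0 : 0 < real_part e.
    by rewrite -(ltr_of_real (b := b)) eE of_real0.
  have C1 : 0 < C * 2 + 1 by rewrite ltr_wpDl// mulr_ge0.
  have : (4^-1 : R) ^+ n @[n --> \oo] --> 0.
    by apply: cvg_expr; rewrite ger0_norm ?invr_ge0// invf_lt1// ltr1n.
  move=> /cvgrPdist_lt /(_ (real_part e / (C * 2 + 1))).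
  rewrite divr_gt0// => /(_ isT) [N _ NP].
  exists ([set n | (N <= n)%N], [set n | (N <= n)%N]).
    by split; exists N.
  move=> [n m] [/= Nn Nm]; rewrite -of_rnorm -eE ltr_of_real.
  have [nm|/ltnW mn] := leqP n m; last by rewrite big_geq// rnorm0.
  apply: (le_lt_trans (tail _ _ nm)); have := NP n Nn.
  rewrite /= sub0r normrN ger0_norm ?exprn_ge0 ?invr_ge0// ltr_pdivlMr// => h.
  apply: le_lt_trans h; rewrite mulrA mulrC ler_wpM2l ?exprn_ge0 ?invr_ge0//.
  by rewrite lerDl.
have /cvg_ex[l ul] := cu; exists l => //.
apply/ler_addgt0Pr => e e0; have [N NP] := (cvg_rnormP _ _).1 ul e e0.
rewrite -[l](subrK (series u N)) (le_trans (rnormD _ _))// [leRHS]addrC.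
rewrite lerD// ?NP//.
have := tail 0%N N (leq0n N); rewrite expr0 mulr1 mulrC; apply.
Qed.

End geometric_series.

(** * Continuity of bounded multilinear maps *)

Section bounded_multilinear.
Context {R : realType} {b : scalar_kind} {E F : normedModType (scalars R b)}.
Local Notation K := (scalars R b).

(** The coordinates of x are exchanged for those of y one at a time; each exchange changes A by t
    times its value at vectors of norm at most 2 M. *)
Lemma bounded_multilinear_dist k (A : ('I_k -> E) -> F) (C : R) (x : 'I_k -> E) (e : R) :
  0 <= C -> multilinear A -> (forall (M : R) x, (forall j, rnorm (x j) <= M) ->
    rnorm (A x) <= C * M ^+ k) -> 0 < e ->
  exists2 t : R, 0 < t & forall y, (forall j, rnorm (x j - y j) <= t) ->
    rnorm (A x - A y) < e.
Proof.
move=> C0 linA bA e0.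
pose M := 1 + \sum_(j < k) rnorm (x j).
have M1 : 1 <= M by rewrite lerDl sumr_ge0// => j _; exact: rnorm_ge0.
have M0 : 0 < M by rewrite (lt_le_trans ltr01).
have xM j : rnorm (x j) <= M.
  rewrite /M (bigD1 j)//= addrCA lerDl addr_ge0// sumr_ge0// => i _.
  exact: rnorm_ge0.
pose D := k%:R * (C * (2 * M) ^+ k) + 1.
have D0 : 0 < D.
  by rewrite ltr_wpDl// mulr_ge0// mulr_ge0// exprn_ge0// mulr_ge0// ltW.
pose t := Num.min 1 (e / D).
have t0 : 0 < t by rewrite lt_min ltr01 divr_gt0.
have t1 : t <= 1 by rewrite ge_min lexx.
have tD : t * D <= e by rewrite -ler_pdivlMr// ge_min lexx orbT.
exists t => // y xy.
have {}xy j : rnorm (y j - x j) <= t by rewrite -rnormN opprB.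
have yM j : rnorm (y j) <= 2 * M.
  rewrite -[y j](subrK (x j)) (le_trans (rnormD _ _))// mulr_natl mulr2n lerD//.
  by rewrite (le_trans (xy j))// (le_trans t1).
have xM2 j : rnorm (x j) <= 2 * M.
  by rewrite (le_trans (xM j))// ler_peMl ?(ltW M0)// ler1n.
pose hyb (m : nat) (j : 'I_k) := if (j < m)%N then y j else x j.
have hybM m j : rnorm (hyb m j) <= 2 * M by rewrite /hyb; case: ifP.
have step m : (m <= k)%N ->
    rnorm (A (hyb m) - A x) <= m%:R * (t * (C * (2 * M) ^+ k)).
  elim: m => [_|m IHm mk].
    by rewrite mul0r (_ : hyb 0%N = x) ?subrr ?rnorm0//; apply/funext.
  apply: (le_trans (rnormB_triangle _ (A (hyb m)) _)).
  rewrite -natr1 mulrDl mul1r addrC lerD//; first exact: IHm (ltnW mk).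
  pose i := Ordinal mk; pose u := of_real b t^-1 *: (y i - x i).
  have hy : hyb m.+1 = dfwith (hyb m) i (y i).
    apply/funext => j; case: dfwithP => [|j' ij]; first by rewrite /hyb ltnS leqnn.
    rewrite /hyb ltnS leq_eqVlt; case: eqP => //= jm.
    by exfalso; move/eqP: ij; apply; exact/val_inj/esym.
  have hx : hyb m = dfwith (hyb m) i (x i).
    by apply/funext => j; case: dfwithP => //; rewrite /hyb ltnn.
  have yE : y i = of_real b t *: u + x i.
    by rewrite scalerA -of_realM divff ?gt_eqF// of_real1 scale1r subrK.
  have -> : A (hyb m.+1) - A (hyb m) = of_real b t *: A (dfwith (hyb m) i u).
    by rewrite hy yE (linA i (hyb m)) -hx addrK.
  rewrite rnormZ rnorm_of_real ger0_norm ?(ltW t0)//.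
  rewrite ler_wpM2l ?(ltW t0)//; apply: bA => j; case: dfwithP => //.
  rewrite rnormZ rnorm_of_real ger0_norm ?invr_ge0 ?(ltW t0)// ler_pdivrMl//.
  apply: (le_trans (xy i)); rewrite ler_peMr ?(ltW t0)//.
  by rewrite (le_trans M1)// ler_peMl ?(ltW M0)// ler1n.
rewrite -rnormN opprB.
have -> : y = hyb k by apply/funext => j; rewrite /hyb ltn_ord.
apply: (le_lt_trans (step k (leqnn k))); apply: lt_le_trans tD.
by rewrite mulrCA ltr_pM2l// /D ltrDl.
Qed.

Lemma ptws_near k (x : {ptws 'I_k -> E}) (t : R) : 0 < t ->
  nbhs x [set y : {ptws 'I_k -> E} | forall j, rnorm (x j - y j) <= t].
Proof.
move=> t0.
apply: (@filter_forall _ _ (fun (j : 'I_k) (y : {ptws 'I_k -> E}) =>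
  rnorm (x j - y j) <= t) (nbhs x)) => j.
have tK : 0 < of_real b t by rewrite -(of_real0 (R := R)) ltr_of_real.
have h := proj1 (@cvgrPdist_lt _ _ _ (nbhs x) (@nbhs_filter _ x) (proj j) (x j))
  (@proj_continuous _ _ j x) _ tK.
apply: (@filterS _ (nbhs x) (@nbhs_filter _ x) _ _ _ h) => y.
by rewrite -of_rnorm ltr_of_real => /ltW.
Qed.

Lemma bounded_multilinear_continuous k (A : {ptws 'I_k -> E} -> F) (C : R) : 0 <= C ->
  multilinear A -> (forall (M : R) x, (forall j, rnorm (x j) <= M) ->
    rnorm (A x) <= C * M ^+ k) -> continuous A.
Proof.
move=> C0 linA bA x.
suff h (e : K) : 0 < e -> \forall y \near nbhs x, `|A x - A y| < e.
  exact: (proj2 (@cvgrPdist_lt _ _ _ (nbhs x) (@nbhs_filter _ x) A (A x)) h).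
move=> e0.
have eE : of_real b (real_part e) = e by rewrite of_real_part// ltW.
have re0 : 0 < real_part e.
  by rewrite -(ltr_of_real (b := b)) eE of_real0.
have [t t0 At] := bounded_multilinear_dist x C0 linA bA re0.
apply: (@filterS _ (nbhs x) (@nbhs_filter _ x) _ _ _ (ptws_near x t0)) => y /At.
by rewrite -(ltr_of_real (b := b)) of_rnorm eE.
Qed.

End bounded_multilinear.

(** * Sequences of blocks *)

Section power_forms.
Context {R : realType} {b : scalar_kind} {E F : normedModType (scalars R b)}.
Local Notation K := (scalars R b).
Context {k N : nat}.
Implicit Types (f : 'I_N -> E -> K) (z : 'I_N -> F).

Definition power_form f z (x : 'I_k -> E) : F :=
  \sum_(i < N) (\prod_(j < k) f i (x j)) *: z i.

Lemma power_form_diag f z x : power_form f z (fun=> x) = power_sum k f z x.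
Proof. by apply: eq_bigr => i _; rewrite prodr_const card_ord. Qed.

Lemma prod_dfwith (g : E -> K) (x : 'I_k -> E) i u :
  \prod_(j < k) g (dfwith x i u j) = g u * \prod_(j < k | j != i) g (x j).
Proof.
rewrite (bigD1 i)//= dfwithin; congr (_ * _).
by apply: eq_bigr => j ji; rewrite dfwithout// eq_sym.
Qed.

Lemma prod_functional_linear (g : E -> K) (x : 'I_k -> E) i (a : K) u v : functional g ->
  \prod_(j < k) g (dfwith x i (a *: u + v) j) =
  a * \prod_(j < k) g (dfwith x i u j) + \prod_(j < k) g (dfwith x i v j).
Proof. by move=> gL; rewrite !prod_dfwith gL mulrDl mulrA. Qed.

Lemma power_form_multilinear f z : (forall i, functional (f i)) ->
  multilinear (power_form f z).
Proof.
move=> fL i x a u v; rewrite /power_form scaler_sumr -big_split /=.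
by apply: eq_bigr => l _; rewrite prod_functional_linear// scalerDl scalerA.
Qed.

Lemma prod_functional_symmetric (g : E -> K) (x : 'I_k -> E) (s : 'S_k) :
  \prod_(j < k) g ((x \o s) j) = \prod_(j < k) g (x j).
Proof. by rewrite [RHS](reindex_inj (@perm_inj _ s)). Qed.

Lemma power_form_symmetric f z : symmetric_map (power_form f z).
Proof. by move=> s x; apply: eq_bigr => i _; rewrite prod_functional_symmetric. Qed.

Lemma functional_le_rnorm f i y :
  (forall y, \sum_(i < N) rnorm (f i y : K^o) ^+ 2 <= rnorm y ^+ 2) ->
  rnorm (f i y : K^o) <= rnorm y.
Proof.
move=> fsum; rewrite -(@ler_pXn2r _ 2) ?nnegrE ?rnorm_ge0//.
apply: le_trans (fsum y); rewrite (bigD1 i)//= lerDl sumr_ge0// => j _.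
exact: sqr_ge0.
Qed.

(** On the ball |f_i y| <= 1, so sum_i |f_i y|^k <= sum_i |f_i y|^2 <= 1. *)
Lemma power_sum_aco f z y : (2 <= k)%N ->
  (forall y, \sum_(i < N) rnorm (f i y : K^o) ^+ 2 <= rnorm y ^+ 2) ->
  rnorm y < 1 -> aco z (power_sum k f z y).
Proof.
move=> k2 fsum y1; exists (fun i => f i y ^+ k) => //.
apply: (@le_trans _ _ (rnorm y ^+ 2)); last by rewrite expr_le1 ?rnorm_ge0// ltW.
apply: le_trans (fsum y); apply: ler_sum => i _; rewrite rnormX.
rewrite ler_wiXn2l ?rnorm_ge0//.
by rewrite (le_trans (functional_le_rnorm _ _ fsum))// ltW.
Qed.

Lemma rnorm_prod (I : Type) (r : seq I) (P : pred I) (a : I -> K) :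
  rnorm (\prod_(i <- r | P i) a i : K^o) = \prod_(i <- r | P i) rnorm (a i : K^o).
Proof.
elim/big_rec2 : _ => [|i u v _ <-]; last by rewrite rnormM.
by rewrite -[X in rnorm X](of_real1 (R := R)) rnorm_of_real normr1.
Qed.

End power_forms.

(** Two of the k factors are paired by 2 s t <= s^2 + t^2, so that the square-sum bound gives a
    constant independent of N; the other k - 2 factors are at most M each. *)
Lemma power_form_bound (R : realType) (b : scalar_kind) (E F : normedModType (scalars R b))
    k N (f : 'I_N -> E -> scalars R b) (z : 'I_N -> F) (D M : R) (x : 'I_k -> E) :
  (2 <= k)%N ->
  (forall y, \sum_(i < N) rnorm (f i y : (scalars R b)^o) ^+ 2 <= rnorm y ^+ 2) ->
  (forall i, rnorm (z i) <= D) -> 0 <= D -> (forall j, rnorm (x j) <= M) ->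
  rnorm (power_form f z x) <= D * M ^+ k.
Proof.
case: k x => [|[|k]] x // _ fsum zD D0 xM.
have M0 : 0 <= M by rewrite (le_trans (rnorm_ge0 (x ord0))).
pose x0 := x ord0; pose x1 := x (lift ord0 ord0).
have step i : rnorm ((\prod_(j < k.+2) f i (x j)) *: z i) <=
    D * M ^+ k / 2 * (rnorm (f i x0 : (scalars R b)^o) ^+ 2 +
      rnorm (f i x1 : (scalars R b)^o) ^+ 2).
  rewrite rnormZ 2!big_ord_recl mulrA !rnormM rnorm_prod -/x0 -/x1.
  have h : \prod_(j < k) rnorm (f i (x (lift ord0 (lift ord0 j))) : (scalars R b)^o) <=
      M ^+ k.
    rewrite -[X in _ ^+ X]card_ord -prodr_const; apply: ler_prod => j _.
    rewrite rnorm_ge0/=; exact: le_trans (functional_le_rnorm _ _ fsum) (xM _).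
  have p0 : 0 <= \prod_(j < k) rnorm (f i (x (lift ord0 (lift ord0 j))) : (scalars R b)^o).
    by apply: prodr_ge0 => j _; exact: rnorm_ge0.
  have am : rnorm (f i x0 : (scalars R b)^o) * rnorm (f i x1 : (scalars R b)^o) <=
      2^-1 * (rnorm (f i x0 : (scalars R b)^o) ^+ 2 + rnorm (f i x1 : (scalars R b)^o) ^+ 2).
    move: (rnorm _) (rnorm _) => s t.
    by have := sqr_ge0 (s - t); rewrite sqrrB; lra.
  have -> : D * M ^+ k / 2 * (rnorm (f i x0 : (scalars R b)^o) ^+ 2 +
      rnorm (f i x1 : (scalars R b)^o) ^+ 2) = 2^-1 * (rnorm (f i x0 : (scalars R b)^o) ^+ 2 +
      rnorm (f i x1 : (scalars R b)^o) ^+ 2) * M ^+ k * D by ring.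
  apply: ler_pM => //; rewrite ?mulr_ge0 ?rnorm_ge0//.
  by apply: ler_pM => //; rewrite mulr_ge0 ?rnorm_ge0.
apply: (le_trans (rnorm_sum _ _ _)); apply: (le_trans (ler_sum _ (fun i _ => step i))).
rewrite -mulr_sumr big_split /=.
apply: (@le_trans _ _ (D * M ^+ k / 2 * (M ^+ 2 + M ^+ 2))).
  rewrite ler_wpM2l ?divr_ge0 ?mulr_ge0 ?exprn_ge0// lerD//.
    by rewrite (le_trans (fsum _))// lerXn2r ?nnegrE ?rnorm_ge0 ?xM.
  by rewrite (le_trans (fsum _))// lerXn2r ?nnegrE ?rnorm_ge0 ?xM.
by rewrite le_eqVlt; apply/orP; left; apply/eqP; rewrite !exprS; field.
Qed.

Section block_sequences.
Context {R : realType} {b : scalar_kind} {E F : normedModType (scalars R b)}.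
Local Notation K := (scalars R b).
Variables (p q : R) (k : nat) (e0 : E).

(** [bs_fun_point] is one-sided, so at the points of block n all earlier blocks remain. [bs_large]
    therefore compares the p-bound there with n times the sum of the earlier [bs_bound]; the summand
    1 absorbs the errors independent of n. *)
Record block_sequence := BlockSequence {
  bs_size : nat -> nat ;
  bs_vec : forall n, 'I_(bs_size n) -> F ;
  bs_fun : forall n, 'I_(bs_size n) -> E -> K ;
  bs_point : forall n, 'I_(bs_size n) -> E ;
  bs_bound : nat -> R ;
  bs_functional : forall n i, functional (@bs_fun n i) ;
  bs_fun0 : forall n i, @bs_fun n i e0 = 0 ;
  bs_fun_point : forall n l i j, (l < n)%N -> @bs_fun n i (@bs_point l j) = 0 ;
  bs_fun_sum : forall n y,
    \sum_(i < bs_size n) rnorm (@bs_fun n i y : K^o) ^+ 2 <= rnorm y ^+ 2 ;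
  bs_point1 : forall n i, rnorm (@bs_point n i) < 1 ;
  bs_covered_q : forall n, p_covered q (4^-1 ^+ n) (aco (@bs_vec n)) ;
  bs_bound0 : forall n, 0 < bs_bound n ;
  bs_covered_p : forall n, p_covered p (bs_bound n) (aco (@bs_vec n)) ;
  bs_large : forall n (A : set F) (C : R), 0 < C ->
    (forall j, A (power_sum k (@bs_fun n) (@bs_vec n) (@bs_point n j))) ->
    p_covered p C A -> n%:R * (1 + \sum_(l < n) bs_bound l) < C }.

(** A block packed with its own size, so that histories of blocks are plain sequences. *)
Record block_data := BlockData {
  bd_size : nat ;
  bd_vec : 'I_bd_size -> F ;
  bd_fun : 'I_bd_size -> E -> K ;
  bd_point : 'I_bd_size -> E ;
  bd_bound : R }.

Lemma block_sequence_exists (A : set F) : 1 <= p -> 1 <= q -> (2 <= k)%N ->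
  ~ finite_dimensional [set: E] -> p_compact q A -> ~ p_compact p A ->
  inhabited block_sequence.
Proof.
move=> p1 q1 k2 Einf qA npA.
pose points (s : seq block_data) : seq E :=
  flatten [seq [seq bd_point i | i <- enum 'I_(bd_size t)] | t <- s].
pose total (s : seq block_data) : R := \sum_(t <- s) bd_bound t.
pose Q (s : seq block_data) (t : block_data) : Prop :=
    [/\ (forall i, functional (@bd_fun t i)) /\
        (forall i y, y \in e0 :: points s -> @bd_fun t i y = 0),
      (forall y, \sum_(i < bd_size t) rnorm (@bd_fun t i y : K^o) ^+ 2 <= rnorm y ^+ 2) /\
        (forall i : 'I_(bd_size t), rnorm (bd_point i) < 1),
      p_covered q (4^-1 ^+ size s) (aco (@bd_vec t)),
      0 < bd_bound t /\ p_covered p (bd_bound t) (aco (@bd_vec t)) &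
      forall (A : set F) (C : R), 0 < C ->
        (forall j, A (power_sum k (@bd_fun t) (@bd_vec t) (@bd_point t j))) ->
        p_covered p C A -> (size s)%:R * (1 + total s) < C].
have [s|g gP] := @history_choice block_data Q.
  have de0 : 0 < (4^-1 : R) ^+ size s by rewrite exprn_gt0// invr_gt0.
  (* The factor 3 * 20^k is the loss in [block] between the values at the points and the hull; the
     rest is the growth required. *)
  pose C0 := 3 * 20 ^+ k * (`|(size s)%:R * (1 + total s)| + 1).
  have C00 : 0 < C0 by rewrite !mulr_gt0 ?exprn_gt0// ltr_wpDl.
  have [N [z [zq zp]]] := finite_gap p1 q1 qA npA de0 C00.
  have [f [x [bf fS fsum x1 large]]] := block (p := p) p1 (e0 :: points s) Einf k2 z.
  have [D D0 zD] := p_covered_finite p1 z.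
  exists (BlockData z f x D); split => //=.
    by split => [i|//]; have [] := bf i.
  move=> B C C1 BP BC; rewrite ltNge; apply/negP => hC; apply: zp.
  apply: p_covered_le (large B C C1 BP BC).
  rewrite /C0 ler_wpM2l ?mulr_ge0 ?exprn_ge0// (le_trans hC)//.
  by rewrite (le_trans (ler_norm _))// lerDl.
have totalE n : total [seq g i | i <- iota 0 n] = \sum_(l < n) bd_bound (g l).
  by rewrite /total big_map -(subn0 n) -/(index_iota _ _) big_mkord subn0.
constructor.
apply: (@BlockSequence (fun n => bd_size (g n)) (fun n => @bd_vec (g n))
  (fun n => @bd_fun (g n)) (fun n => @bd_point (g n)) (fun n => bd_bound (g n))).
- by move=> n i; have [[]] := gP n.
- by move=> n i; have [[_ h] _ _ _ _] := gP n; rewrite h// mem_head.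
- move=> n l i j ln; have [[_ h] _ _ _ _] := gP n; apply: h; rewrite in_cons; apply/orP; right.
  rewrite /points -map_comp; apply/flatten_mapP; exists l; first by rewrite mem_iota.
  by apply/map_f; rewrite mem_enum.
- by move=> n; have [_ []] := gP n.
- by move=> n; have [_ []] := gP n.
- by move=> n; have [_ _] := gP n; rewrite size_map size_iota.
- by move=> n; have [_ _ _ []] := gP n.
- by move=> n; have [_ _ _ []] := gP n.
- by move=> n; have [_ _ _ _] := gP n; rewrite size_map size_iota totalE.
Qed.

End block_sequences.

(** * Powers of a functional perturbed by a series of blocks *)

Section perturbed_powers.
Context {R : realType} {b : scalar_kind} {E : normedModType (scalars R b)}
  {F : completeNormedModType (scalars R b)}.
Local Notation K := (scalars R b).
Variables (p q : R) (k : nat) (e0 : E).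
Hypotheses (p1 : 1 <= p) (q1 : 1 <= q) (k2 : (2 <= k)%N).
Variable B : block_sequence (F := F) p q k e0.
Variables (h : nat -> F -> K) (g : E -> K).
Hypotheses (hL : forall m, functional (h m))
  (hN : forall m z, rnorm (h m z : K^o) <= rnorm z)
  (gL : functional g) (gN : forall x, rnorm (g x : K^o) <= rnorm x).

Local Notation fun_ n := (@bs_fun _ _ _ _ _ _ _ _ B n).
Local Notation vec_ n := (@bs_vec _ _ _ _ _ _ _ _ B n).
Local Notation point_ n := (@bs_point _ _ _ _ _ _ _ _ B n).
Local Notation block_form n := (power_form (fun_ n) (vec_ n)).

(* Every value of the index logn 2 n.+1 is taken infinitely often. *)
Definition block_term (z : F) (x : 'I_k -> E) (n : nat) : F :=
  h (logn 2 n.+1) z *: block_form n x.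

Definition block_sum (z : F) (x : 'I_k -> E) : F := lim (series (block_term z x) @ \oo).

Definition perturbed_power (z : F) (x : 'I_k -> E) : F :=
  (\prod_(j < k) g (x j)) *: z + block_sum z x.

(** The vectors of block n lie in their own hull, whose m_q, at most 4^-n, bounds their norms. *)
Lemma block_term_bound z x (M : R) n : (forall j, rnorm (x j) <= M) ->
  rnorm (block_term z x n) <= rnorm z * M ^+ k * 4^-1 ^+ n.
Proof.
move=> xM; rewrite /block_term rnormZ -mulrA ler_pM ?rnorm_ge0//.
rewrite mulrC; apply: power_form_bound => //; first exact: bs_fun_sum.
  move=> i; have [v [vC vA]] := bs_covered_q B n.
  rewrite -lee_fin; apply: le_trans vC; apply: (p_hull_le q1); apply: vA.
  exists (fun j => (j == i)%:R).
    rewrite (bigD1 i)//= eqxx big1 ?addr0.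
      by rewrite -(of_real1 (R := R)) rnorm_of_real normr1.
    by move=> j /negbTE ->; exact: rnorm0.
  rewrite (bigD1 i)//= eqxx scale1r big1 ?addr0// => j /negbTE ->.
  by rewrite scale0r.
Qed.

Lemma exists_bound (x : 'I_k -> E) : exists2 M : R, 0 <= M & forall j, rnorm (x j) <= M.
Proof.
exists (\sum_j rnorm (x j)); first by apply: sumr_ge0 => j _; exact: rnorm_ge0.
move=> j; rewrite (bigD1 j)//= lerDl sumr_ge0// => i _; exact: rnorm_ge0.
Qed.

Lemma block_sum_cvg z x : series (block_term z x) @ \oo --> block_sum z x.
Proof.
have [M M0 xM] := exists_bound x.
have C0 : 0 <= rnorm z * M ^+ k by rewrite mulr_ge0 ?rnorm_ge0 ?exprn_ge0.
have [l ul _] := cvg_geometric C0 (fun n => block_term_bound z n xM).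
by rewrite /block_sum (norm_cvg_lim ul).
Qed.

Lemma block_sum_bound z x (M : R) : 0 <= M -> (forall j, rnorm (x j) <= M) ->
  rnorm (block_sum z x) <= 2 * (rnorm z * M ^+ k).
Proof.
move=> M0 xM.
have C0 : 0 <= rnorm z * M ^+ k by rewrite mulr_ge0 ?rnorm_ge0 ?exprn_ge0.
have [l ul lC] := cvg_geometric C0 (fun n => block_term_bound z n xM).
by rewrite /block_sum (norm_cvg_lim ul).
Qed.

(** The vectors and the arguments vary separately, so that this serves both linearity in z and
    multilinearity in x. *)
Lemma block_sum_lincomb (a : K) z1 z2 z3 x1 x2 x3 :
  (forall n, block_term z3 x3 n = a *: block_term z1 x1 n + block_term z2 x2 n) ->
  block_sum z3 x3 = a *: block_sum z1 x1 + block_sum z2 x2.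
Proof.
move=> tE; apply: norm_cvg_lim.
rewrite (_ : series _ = (fun n => a *: series (block_term z1 x1) n +
    series (block_term z2 x2) n)).
  by apply: cvgD; [apply: cvgZl_tmp|]; exact: block_sum_cvg.
apply/funext => n; rewrite /series /= scaler_sumr -big_split /=.
by apply: eq_bigr => i _.
Qed.

Lemma perturbed_power_linear (a : K) z1 z2 x : perturbed_power (a *: z1 + z2) x =
  a *: perturbed_power z1 x + perturbed_power z2 x.
Proof.
rewrite /perturbed_power (@block_sum_lincomb a z1 z2 _ x x).
  by rewrite !scalerDr !scalerA mulrC -!addrA; congr (_ + _); rewrite addrCA.
by move=> n; rewrite /block_term hL scalerDl scalerA.
Qed.

Lemma perturbed_power_multilinear z : multilinear (perturbed_power z).
Proof.
move=> i x a u v; rewrite /perturbed_power.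
rewrite (@block_sum_lincomb a z z _ (dfwith x i u) (dfwith x i v)).
  rewrite prod_functional_linear// scalerDl scalerDr scalerA -!addrA; congr (_ + _).
  by rewrite addrCA.
move=> n; rewrite /block_term power_form_multilinear; last by move=> l; exact: bs_functional.
by rewrite scalerDr !scalerA mulrC.
Qed.

Lemma perturbed_power_symmetric z : symmetric_map (perturbed_power z).
Proof.
move=> s x; rewrite /perturbed_power prod_functional_symmetric; congr (_ + _).
rewrite /block_sum (_ : block_term z (x \o s) = block_term z x)//.
by apply/funext => n; rewrite /block_term power_form_symmetric.
Qed.

Lemma perturbed_power_bound z (M : R) x : (forall j, rnorm (x j) <= M) ->
  rnorm (perturbed_power z x) <= 3 * rnorm z * M ^+ k.
Proof.
move=> xM; have M0 : 0 <= M.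
  by case: k k2 x xM => // k' _ x xM; rewrite (le_trans (rnorm_ge0 (x ord0))).
rewrite (le_trans (rnormD _ _))//.
have -> : 3 * rnorm z * M ^+ k = M ^+ k * rnorm z + 2 * (rnorm z * M ^+ k) by ring.
rewrite lerD ?block_sum_bound// rnormZ ler_wpM2r ?rnorm_ge0// rnorm_prod.
rewrite -[X in _ ^+ X](card_ord k) -prodr_const; apply: ler_prod => j _.
by rewrite rnorm_ge0/= (le_trans (gN _)).
Qed.

Lemma perturbed_power_polynomial z :
  homogeneous_polynomial k (fun x => perturbed_power z (fun=> x)).
Proof.
exists (perturbed_power z); split => //.
- apply: (@bounded_multilinear_continuous _ _ _ _ _ _ (3 * rnorm z)).
  + by rewrite mulr_ge0 ?rnorm_ge0.
  + exact: perturbed_power_multilinear.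
  + by move=> M x; exact: perturbed_power_bound.
- exact: perturbed_power_multilinear.
- exact: perturbed_power_symmetric.
Qed.

Lemma perturbed_power_at z : perturbed_power z (fun=> e0) = g e0 ^+ k *: z.
Proof.
rewrite /perturbed_power prodr_const card_ord.
rewrite [block_sum _ _](_ : _ = 0) ?addr0//; apply: norm_cvg_lim.
rewrite (_ : series _ = cst 0); first exact: cvg_cst.
apply/funext => n; rewrite /series /= big1// => i _.
rewrite /block_term power_form_diag /power_sum big1 ?scaler0// => j _.
by rewrite bs_fun0 expr0n (gtn_eqF (ltnW k2)) scale0r.
Qed.

Lemma unit_disc_power (z : F) x : rnorm x < 1 ->
  [set a *: z | a in [set a : K | rnorm (a : K^o) <= 1]] (g x ^+ k *: z).
Proof.
move=> x1; exists (g x ^+ k) => //=.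
by rewrite rnormX exprn_ile1 ?rnorm_ge0// (le_trans (gN _))// ltW.
Qed.

(** The image lies in the disc of z plus sums of series with terms in multiples of the block hulls,
    whose q-bounds decay like 4^-n. *)
Lemma perturbed_power_compact z :
  p_compact q ((fun x => perturbed_power z (fun=> x)) @` open_unit_ball E).
Proof.
have zq : p_covered q (2 * rnorm z + 1)
    [set a *: z | a in [set a : K | rnorm (a : K^o) <= 1]].
  by apply: p_covered_disc => //; rewrite lerDl.
have sq := @p_covered_series _ _ _ _ q1
  (fun n => [set h (logn 2 n.+1) z *: y | y in aco (vec_ n)])
  (rnorm z) (rnorm_ge0 z).
have {}sq : p_covered q (8 * rnorm z + 1) [set y | exists2 v : nat -> F,
    (forall n, [set h (logn 2 n.+1) z *: y | y in aco (vec_ n)] (v n)) &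
    series v @ \oo --> y].
  apply: p_covered_le (sq _) => [|n]; first by rewrite lerDl.
  apply: p_covered_le (p_coveredZ q1 _ (bs_covered_q B n)).
  by rewrite ler_wpM2r ?exprn_ge0 ?invr_ge0.
have z0 (c : R) : 0 <= c -> 0 < c * rnorm z + 1.
  by move=> c0; rewrite ltr_wpDl// mulr_ge0// rnorm_ge0.
apply: p_covered_compact (p_coveredS _ (p_coveredD q1 (z0 2 _) (z0 8 _) zq sq)) => //.
move=> _ [x x1 <-].
exists (g x ^+ k *: z); first exact: unit_disc_power.
exists (block_sum z (fun=> x)); last by rewrite /perturbed_power prodr_const card_ord.
exists (block_term z (fun=> x)); last exact: block_sum_cvg.
move=> n; exists (block_form n (fun _ : 'I_k => x)) => //.
by rewrite power_form_diag; apply: power_sum_aco => //; exact: bs_fun_sum.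
Qed.

Lemma block_sum_at_point z n (j : 'I_(bs_size B n)) : block_sum z (fun=> (point_ n j)) =
  \sum_(l < n.+1) block_term z (fun=> (point_ n j)) l.
Proof.
apply: norm_cvg_lim; apply/cvg_rnormP => e e1; exists n.+1 => m nm.
rewrite /series /= (big_cat_nat (n := n.+1))//= big_mkord.
have -> : \sum_(n.+1 <= i < m) block_term z (fun=> (point_ n j)) i = 0.
  rewrite big_nat big1// => i /andP[ni _].
  rewrite /block_term power_form_diag /power_sum big1 ?scaler0// => l _.
  by rewrite bs_fun_point// expr0n (gtn_eqF (ltnW k2)) scale0r.
by rewrite addr0 subrr rnorm0 ltW.
Qed.

Lemma perturbed_power_not_compact z m : h m z != 0 ->
  ~ p_compact p ((fun x => perturbed_power z (fun=> x)) @` open_unit_ball E).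
Proof.
move=> hz /(p_compact_covered)[C C0 PC].
pose r := rnorm (h m z : K^o).
have r0 : 0 < r.
  rewrite lt_neqAle rnorm_ge0 andbT eq_sym; apply: contra_neq hz.
  exact: (@rnorm0_eq0 _ _ K^o).
pose D := bs_bound B.
have zp : p_covered p (2 * rnorm z + 1)
    [set a *: z | a in [set a : K | rnorm (a : K^o) <= 1]].
  by apply: p_covered_disc => //; rewrite lerDl.
have z10 : 0 < rnorm z + 1 by rewrite ltr_wpDl// rnorm_ge0.
have z20 : 0 < 2 * rnorm z + 1 by rewrite ltr_wpDl// mulr_ge0// rnorm_ge0.
(* [G] collects the assumed bound C, the disc of z and the factor |z| + 1 of the earlier blocks.
   Dividing the bound at block n by 1 + sum_(l < n) D l shows n < G, which fails for large n of
   index m. *)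
pose G := r^-1 * (C + (2 * rnorm z + 1) + (rnorm z + 1)).
have key n : logn 2 n.+1 = m -> n%:R < G.
  move=> nm.
  pose A1 (l : 'I_n) := [set - h (logn 2 l.+1) z *: y | y in aco (vec_ l)].
  have A1P (l : 'I_n) : p_covered p ((rnorm z + 1) * D l) (A1 l).
    apply: p_covered_le (p_coveredZ p1 _ (bs_covered_p B l)).
    rewrite ler_wpM2r ?(ltW (bs_bound0 B l))// /rnorm normrN -/(rnorm _).
    by rewrite (le_trans (hN _ _))// lerDl.
  have D0 (l : 'I_n) : 0 < (rnorm z + 1) * D l by rewrite mulr_gt0// bs_bound0.
  have s1 := p_covered_sum p1 z10 D0 A1P.
  have S0 : 0 < rnorm z + 1 + \sum_(l < n) (rnorm z + 1) * D l.
    by rewrite ltr_wpDr// sumr_ge0// => l _; exact: ltW.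
  have zp' := p_coveredZ p1 (-1) zp.
  have n1 : rnorm (-1 : K^o) = 1.
    by rewrite /rnorm normrN -/(rnorm _) -[X in rnorm X](of_real1 (R := R)) rnorm_of_real normr1.
  rewrite n1 mul1r in zp'.
  have s2 := p_coveredD p1 C0 z20 PC zp'.
  have s3 := p_coveredD p1 (addr_gt0 C0 z20) S0 s2 s1.
  have s4 := p_coveredZ p1 (h m z)^-1 s3.
  have rV : rnorm ((h m z)^-1 : K^o) = r^-1.
    apply: (mulfI (lt0r_neq0 r0)); rewrite divff ?gt_eqF// -rnormM divff//.
    by rewrite -[X in rnorm X](of_real1 (R := R)) rnorm_of_real normr1.
  rewrite rV in s4.
  set X := C + _ + _ in s4; have X0 : 0 < r^-1 * X.
    by rewrite mulr_gt0 ?invr_gt0// addr_gt0// addr_gt0.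
  have SD0 : 0 <= \sum_(l < n) D l by apply: sumr_ge0 => l _; rewrite ltW// bs_bound0.
  have : n%:R * (1 + \sum_(l < n) D l) < r^-1 * X.
    apply: (@bs_large _ _ _ _ _ _ _ _ B n _ _ X0 _ s4) => j.
    set x := (point_ n j).
    (* Block n is isolated at x as T_z (x) minus g(x)^k z minus the terms of the earlier blocks; the
       later ones vanish there. *)
    exists (h m z *: power_sum k (fun_ n) (vec_ n) x);
      last by rewrite scalerA mulVf// scale1r.
    exists (perturbed_power z (fun=> x) - g x ^+ k *: z).
      exists (perturbed_power z (fun=> x)); first by exists x => //; exact: bs_point1.
      exists (- (g x ^+ k *: z)) => //.
      exists (g x ^+ k *: z); last by rewrite scaleN1r.
      by apply: unit_disc_power; exact: bs_point1.
    exists (\sum_(l < n) - block_term z (fun=> x) l).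
      exists (fun l : 'I_n => - block_term z (fun=> x) l) => // l.
      exists (block_form l (fun _ : 'I_k => x)); last by rewrite scaleNr.
      rewrite power_form_diag; apply: power_sum_aco => //; first exact: bs_fun_sum.
      exact: bs_point1.
    have cancel (u v t : F) : u + (v + t) - u - v = t.
      by rewrite (addrAC u) subrr add0r addrAC subrr add0r.
    rewrite sumrN /perturbed_power prodr_const card_ord block_sum_at_point.
    by rewrite big_ord_recr /= cancel /block_term nm power_form_diag.
  move=> lt_nX; rewrite -(ltr_pM2r (_ : 0 < 1 + \sum_(l < n) D l)); last by rewrite ltr_wpDr.
  apply: lt_le_trans lt_nX _; rewrite /G -mulrA ler_wpM2l ?invr_ge0 ?(ltW r0)//.
  rewrite /X -mulr_sumr -subr_ge0; set S := \sum_(l < n) D l.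
  rewrite (_ : _ - _ = (C + (2 * rnorm z + 1)) * S); last by ring.
  by rewrite mulr_ge0// addr_ge0 ?(ltW C0) ?(ltW z20).
pose N := Num.truncn (Num.max G 0).
have GN : G < N.+1%:R.
  by rewrite (le_lt_trans _ (truncnS_gt _))// le_max lexx.
(* n + 1 is 2^m times the odd number 2 N + 3, so its index is m and n >= N + 1 > G. *)
pose n := (2 ^ m * (N.+1).*2.+1).-1.
have nE : n.+1 = (2 ^ m * (N.+1).*2.+1)%N by rewrite prednK// muln_gt0 expn_gt0.
have nm : logn 2 n.+1 = m.
  rewrite nE lognM ?expn_gt0// pfactorK// lognE dvdn2/= odd_double /=.
  by rewrite addn0.
have := key n nm; rewrite ltNge => /negP; apply.
rewrite (le_trans (ltW GN))// ler_nat -ltnS nE.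
rewrite (leq_trans _ (leq_pmull _ _)) ?expn_gt0//.
by rewrite ltnS -addnn leq_addr.
Qed.

End perturbed_powers.

(** * The space of perturbed powers *)

Section spaceability.
Context {R : realType} {b : scalar_kind} {E : normedModType (scalars R b)}
  {F : completeNormedModType (scalars R b)}.
Local Notation K := (scalars R b).
Context {p q : R} {k : nat}.
Hypotheses (p1 : 1 <= p) (q1 : 1 <= q) (k2 : (2 <= k)%N).
Local Notation X := (p_compact_polynomial_space E F k q1).

Lemma polynomial_of_lincomb (a : K) (P Q : X) x :
  polynomial_of (a *: P + Q) x = a *: polynomial_of P x + polynomial_of Q x.
Proof. by rewrite /polynomial_of linearP. Qed.

Lemma polynomial_of0 x : polynomial_of (0 : X) x = 0.
Proof. by rewrite /polynomial_of raddf0. Qed.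

Lemma polynomial_of_sum m (c : 'I_m -> K) (P : 'I_m -> X) x :
  polynomial_of (\sum_(i < m) c i *: P i) x = \sum_(i < m) c i *: polynomial_of (P i) x.
Proof.
elim/big_ind2 : _ => [|u Pu v Pv Hu Hv|i _]; first exact: polynomial_of0.
  by rewrite -Hu -Hv -{1}(scale1r Pu) polynomial_of_lincomb scale1r.
by have := polynomial_of_lincomb (c i) (P i) 0 x; rewrite addr0 polynomial_of0 addr0.
Qed.

Lemma polynomial_of_compact (P : X) : p_compact_polynomials E F k q (polynomial_of P).
Proof. exact: (ns_domP P). Qed.

Lemma polynomial_of_surj (P : E -> F) : p_compact_polynomials E F k q P ->
  exists Q : X, polynomial_of Q = P.
Proof. by move=> hP; exists (exist _ P (asboolT hP)). Qed.

(** Division by |x| + 1 moves x into the open ball, where values are bounded by m_q; thus evaluation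
    at a point is continuous for the norm of the polynomial space. *)
Lemma polynomial_of_bound (P : X) x :
  rnorm (polynomial_of P x) <= (rnorm x + 1) ^+ k * rnorm P.
Proof.
have [hP cP] := polynomial_of_compact P.
have t0 : 0 < rnorm x + 1 by rewrite ltr_wpDl// rnorm_ge0.
have xE : x = of_real b (rnorm x + 1) *: (of_real b (rnorm x + 1)^-1 *: x).
  by rewrite scalerA -of_realM divff ?gt_eqF// of_real1 scale1r.
rewrite {1}xE (homogeneous_polynomialZ _ _ hP) rnormZ rnormX rnorm_of_real.
rewrite ger0_norm ?(ltW t0)// ler_wpM2l ?exprn_ge0 ?(ltW t0)//.
rewrite rnorm_nsE /= -lee_fin fineK ?p_measure_fin//.
apply: p_measure_ub => //; exists (of_real b (rnorm x + 1)^-1 *: x) => //.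
rewrite /open_unit_ball /= rnormZ rnorm_of_real ger0_norm ?invr_ge0 ?(ltW t0)//.
by rewrite ltr_pdivrMl// mulr1 ltrDl.
Qed.

Theorem spaceable_difference (P0 : X) : ~ finite_dimensional [set: E] ->
  ~ finite_dimensional [set: F] -> ~ p_compact_polynomials E F k p (polynomial_of P0) ->
  spaceable [set P : X | ~ p_compact_polynomials E F k p (polynomial_of P)].
Proof.
move=> Einf Finf nP0; have [hP0 qP0] := polynomial_of_compact P0.
have {}nP0 : ~ p_compact p (polynomial_of P0 @` open_unit_ball E).
  by move=> cP0; apply: nP0; split.
have [f [e0 [[fL _] _ fe0]]] := functional_killing [::] Einf.
have e0_neq0 : rnorm e0 != 0.
  apply/eqP => /rnorm0_eq0 e00; move/eqP : fe0.
  by rewrite e00 functional0// eq_sym oner_eq0.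
have [g [gL gN ge0]] := hahn_banach e0.
have {}ge0 : g e0 ^+ k != 0.
  rewrite expf_neq0//; apply: contra_neq e0_neq0 => ge00.
  by rewrite -ge0 ge00 (rnorm0 (V := K^o)).
have [B] := block_sequence_exists (F := F) e0 p1 q1 k2 Einf qP0 nP0.
have [phi [w phiw]] := triangular_system Finf [::].
have [h [hL hN htotal]] := closed_span_total w.
pose T z x := perturbed_power B h g z (fun=> x).
have Tlin (a : K) z1 z2 x : T (a *: z1 + z2) x = a *: T z1 x + T z2 x.
  exact: perturbed_power_linear.
have TX z : exists Q : X, polynomial_of Q = T z.
  apply: polynomial_of_surj; split; first exact: perturbed_power_polynomial.
  exact: perturbed_power_compact.
have Te0 z : T z e0 = g e0 ^+ k *: z by exact: perturbed_power_at.
have T0 x : T 0 x = 0.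
  by have := Tlin (-1) 0 0 x; rewrite scaler0 addr0 scaleN1r addNr.
pose V : set X := [set Q | exists2 z, closed_span w z & polynomial_of Q = T z].
have [w0 wD] := closed_span_linear w.
exists V; split.
- split; first by exists 0 => //; apply/funext => x; rewrite T0 polynomial_of0.
  move=> a Q1 Q2 [z1 wz1 Q1E] [z2 wz2 Q2E]; exists (a *: z1 + z2); first exact: wD.
  by apply/funext => x; rewrite polynomial_of_lincomb Q1E Q2E Tlin.
- move=> Q clQ.
  have near_V (e : R) : 0 < e -> exists2 Q', V Q' & rnorm (Q - Q') <= e.
    move=> epos; have eK : 0 < of_real b e by rewrite -(of_real0 (R := R)) ltr_of_real.
    have [Q' [VQ' BQ']] := clQ _ (nbhsx_ballx Q _ eK).
    exists Q' => //; move: BQ'; rewrite -ball_normE /= -of_rnorm ltr_of_real.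
    exact: ltW.
  pose c := (g e0 ^+ k)^-1.
  pose z := c *: polynomial_of Q e0.
  pose C1 := rnorm (c : K^o) * (rnorm e0 + 1) ^+ k.
  have C10 : 0 <= C1 by rewrite mulr_ge0 ?rnorm_ge0 ?exprn_ge0 ?addr_ge0 ?rnorm_ge0.
  have polyB (Q' : X) x : polynomial_of (Q - Q') x = polynomial_of Q x - polynomial_of Q' x.
    by rewrite -(scaleN1r Q') addrC polynomial_of_lincomb scaleN1r addrC.
  (* Recovering the vector from the polynomial is Lipschitz, so the vectors of approximating members
     of V converge to z. *)
  have zz' Q' z' : polynomial_of Q' = T z' -> rnorm (z - z') <= C1 * rnorm (Q - Q').
    move=> QE; have -> : z' = c *: polynomial_of Q' e0.
      by rewrite QE Te0 scalerA mulVf// scale1r.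
    by rewrite -scalerBr -polyB rnormZ -mulrA ler_wpM2l ?rnorm_ge0// polynomial_of_bound.
  exists z.
    apply: closed_span_limit => e epos.
    have [|Q' [z' wz' QE] QQ'] := near_V (e / (C1 + 1)).
      by rewrite divr_gt0// ltr_wpDl.
    exists z' => //; apply: (le_trans (zz' _ _ QE)).
    apply: (@le_trans _ _ ((C1 + 1) * (e / (C1 + 1)))).
      by rewrite ler_pM ?rnorm_ge0// lerDl.
    by rewrite mulrC divfK// gt_eqF// ltr_wpDl.
  apply/funext => x; apply/eqP; rewrite -subr_eq0; apply/eqP/rnorm0_eq0.
  apply/eqP; rewrite eq_le rnorm_ge0 andbT; apply/ler_addgt0Pr => e epos; rewrite add0r.
  (* The first summand bounds |Q x - Q' x|, the second |T_z' x - T_z x|, both relative to the norm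
     of Q - Q'. *)
  pose C2 := (rnorm x + 1) ^+ k + 3 * C1 * rnorm x ^+ k.
  have C20 : 0 <= C2.
    have x0 := rnorm_ge0 x.
    apply: addr_ge0; first by apply: exprn_ge0; exact: addr_ge0.
    by apply: mulr_ge0; [exact: mulr_ge0|exact: exprn_ge0].
  have [|Q' [z' wz' QE] QQ'] := near_V (e / (C2 + 1)).
    by rewrite divr_gt0// ltr_wpDl.
  apply: (@le_trans _ _ (C2 * rnorm (Q - Q'))); last first.
    apply: (@le_trans _ _ ((C2 + 1) * (e / (C2 + 1)))).
      by rewrite ler_pM ?rnorm_ge0// lerDl.
    by rewrite mulrC divfK// gt_eqF// ltr_wpDl.
  apply: (le_trans (rnormB_triangle _ (polynomial_of Q' x) _)).
  rewrite /C2 mulrDl lerD//; first by rewrite -polyB polynomial_of_bound.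
  have -> : polynomial_of Q' x - T z x = T (z' - z) x.
    by rewrite -(scaleN1r z) (addrC z') Tlin QE scaleN1r addrC.
  rewrite (le_trans (perturbed_power_bound q1 k2 B hN gN _ (fun=> lexx (rnorm x))))//.
  rewrite [leRHS]mulrAC ler_wpM2r ?exprn_ge0 ?rnorm_ge0//.
  rewrite -[leRHS]mulrA ler_wpM2l// -rnormN opprB.
  by rewrite zz'.
- move=> [m [d Vd]].
  (* If V were in the span of finitely many d_i, evaluation at e0 would put all w_j in the span of
     the d_i (e0). *)
  have bphi j : functional (phi j) by have [[]] := phiw j.
  apply: (triangular_independent (phi := phi) (w := w) bphi _ _
      (e := fun i => polynomial_of (d i) e0)).
  + by move=> i j ij; have [_ _ h1 _] := phiw j; exact: h1.
  + by move=> j; have [_ _ _ h1] := phiw j.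
  move=> j; have [Q QE] := TX (w j).
  have [|c QdE] := Vd Q; first by exists (w j) => //; exact: closed_span_gen.
  exists (fun i => (g e0 ^+ k)^-1 * c i).
  have : polynomial_of Q e0 = \sum_(i < m) c i *: polynomial_of (d i) e0.
    by rewrite QdE polynomial_of_sum.
  rewrite QE Te0 => /(congr1 (fun v => (g e0 ^+ k)^-1 *: v)).
  rewrite scalerA mulVf// scale1r => ->; rewrite scaler_sumr.
  by apply: eq_bigr => i _; rewrite scalerA.
- move=> Q [z wz QE]; have [z0|z0] := eqVneq z 0.
    right; apply/val_inj/funext => x.
    by rewrite -[LHS]/(polynomial_of Q x) QE z0 T0 -[RHS]/(polynomial_of 0 x) polynomial_of0.
  left => -[_]; rewrite QE.
  have [m hm] : exists m, h m z != 0.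
    apply: contrapT => nh; move/eqP: z0; apply; apply: htotal => // m.
    by apply/eqP/negP => /negP hm; apply: nh; exists m.
  exact: perturbed_power_not_compact hm.
Qed.

End spaceability.

Theorem proposition4p1 (R : realType) (b : scalar_kind)
    (E F : completeNormedModType (scalars R b))
    (p q : R) (p1 : 1 <= p) (pq : p < q)
    (s : \bar R) (s1 : (1 <= s)%E) :
  ~ finite_dimensional [set: E] ->
  ~ finite_dimensional [set: F] ->
  p_compact_operators (ell b (lexx 1%E) nat) (ell_bar b s1) q `\`
    p_compact_operators (ell b (lexx 1%E) nat) (ell_bar b s1) p !=set0 ->
  embed_uniformly s1 F ->
  forall k : nat, (2 <= k)%N ->
  let A : set (p_compact_polynomial_space E F k (le_trans p1 (ltW pq))) :=
    [set P | ~ p_compact_polynomials E F k p (polynomial_of P)] in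
  A = set0 \/ spaceable A.
Proof.
move=> Einf Finf _ _ k k2 A.
have [A0|A0] := pselect (A = set0); [by left|right].
have [P AP] : A !=set0 by apply/set0P/eqP.
exact: (@spaceable_difference _ _ E F p q k p1 _ k2 P Einf Finf AP).
Qed.
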